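(* Let $(\xi^*,\zeta^* )\in\mathcal A^\circ_0(\mathbb F^1)\times\mathcal A^\circ_0(\mathbb F^2)$ be an optimal pair. For any $\lambda\in\mathcal T_0(\mathbb F^{1,2})$, set $$\Pi^*_\lambda=\frac{(1-\xi^*_{\lambda-})(1-\zeta^*_{\lambda-})}{\mathsf E[(1-\xi^*_{\lambda-})(1-\zeta^*_{\lambda-})|\mathcal F^{1,2}_\lambda]}$$ with the ratio equal to $1$ where the denominator is $0$, and define $V(\lambda)=J^{\Pi^*_\lambda}(\xi^{*;\lambda},\zeta^{*;\lambda}|\mathcal F^{1,2}_\lambda)$. Then $$V(\lambda)=\operatorname*{ess\,inf}_{\xi\in\mathcal A^\circ_\lambda(\mathbb F^1)}\operatorname*{ess\,sup}_{\zeta\in\mathcal A^\circ_\lambda(\mathbb F^2)}J^{\Pi^*_\lambda}(\xi,\zeta|\mathcal F^{1,2}_\lambda)=\operatorname*{ess\,sup}_{\zeta\in\mathcal A^\circ_\lambda(\mathbb F^2)}\operatorname*{ess\,inf}_{\xi\in\mathcal A^\circ_\lambda(\mathbb F^1)}J^{\Pi^*_\lambda}(\xi,\zeta|\mathcal F^{1,2}_\lambda)$$ on the event $\{\mathsf E[(1-\xi^*_{\lambda-})(1-\zeta^*_{\lambda-})|\mathcal F^{1,2}_\lambda]>0\}$. Moreover, $$\bar V(\lambda)=\mathsf E\big[(1-\xi^*_{\lambda-})(1-\zeta^*_{\lambda-})\big|\mathcal F^{1,2}_\lambda\big]V(\lambda),$$ where $$\bar V(\lambda)=\mathsf E\Big[\int_{[\lambda,T)}(1-\zeta^*_t)f_t\,d\xi^*_t+\int_{[\lambda,T)}\big[(1-\xi^*_t)g_t+h_t\Delta\xi^*_t\big]d\zeta^*_t+h_T\Delta\zeta^*_T\Delta\xi^*_T\Big|\mathcal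 F^{1,2}_\lambda\Big].$$
   Context: Let $T\in(0,\infty)$ and let $(\Omega,\mathcal F,\mathsf P)$ be a complete probability space with a right-continuous filtration $\mathbb F=(\mathcal F_t)_{t\in[0,T]}$ completed with $\mathsf P$-null sets, $\mathcal F_T\subsetneq\mathcal F$. Right-continuous filtrations $\mathbb F^i=(\mathcal F^i_t)_{t\in[0,T]}$, $i=1,2$, completed with null sets, satisfy $\mathcal F^1_t\vee\mathcal F^2_t\subseteq\mathcal F_t$. The common filtration is $\mathbb F^{1,2}=(\mathcal F^{1,2}_t)_{t\in[0,T]}$, $\mathcal F^{1,2}_t=\mathcal F^1_t\cap\mathcal F^2_t$. Equalities/inequalities between random variables are $\mathsf P$-a.s. $\mathcal L_b(\mathsf P)$ is the space of càdlàg $\mathcal B([0,T])\times\mathcal F$-measurable $X$ with $\mathsf E[\sup_{0\le t\le T}|X_t|]<\infty$. The payoff processes $f,g,h\in\mathcal L_b(\mathsf P)$ are $\mathbb F$-adapted with $f_t\ge h_t\ge g_t$ for all $t\in[0,T]$ a.s. For a filtration $\mathbb G\subseteq\mathbb F$ and a $\mathbb G$-stopping time $\theta\in[0,T]$: $\mathcal T_\theta(\mathbb G)$ is the set of $\mathbb G$-stopping times with values in $[\theta,T]$; $\mathcal A^\circ_\theta(\mathbb G)$ is the set of $\mathbb G$-adapted càdlàg non-decreasing $\rho$ with $\rho_{\theta-}=0$, $\rho_T=1$ (for $\theta=0$, $\rho_{0-}:=0$, so $d\rho$ may charge $\{0\}$); $\Delta\rho_t=\rho_t-\rho_{t-}$.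 The $\mathbb G$-randomised stopping time generated by $\rho\in\mathcal A^\circ_\theta(\mathbb G)$ is $\eta=\inf\{t\in[0,T]:\rho_t>Z\}$ with $Z\sim U([0,1])$ independent of $\mathcal F_T$; the class of these is $\mathcal T^R_\theta(\mathbb G)$. The randomisation devices $Z$ of the two players are independent. Game: $\mathcal P(\tau,\sigma)=f_\tau\mathbf 1_{\{\tau<\sigma\}}+h_\tau\mathbf 1_{\{\tau=\sigma\}}+g_\sigma\mathbf 1_{\{\sigma<\tau\}}$; Player 1 picks $\tau\in\mathcal T^R_0(\mathbb F^1)$ to minimise, Player 2 picks $\sigma\in\mathcal T^R_0(\mathbb F^2)$ to maximise $\mathsf E[\mathcal P(\tau,\sigma)]$. A pair $(\xi^*,\zeta^* )\in\mathcal A^\circ_0(\mathbb F^1)\times\mathcal A^\circ_0(\mathbb F^2)$ is optimal if it generates a saddle point $(\tau_*,\sigma_* )$: $\mathsf E[\mathcal P(\tau_*,\sigma)]\le\mathsf E[\mathcal P(\tau_*,\sigma_* )]\le\mathsf E[\mathcal P(\tau,\sigma_* )]$ for all $(\tau,\sigma)\in\mathcal T^R_0(\mathbb F^1)\times\mathcal T^R_0(\mathbb F^2)$. Truncated controls: for a stopping time $\eta$, $\xi^{*;\eta}_t=\frac{\xi^*_t-\xi^*_{\eta-}}{1-\xi^*_{\eta-}}\mathbf 1_{\{t\ge\eta\}}$, $\zeta^{*;\eta}_t=\frac{\zeta^*_t-\zeta^*_{\eta-}}{1-\zeta^*_{\eta-}}\mathbf 1_{\{t\ge\eta\}}$, with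 $0/0=1$ and $\xi^{*;\eta}_{\eta-}=\zeta^{*;\eta}_{\eta-}=0$. For a random variable $\Pi\ge0$, a $\sigma$-algebra $\mathcal G$, and $\xi,\zeta$ started at $\theta$, $$J^\Pi(\xi,\zeta|\mathcal G)=\mathsf E\Big[\Pi\Big(\int_{[\theta,T)}f_t(1-\zeta_t)d\xi_t+\int_{[\theta,T)}g_t(1-\xi_t)d\zeta_t+\sum_{t\in[\theta,T]}h_t\Delta\zeta_t\Delta\xi_t\Big)\Big|\mathcal G\Big].$$ *)

(* Defs.v *)
From HB Require Import structures.
From mathcomp Require Import all_boot all_order all_algebra.
From mathcomp Require Import all_classical all_reals all_analysis.
From mathcomp Require Import measurable_realfun.

Set Implicit Arguments.
Unset Strict Implicit.
Unset Printing Implicit Defensive.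

Import Order.TTheory GRing.Theory Num.Theory.
Import numFieldNormedType.Exports.

Local Open Scope classical_set_scope.
Local Open Scope ring_scope.

(* A process is a function X : R -> Omega -> R of which only the values at
   times in [0, T] matter.  A filtration is a family of sigma-algebras on
   Omega, each given by its collection of sets, of which again only the
   members with index in [0, T] matter. *)

Section paths.
Context {R : realType}.
Variable T : R.
Implicit Types x : R -> R.

Definition cadlag x : Prop :=
  (forall t, 0 <= t < T -> x @ t^'+ --> x t) /\
  (forall t, 0 < t <= T -> cvg (x @ t^'-)).

(* The path of a control, extended to the whole line by 0 before time 0 and by
   its terminal value after T.  This builds in the convention x_{0-} = 0: the
   Stieltjes measure of the extended path has an atom of mass x_0 at 0 and does
   not charge the complement of [0, T]. *)
Definition extend x : R -> R :=
  fun t => if t < 0 then 0 else x (Num.min t T).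

Definition left_lim x t : R := lim (extend x @ t^'-).

Definition jump x t : R := x t - left_lim x t.

Definition cumulative_path (F : R -> R)
    (H : nondecreasing F /\ right_continuous F) : cumulative R R :=
  HB.pack_for (cumulative R R) F
    (isCumulative.Build R _ R F (proj1 H) (proj2 H)).

(* The measure dx; it is the Lebesgue-Stieltjes measure whenever x is cadlag
   and non-decreasing with x_0 >= 0, and is only totalised by 0 elsewhere. *)
Definition stieltjes x : {measure set (measurableTypeR R) -> \bar R} :=
  match pselect (nondecreasing (extend x) /\ right_continuous (extend x)) with
  | left H => lebesgue_stieltjes_measure (cumulative_path H)
  | right _ => mzero
  end.

End paths.

(* \esum is a supremum of finite sums, hence only meaningful for nonnegative
   terms. *)
Definition signed_sum {R : realType} (D : set R) (a : R -> R) : R :=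
  fine (\esum_(t in D) (a^\+ t)%:E) - fine (\esum_(t in D) (a^\- t)%:E).

Definition ratio1 {R : realType} (x y : R) : R := if y == 0 then 1 else x / y.

Section probability_space.
Context {R : realType} {d : measure_display} {Omega : measurableType d}.
Variable P : probability Omega R.
Implicit Types (G : set (set Omega)) (X Y : Omega -> \bar R).

Definition measurable_wrt {d'} {U : sigmaRingType d'} G (X : Omega -> U) :=
  forall B, measurable B -> G (X @^-1` B).

(* Conditional expectations are taken in the generalised sense, with values in
   [0, +oo] for nonnegative variables, and by difference for the others:
   E[Pi * X | G] may be a.s. finite although Pi * X is not integrable. *)
Definition is_cond_exp_ge0 G X Y : Prop :=
  [/\ measurable_wrt G Y,
      forall w, (0 <= Y w)%E
    & forall A, G A -> (\int[P]_(w in A) Y w = \int[P]_(w in A) X w)%E].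

Definition cond_exp_ge0 G X : Omega -> \bar R :=
  xget (cst 0%E) [set Y | is_cond_exp_ge0 G X Y].

Definition cond_exp G X : Omega -> \bar R :=
  fun w => (cond_exp_ge0 G X^\+ w - cond_exp_ge0 G X^\- w)%E.

(* Essential infimum and supremum of a family of random variables (as opposed
   to the numbers ess_inf X and ess_sup X attached to one variable). *)
Definition is_essinf (S : set (Omega -> \bar R)) Y : Prop :=
  [/\ measurable_fun setT Y,
      forall X, S X -> \forall w \ae P, (Y w <= X w)%E
    & forall Y', measurable_fun setT Y' ->
        (forall X, S X -> \forall w \ae P, (Y' w <= X w)%E) ->
        \forall w \ae P, (Y' w <= Y w)%E].

Definition is_esssup (S : set (Omega -> \bar R)) Y : Prop :=
  [/\ measurable_fun setT Y,
      forall X, S X -> \forall w \ae P, (X w <= Y w)%E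
    & forall Y', measurable_fun setT Y' ->
        (forall X, S X -> \forall w \ae P, (X w <= Y' w)%E) ->
        \forall w \ae P, (Y w <= Y' w)%E].

Definition essinf_family (S : set (Omega -> \bar R)) : Omega -> \bar R :=
  xget (cst 0%E) [set Y | is_essinf S Y].

Definition esssup_family (S : set (Omega -> \bar R)) : Omega -> \bar R :=
  xget (cst 0%E) [set Y | is_esssup S Y].

End probability_space.

Section filtrations.
Context {R : realType} {d : measure_display} {Omega : measurableType d}.
Variables (P : probability Omega R) (T : R).
Implicit Types (G : R -> set (set Omega)) (X : R -> Omega -> R).

Record usual_filtration G : Prop := UsualFiltration {
  filtration_sigma_algebra :
    forall t, 0 <= t <= T -> sigma_algebra setT (G t) ;
  filtration_sub : forall t, 0 <= t <= T -> G t `<=` d.-measurable ;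
  filtration_mono : forall s t, 0 <= s -> s <= t -> t <= T -> G s `<=` G t ;
  filtration_right_continuous :
    forall t, 0 <= t < T -> \bigcap_(u in `]t, T]) G u = G t ;
  filtration_null_sets : forall t, 0 <= t <= T -> P.-negligible `<=` G t }.

Definition adapted G X : Prop :=
  forall t, 0 <= t <= T -> measurable_wrt (G t) (X t).

Definition Lb : set (R -> Omega -> R) :=
  [set X | [/\ forall w, cadlag T (X^~ w),
               measurable_fun (`[0, T] `*` [set: Omega])
                 (fun p : R * Omega => X p.1 p.2)
             & (\int[P]_w ereal_sup [set `|X t w|%:E | t in `[0%R, T]] < +oo)%E
           ]].

Definition stopping_times G (theta : Omega -> R) : set (Omega -> R) :=
  [set tau | (forall w, theta w <= tau w <= T) /\
             (forall t, 0 <= t <= T -> G t [set w | tau w <= t])].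

Definition stopped_sigma_algebra G (theta : Omega -> R) : set (set Omega) :=
  [set A | G T A /\
           forall t, 0 <= t <= T -> G t (A `&` [set w | theta w <= t])].

(* Monotonicity of the extended path includes 0 = rho_{0-} <= rho_0. *)
Definition controls G (theta : Omega -> R) : set (R -> Omega -> R) :=
  [set rho | [/\ adapted G rho,
                 forall w, cadlag T (rho^~ w),
                 forall w, nondecreasing (extend T (rho^~ w)),
                 \forall w \ae P, left_lim T (rho^~ w) (theta w) = 0
               & \forall w \ae P, rho T w = 1]].

(* Z1 and Z2 are uniform on [0, 1], and Z1, Z2 and the sigma-algebra FT are
   mutually independent. *)
Definition randomisation_devices (FT : set (set Omega))
    (Z1 Z2 : {RV P >-> R}) : Prop :=
  [/\ forall B, measurable B -> distribution P Z1 B = uniform_prob (@ltr01 R) B,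
      forall B, measurable B -> distribution P Z2 B = uniform_prob (@ltr01 R) B
    & forall B1 B2 A, measurable B1 -> measurable B2 -> FT A ->
        (P (Z1 @^-1` B1 `&` Z2 @^-1` B2 `&` A) =
         P (Z1 @^-1` B1) * P (Z2 @^-1` B2) * P A)%E].

(* On the event Z >= rho_T, which is null for Z uniform, the infimum of the
   empty set is 0 by convention. *)
Definition randomised_time X (Z : Omega -> R) : Omega -> R :=
  fun w => inf [set t | 0 <= t <= T /\ Z w < X t w].

Definition randomised_stopping_times G (theta : Omega -> R) (Z : Omega -> R)
    : set (Omega -> R) :=
  [set randomised_time rho Z | rho in controls G theta].

End filtrations.

Section game.
Context {R : realType} {d : measure_display} {Omega : measurableType d}.
Variables (P : probability Omega R) (T : R).
Variables (FF F1 F2 : R -> set (set Omega)) (f g h : R -> Omega -> R).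
Implicit Types (tau sigma theta : Omega -> R) (xi zeta : R -> Omega -> R).

Definition payoff tau sigma : Omega -> R := fun w =>
  if tau w < sigma w then f (tau w) w
  else if tau w == sigma w then h (tau w) w
  else g (sigma w) w.

(* The pair (xi, zeta) generates a saddle point.  In every payoff the devices
   of the two players are independent; the value of E[payoff] then does not
   depend on their choice. *)
Definition optimal_pair xi zeta : Prop :=
  [/\ controls P T F1 (cst 0) xi, controls P T F2 (cst 0) zeta
    & exists Z1 Z2 : {RV P >-> R},
      let tau_ := randomised_time T xi Z1 in
      let sigma_ := randomised_time T zeta Z2 in
      [/\ randomisation_devices (FF T) Z1 Z2,
          forall (Z : {RV P >-> R}) sigma,
            randomisation_devices (FF T) Z1 Z ->
            randomised_stopping_times P T F2 (cst 0) Z sigma ->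
            ('E_P[payoff tau_ sigma] <= 'E_P[payoff tau_ sigma_])%E
        & forall (Z : {RV P >-> R}) tau,
            randomisation_devices (FF T) Z Z2 ->
            randomised_stopping_times P T F1 (cst 0) Z tau ->
            ('E_P[payoff tau_ sigma_] <= 'E_P[payoff tau sigma_])%E]].

Definition truncated xi theta : R -> Omega -> R := fun t w =>
  let a := left_lim T (xi^~ w) (theta w) in
  if theta w <= t then ratio1 (xi t w - a) (1 - a) else 0.

Definition J (theta Pi : Omega -> R) (G : set (set Omega)) xi zeta
    : Omega -> \bar R :=
  cond_exp P G (fun w => (Pi w *
    (\int[stieltjes T (xi^~ w)]_(t in `[theta w, T[)
        (f t w * (1 - zeta t w))
     + \int[stieltjes T (zeta^~ w)]_(t in `[theta w, T[)
        (g t w * (1 - xi t w))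
     + signed_sum `[theta w, T] (fun t =>
         h t w * jump T (zeta^~ w) t * jump T (xi^~ w) t)))%:E).

Definition common_at (lambda : Omega -> R) : set (set Omega) :=
  stopped_sigma_algebra T (fun t => F1 t `&` F2 t) lambda.

Definition survival xi zeta (lambda : Omega -> R) : Omega -> R := fun w =>
  (1 - left_lim T (xi^~ w) (lambda w)) *
  (1 - left_lim T (zeta^~ w) (lambda w)).

Definition cond_survival xi zeta (lambda : Omega -> R) : Omega -> \bar R :=
  cond_exp P (common_at lambda) (fun w => (survival xi zeta lambda w)%:E).

Definition PiStar xi zeta (lambda : Omega -> R) : Omega -> R := fun w =>
  ratio1 (survival xi zeta lambda w) (fine (cond_survival xi zeta lambda w)).

Definition value xi zeta (lambda : Omega -> R) : Omega -> \bar R :=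
  J lambda (PiStar xi zeta lambda) (common_at lambda)
    (truncated xi lambda) (truncated zeta lambda).

Definition value_bar xi zeta (lambda : Omega -> R) : Omega -> \bar R :=
  cond_exp P (common_at lambda) (fun w =>
    (\int[stieltjes T (xi^~ w)]_(t in `[lambda w, T[)
        ((1 - zeta t w) * f t w)
     + \int[stieltjes T (zeta^~ w)]_(t in `[lambda w, T[)
        ((1 - xi t w) * g t w + h t w * jump T (xi^~ w) t)
     + h T w * jump T (zeta^~ w) T * jump T (xi^~ w) T)%:E).

Definition upper_value lambda Pi : Omega -> \bar R :=
  essinf_family P
    [set esssup_family P
       [set J lambda Pi (common_at lambda) xi zeta
         | zeta in controls P T F2 lambda]
     | xi in controls P T F1 lambda].

Definition lower_value lambda Pi : Omega -> \bar R :=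
  esssup_family P
    [set essinf_family P
       [set J lambda Pi (common_at lambda) xi zeta
         | xi in controls P T F1 lambda]
     | zeta in controls P T F2 lambda].

End game.

(* Main.v *)
(* Averaging over the randomisation devices turns E[P(tau, sigma)] into the
   expectation of a functional of the paths of the generating controls (a
   randomised time is a quantile of an independent uniform variable).  That
   functional splits at lambda into a part depending on the paths before lambda
   only and the payoff after lambda, which is proportional to the remaining
   masses 1 - xi*_{lambda-} and 1 - zeta*_{lambda-}.  Replacing the optimal
   control of one player after lambda, on an event A of the common information,
   by another control is an admissible deviation of the game started at 0, so
   optimality gives inequalities between integrals over A of
   (1 - xi*_{lambda-}) (1 - zeta*_{lambda-}) times the payoffs from lambda on.
   As A is arbitrary they hold between the conditional expectations, which are
   E[(1 - xi*_{lambda-}) (1 - zeta*_{lambda-}) | F12_lambda] times J: the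
   truncated pair is a saddle point of J wherever this factor is positive. *)
Require Import Defs.
From HB Require Import structures.
From mathcomp Require Import all_boot all_order all_algebra.
From mathcomp Require Import all_classical all_reals all_analysis.
From mathcomp Require Import measurable_realfun.
From mathcomp Require Import ring lra.

Set Implicit Arguments.
Unset Strict Implicit.
Unset Printing Implicit Defensive.

Import Order.TTheory GRing.Theory Num.Theory.
Import numFieldNormedType.Exports.

Local Open Scope classical_set_scope.
Local Open Scope ring_scope.

(** Three obstacles shape the proof. A control is normalised only almost surely, whereas Stieltjes
    integrals are taken path by path: each control is changed on a null event, which every
    filtration contains, into one whose paths are all distribution functions on [0, T]. Integrals
    against the varying Stieltjes measures then become integrals of generalised inverses against one
    fixed uniform law, where Tonelli's theorem gives both the averaging and the measurability. The
    devices are independent of [FF T] only. The averaging therefore takes place on Omega equipped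
    with [FF T], and joint measurability of the payoffs there is derived from adaptedness and right
    continuity. Finally, the weight Pi times a payoff may fail to be integrable. The conditional
    expectation in [J] is handled through nonnegative parts, for which a factor measurable with
    respect to the common information can be pulled out even if the product has infinite integral.
    Where the conditional survival vanishes, only its product with [J] is controlled. *)

Definition mfun_of {d1 d2} {T1 : measurableType d1} {T2 : measurableType d2}
    {phi : T1 -> T2} (mphi : measurable_fun setT phi) : {mfun T1 >-> T2} :=
  HB.pack phi (isMeasurableFun.Build _ _ _ _ _ mphi).

(** * Conditional expectations *)

Section density.
Context d (T : measurableType d) (R : realType) (mu : {measure set T -> \bar R}).
Variable f : T -> \bar R.
Hypotheses (mf : measurable_fun setT f) (f0 : forall x, (0 <= f x)%E).
Local Open Scope ereal_scope.

(** The two proofs are arguments so that the measure instance declared below applies to every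
    [density mf f0]. *)
Definition density of measurable_fun setT f & (forall x, 0 <= f x) :=
  fun A : set T => \int[mu]_(x in A) f x.

Local Notation nu := (density mf f0).

Let nu0 : nu set0 = 0. Proof. exact: integral_set0. Qed.

Let nu_ge0 A : 0 <= nu A. Proof. exact: integral_ge0. Qed.

Let nu_sigma_additive : semi_sigma_additive nu.
Proof. exact: semi_sigma_additive_nng_induced. Qed.

HB.instance Definition _ := isMeasure.Build _ _ _ nu nu0 nu_ge0 nu_sigma_additive.

End density.

Section density_integral.
Context d (T : measurableType d) (R : realType) (P : probability T R).
Variable f : T -> \bar R.
Hypotheses (mf : measurable_fun setT f) (f0 : forall x, (0 <= f x)%E)
  (intf : (\int[P]_x f x < +oo)%E).
Local Open Scope ereal_scope.

(** The density measure is finite and dominated by [P]. Its Radon-Nikodym derivative has the same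
    integrals as [f], hence equals [f] almost everywhere, and the change of variables for the
    derivative carries over. *)
Lemma density_integral (k : T -> \bar R) A : measurable A ->
  measurable_fun setT k -> (forall x, 0 <= k x) ->
  \int[density P mf f0]_(x in A) k x = \int[P]_(x in A) (k x * f x).
Proof.
move=> mA mk k0.
pose nu := density P mf f0.
have nu_fin : fin_num_fun nu.
  move=> B mB; rewrite ge0_fin_numE ?integral_ge0//.
  by apply: le_lt_trans intf; apply: ge0_subset_integral.
pose nuF := HB.pack_for {finite_measure set T -> \bar R} nu
  (Measure_isFinite.Build _ _ _ nu nu_fin).
have dom : nuF `<< P.
  apply/null_content_dominatesP => B mB PB.
  by rewrite /= /nu /density null_set_integral//; exact: measurable_funTS.
have intRN := Radon_Nikodym_SigmaFinite.f_integrable dom.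
have mRN := measurable_int _ intRN.
have aeq : ae_eq P setT (Radon_Nikodym_SigmaFinite.f nuF P) f.
  apply: integral_ae_eq => // E _ mE.
  by rewrite -Radon_Nikodym_SigmaFinite.f_integral.
have f_fin := Radon_Nikodym_SigmaFinite.f_ge0 dom.
apply: (etrans (esym (@Radon_Nikodym_SigmaFinite.change_of_variables
  _ _ _ nuF P dom k A k0 mA (measurable_funTS mk)))).
apply: ge0_ae_eq_integral => //.
- exact/measurable_funTS/emeasurable_funM.
- exact/measurable_funTS/emeasurable_funM.
- by move=> x _; exact: mule_ge0.
- by move=> x _; exact: mule_ge0.
- by apply: filterS aeq => x /(_ I) ->.
Qed.

End density_integral.

Section sub_sigma_algebra.
Context {R : realType} {d : measure_display} {Omega : measurableType d}.
Variables (P : probability Omega R) (G : set (set Omega)).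
Hypotheses (sG : sigma_algebra setT G) (Gm : G `<=` d.-measurable).
Local Open Scope ereal_scope.

Local Notation OmegaG := (g_sigma_algebraType G).

Lemma measurable_wrtP {d'} {U : sigmaRingType d'} (X : Omega -> U) :
  measurable_wrt G X <-> measurable_fun setT (X : OmegaG -> U).
Proof.
have GE := measurable_g_measurableTypeE sG.
split=> [mX _ B mB|mX B mB]; first by rewrite setTI GE; exact: mX.
by have := mX measurableT B mB; rewrite setTI GE.
Qed.

Lemma measurable_wrtW {d'} {U : sigmaRingType d'} (X : Omega -> U) :
  measurable_wrt G X -> measurable_fun setT (X : OmegaG -> U).
Proof. by move/measurable_wrtP. Qed.

(** The target is the same set with fewer measurable subsets: pushing a measure forward along this
    map restricts it to [G]. *)
Lemma measurable_subidfun : measurable_fun setT (idfun : Omega -> OmegaG).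
Proof.
by move=> _ B mB; rewrite setTI; apply: Gm; rewrite -(measurable_g_measurableTypeE sG).
Qed.

Lemma measurable_wrt_fun {d'} {U : sigmaRingType d'} (X : Omega -> U) :
  measurable_wrt G X -> measurable_fun setT X.
Proof. by move=> mX _ B mB; rewrite setTI; apply: Gm; exact: mX. Qed.

Lemma sub_measurableE A : G A <-> measurable (A : set OmegaG).
Proof. by rewrite (measurable_g_measurableTypeE sG). Qed.

Lemma sub_setT : G setT. Proof. exact/sub_measurableE. Qed.

(** The measures with densities [X] and [Y] agree on [G], and [k] sees only [G], so its integrals
    against them agree. Nothing is approximated, and [k \* X] may have infinite integral. *)
Lemma cond_exp_ge0_pull_out X Y (k : Omega -> \bar R) :
  measurable_fun setT X -> (forall w, 0 <= X w) -> \int[P]_w X w < +oo ->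
  measurable_wrt G k -> (forall w, 0 <= k w) ->
  is_cond_exp_ge0 P G X Y -> is_cond_exp_ge0 P G (k \* X) (k \* Y).
Proof.
move=> mX X0 iX mk k0 [mY Y0 XY].
have mYT := measurable_wrt_fun mY.
have mkT := measurable_wrt_fun mk.
have iY : \int[P]_w Y w < +oo by rewrite XY//; exact: sub_setT.
split.
- apply/measurable_wrtP; apply: emeasurable_funM;
  [exact (measurable_wrtW mk)|exact (measurable_wrtW mY)].
- by move=> w; exact: mule_ge0.
move=> A GA; have mA := Gm GA.
rewrite -(density_integral mX X0 iX mA mkT k0) -(density_integral mYT Y0 iY mA mkT k0).
have mGA : measurable (A : set OmegaG) by exact/sub_measurableE.
have mGk : measurable_fun (A : set OmegaG) (k : OmegaG -> \bar R).
  by apply: measurable_funTS; exact (measurable_wrtW mk).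
have k0' : {in (A : set OmegaG), forall y, 0 <= k y} by move=> y _.
(* Both density measures are pushed forward to [OmegaG], where [k] is still measurable and the two
   measures coincide. *)
rewrite -(ge0_integral_pushforward measurable_subidfun _ mGA mGk k0').
rewrite -(ge0_integral_pushforward measurable_subidfun _ mGA mGk k0').
apply: eq_measure_integral; [exact: measurable_subidfun..|].
move=> ? ? B mB BA.
change (\int[P]_(w in B) Y w = \int[P]_(w in B) X w).
by apply: XY; exact/sub_measurableE.
Qed.

Lemma cond_exp_ge0D X1 X2 Y1 Y2 :
  measurable_fun setT X1 -> (forall w, 0 <= X1 w) ->
  measurable_fun setT X2 -> (forall w, 0 <= X2 w) ->
  is_cond_exp_ge0 P G X1 Y1 -> is_cond_exp_ge0 P G X2 Y2 ->
  is_cond_exp_ge0 P G (X1 \+ X2) (Y1 \+ Y2).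
Proof.
move=> mX1 X10 mX2 X20 [mY1 Y10 XY1] [mY2 Y20 XY2]; split.
- apply/measurable_wrtP; apply: emeasurable_funD;
  [exact (measurable_wrtW mY1)|exact (measurable_wrtW mY2)].
- by move=> w; exact: adde_ge0.
move=> A GA; have mA := Gm GA.
rewrite !ge0_integralD//; first by rewrite XY1// XY2//.
all: try exact: measurable_funTS.
all: exact/measurable_funTS/measurable_wrt_fun.
Qed.

(** A version is the Radon-Nikodym derivative, on [G], of the measure with density [X] relative to
    the restriction of [P]. *)
Lemma cond_exp_ge0_exists X :
  measurable_fun setT X -> (forall w, 0 <= X w) -> \int[P]_w X w < +oo ->
  exists Y, is_cond_exp_ge0 P G X Y.
Proof.
move=> mX X0 iX.
pose PG := distribution P (mfun_of measurable_subidfun).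
pose nu (A : set OmegaG) := \int[P]_(w in A) X w.
have nu0 : nu set0 = 0 by exact: integral_set0.
have nu_ge0 A : 0 <= nu A by exact: integral_ge0.
have sub_mble (A : set OmegaG) : measurable A -> d.-measurable A.
  by move=> /sub_measurableE /Gm.
have nu_add : semi_sigma_additive nu.
  move=> F mF tF mUF.
  apply: (@semi_sigma_additive_nng_induced _ _ _ P X mX X0 F) => //.
  - by move=> i; exact: sub_mble.
  - exact: sub_mble.
have nu_fin : fin_num_fun nu.
  move=> B mB; rewrite ge0_fin_numE//.
  by apply: le_lt_trans iX; apply: ge0_subset_integral => //; exact: sub_mble.
pose nuM := HB.pack_for {measure set OmegaG -> \bar R} nu
  (isMeasure.Build _ _ _ nu nu0 nu_ge0 nu_add).
pose nuF := HB.pack_for {finite_measure set OmegaG -> \bar R} nu nuM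
  (Measure_isFinite.Build _ _ _ nuM nu_fin).
have dom : nuF `<< PG.
  apply/null_content_dominatesP => B mB PB.
  by apply: null_set_integral => //; [exact: sub_mble|exact: measurable_funTS].
pose Y := Radon_Nikodym_SigmaFinite.f nuF PG.
have mY : measurable_fun setT (Y : OmegaG -> \bar R).
  exact: measurable_int (Radon_Nikodym_SigmaFinite.f_integrable dom).
have Y0 w : 0 <= Y w by exact: Radon_Nikodym_SigmaFinite.f_ge0.
exists Y; split => //.
  exact: (measurable_wrtP _).2.
move=> A GA; have mGA : measurable (A : set OmegaG) by exact/sub_measurableE.
have := Radon_Nikodym_SigmaFinite.f_integral dom mGA.
rewrite -[LHS]/(\int[P]_(w in A) X w) => ->.
rewrite ge0_integral_pushforward//.
exact: measurable_funTS.
Qed.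

(** On the event where [Y'] is below [Y] and at most [n], the integral of [Y'] is finite and can be
    subtracted, which forces the event to be null. These events exhaust the failure set, because
    [Y'] is finite there. *)
Lemma cond_exp_ge0_le X X' Y Y' :
  (forall A, G A -> \int[P]_(w in A) X w <= \int[P]_(w in A) X' w) ->
  is_cond_exp_ge0 P G X Y -> is_cond_exp_ge0 P G X' Y' ->
  \forall w \ae P, Y w <= Y' w.
Proof.
move=> XX' [mY Y0 XY] [mY' Y'0 XY'].
have mYT := measurable_wrt_fun mY.
have mY'T := measurable_wrt_fun mY'.
pose A n := [set w | Y' w < Y w] `&` [set w | Y' w <= n%:R%:E].
have GA n : G (A n).
  apply/sub_measurableE.
  apply: measurableI.
  - rewrite -[X in measurable X]setTI; apply: emeasurable_fun_lt => //;
      [exact (measurable_wrtW mY')|exact (measurable_wrtW mY)].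
  - rewrite -[X in measurable X]setTI; apply: emeasurable_fun_le => //;
      exact (measurable_wrtW mY').
have PA n : P (A n) = 0.
  have mA := Gm (GA n).
  have Y'fin w : A n w -> Y' w \is a fin_num.
    by move=> [_ /= h]; rewrite ge0_fin_numE//; apply: le_lt_trans h _; exact: ltry.
  have iY' : \int[P]_(w in A n) Y' w \is a fin_num.
    rewrite ge0_fin_numE; last exact: integral_ge0.
    apply: (@le_lt_trans _ _ (\int[P]_(w in A n) n%:R%:E)).
      apply: ge0_le_integral => //.
        exact: measurable_funTS.
      by move=> w [].
    by rewrite integral_cst// -ge0_fin_numE ?mule_ge0// fin_numM// fin_num_measure.
  have : \int[P]_(w in A n) (Y w - Y' w) <= 0.
    have : \int[P]_(w in A n) Y w <= \int[P]_(w in A n) Y' w by rewrite XY// XY'//; exact: XX'.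
    have -> : \int[P]_(w in A n) Y w = \int[P]_(w in A n) (Y' w + (Y w - Y' w)).
      by apply: eq_integral => w /set_mem wA; rewrite addeC subeK// Y'fin.
    rewrite ge0_integralD//; last 3 first.
    - exact: measurable_funTS.
    - by move=> w Aw; rewrite sube_ge0 ?Y'fin//; case: Aw => h _; exact: ltW.
    - by apply: measurable_funTS; exact: emeasurable_funB.
    by rewrite addeC -leeBrDr// subee.
  move=> I0.
  have : \int[P]_(w in A n) `|Y w - Y' w| = 0.
    apply/eqP; rewrite eq_le integral_ge0// andbT; apply: le_trans I0.
    rewrite le_eqVlt; apply/orP; left; apply/eqP; apply: eq_integral => w /set_mem wA.
    by rewrite gee0_abs// sube_ge0 ?Y'fin//; case: wA => h _; exact: ltW.
  move/(ae_eq_integral_abs P mA (measurable_funTS (emeasurable_funB mYT mY'T))).1.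
  move=> [N [mN N0 sN]]; apply: (subset_measure0 _ mN _ N0) => // w wA.
  apply: sN => /= /(_ wA) e; case: (wA) => h _.
  by move: h; rewrite /= -sube_gt0 e ltxx.
have : P.-negligible (\bigcup_n A n).
  by apply: negligible_bigcup => n; exists (A n); split; [exact: Gm|exact: PA|].
apply: negligibleS => w /=.
move=> /negP; rewrite -ltNge => h; have h' : Y' w \is a fin_num.
  by rewrite ge0_fin_numE//; apply: lt_le_trans h _; exact: leey.
exists (Num.trunc (fine (Y' w))).+1 => //; split => //=.
by rewrite -(fineK h') lee_fin ltW// truncnS_gt.
Qed.

Lemma cond_exp_ge0_unique X Y Y' :
  is_cond_exp_ge0 P G X Y -> is_cond_exp_ge0 P G X Y' ->
  \forall w \ae P, Y w = Y' w.
Proof.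
move=> XY XY'.
have := cond_exp_ge0_le (fun A _ => lexx _) XY XY'.
have := cond_exp_ge0_le (fun A _ => lexx _) XY' XY.
by apply: filterS2 => w h1 h2; apply/le_anti; rewrite h1 h2.
Qed.

End sub_sigma_algebra.

Section signed_cond_exp.
Context {R : realType} {d : measure_display} {Omega : measurableType d}.
Variables (P : probability Omega R) (G : set (set Omega)).
Hypotheses (sG : sigma_algebra setT G) (Gm : G `<=` d.-measurable).
Local Open Scope ereal_scope.

(** When no version exists the chosen value is the constant 0, so measurability is unconditional. *)
Lemma cond_exp_ge0_measurable X : measurable_fun setT (cond_exp_ge0 P G X).
Proof.
rewrite /cond_exp_ge0; case: xgetP => [Y _ [mY _ _]|_].
  exact: measurable_wrt_fun mY.
exact: measurable_cst.
Qed.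

Lemma cond_exp_measurable X : measurable_fun setT (cond_exp P G X).
Proof. by apply: emeasurable_funB; exact: cond_exp_ge0_measurable. Qed.

Lemma cond_exp_ge0P X : (exists Y, is_cond_exp_ge0 P G X Y) ->
  is_cond_exp_ge0 P G X (cond_exp_ge0 P G X).
Proof. exact: xgetPex. Qed.

Lemma cond_exp_ge0_ge0 X w : 0 <= cond_exp_ge0 P G X w.
Proof. by rewrite /cond_exp_ge0; case: xgetP => [Y _ []|_]. Qed.

(** Almost sure equality leaves the set of versions unchanged, so the choice operator returns the
    very same function. Equality everywhere permits plain rewriting later. *)
Lemma cond_exp_ge0_congr X X' : measurable_fun setT X -> measurable_fun setT X' ->
  (\forall w \ae P, X w = X' w) -> cond_exp_ge0 P G X = cond_exp_ge0 P G X'.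
Proof.
move=> mX mX' XX'; rewrite /cond_exp_ge0; congr xget.
apply/seteqP; split=> Y [mY Y0 XY]; split => // A GA; rewrite XY//;
  apply: ae_eq_integral; try exact: Gm; try exact: measurable_funTS.
- by apply: filterS XX' => w ->.
- by apply: filterS XX' => w ->.
Qed.

Lemma cond_exp_congr X X' : measurable_fun setT X -> measurable_fun setT X' ->
  (\forall w \ae P, X w = X' w) -> cond_exp P G X = cond_exp P G X'.
Proof.
move=> mX mX' XX'; rewrite /cond_exp.
rewrite (@cond_exp_ge0_congr X^\+ X'^\+) 1?(@cond_exp_ge0_congr X^\- X'^\-)//;
  try exact: measurable_funepos; try exact: measurable_funeneg.
- by apply: filterS XX' => x; rewrite !funenegE => ->.
- by apply: filterS XX' => x; rewrite !funeposE => ->.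
Qed.

Lemma cond_exp_ge0_integrable X : P.-integrable setT X -> (forall w, 0 <= X w) ->
  is_cond_exp_ge0 P G X (cond_exp_ge0 P G X) /\
  \forall w \ae P, cond_exp_ge0 P G X w \is a fin_num.
Proof.
move=> iX X0.
have XY : is_cond_exp_ge0 P G X (cond_exp_ge0 P G X).
  apply: cond_exp_ge0P; apply: cond_exp_ge0_exists => //.
  - exact: measurable_int iX.
  - exact: integrable_lty.
split=> //.
have : P.-integrable setT (cond_exp_ge0 P G X).
  apply/integrableP; split; first exact: cond_exp_ge0_measurable.
  under eq_integral do rewrite gee0_abs ?cond_exp_ge0_ge0//.
  case: XY => _ _ ->; last exact: sub_setT.
  exact: integrable_lty.
by move/(integrable_ae measurableT); apply: filterS => w; apply.
Qed.

Lemma integrable_pos (X : Omega -> R) : P.-integrable setT (EFin \o X) ->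
  is_cond_exp_ge0 P G (EFin \o X)^\+ (cond_exp_ge0 P G (EFin \o X)^\+) /\
  \forall w \ae P, cond_exp_ge0 P G (EFin \o X)^\+ w \is a fin_num.
Proof.
move=> iX; apply: cond_exp_ge0_integrable; last exact: funepos_ge0.
exact: integrable_funepos.
Qed.

Lemma integrable_neg (X : Omega -> R) : P.-integrable setT (EFin \o X) ->
  is_cond_exp_ge0 P G (EFin \o X)^\- (cond_exp_ge0 P G (EFin \o X)^\-) /\
  \forall w \ae P, cond_exp_ge0 P G (EFin \o X)^\- w \is a fin_num.
Proof.
move=> iX; apply: cond_exp_ge0_integrable; last exact: funeneg_ge0.
exact: integrable_funeneg.
Qed.

Lemma cond_exp_fin_num (X : Omega -> R) : P.-integrable setT (EFin \o X) ->
  \forall w \ae P, cond_exp P G (EFin \o X) w \is a fin_num.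
Proof.
move=> iX; have [_ p] := integrable_pos iX; have [_ n] := integrable_neg iX.
by apply: filterS2 p n => w pw nw; rewrite /cond_exp fin_numB pw nw.
Qed.

(** Moving the negative parts to the other side reduces the claim to nonnegative variables; the four
    conditional expectations are almost surely finite and can be moved back. *)
Lemma cond_exp_le (X X' : Omega -> R) :
  P.-integrable setT (EFin \o X) -> P.-integrable setT (EFin \o X') ->
  (forall A, G A -> \int[P]_(w in A) (X w)%:E <= \int[P]_(w in A) (X' w)%:E) ->
  \forall w \ae P, cond_exp P G (EFin \o X) w <= cond_exp P G (EFin \o X') w.
Proof.
move=> iX iX' XX'.
have [Xp pf] := integrable_pos iX; have [Xn nf] := integrable_neg iX.
have [X'p p'f] := integrable_pos iX'; have [X'n n'f] := integrable_neg iX'.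
have mX := measurable_int _ iX; have mX' := measurable_int _ iX'.
have mXp := measurable_funepos mX; have mXn := measurable_funeneg mX.
have mXp' := measurable_funepos mX'; have mXn' := measurable_funeneg mX'.
have H1 := cond_exp_ge0D sG Gm mXp (funepos_ge0 _) mXn' (funeneg_ge0 _) Xp X'n.
have H2 := cond_exp_ge0D sG Gm mXp' (funepos_ge0 _) mXn (funeneg_ge0 _) X'p Xn.
have le A : G A -> \int[P]_(w in A) ((EFin \o X)^\+ \+ (EFin \o X')^\-) w <=
    \int[P]_(w in A) ((EFin \o X')^\+ \+ (EFin \o X)^\-) w.
  move=> GA; have mA := Gm GA.
  have iXA : P.-integrable A (EFin \o X) by exact: integrableS iX.
  have iXA' : P.-integrable A (EFin \o X') by exact: integrableS iX'.
  have := XX' _ GA; rewrite integralE (integralE _ _ (fun w => (X' w)%:E)).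
  rewrite !ge0_integralD//; try exact: measurable_funTS.
  have := integrable_pos_fin_num mA iXA; have := integrable_neg_fin_num mA iXA.
  have := integrable_pos_fin_num mA iXA'; have := integrable_neg_fin_num mA iXA'.
  rewrite /=.
  move: (\int[P]_(w in A) _) (\int[P]_(w in A) _) (\int[P]_(w in A) _) (\int[P]_(w in A) _).
  move=> [a| |] [b| |] [c| |] [e| |]//= _ _ _ _.
  rewrite -!EFinB -!EFinD !lee_fin.
  lra.
have := cond_exp_ge0_le sG Gm le H1 H2.
apply: filterS3 (filterI pf nf) (filterI p'f n'f) => w [p n] [p' n'] /=.
rewrite /cond_exp.
move: p n p' n'.
move: (cond_exp_ge0 _ _ _ _) (cond_exp_ge0 _ _ _ _) (cond_exp_ge0 _ _ _ _) (cond_exp_ge0 _ _ _ _).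
move=> [a| |] [b| |] [c| |] [e| |]//= _ _ _ _.
rewrite -!EFinB -!EFinD !lee_fin.
lra.
Qed.

End signed_cond_exp.

(** Squaring makes the base nonnegative, where the power -1 is the inverse; at 0 both sides are 0 by
    the convention for inverses. *)
Lemma measurable_invr (R : realType) : measurable_fun setT (fun x : R => x^-1).
Proof.
rewrite (_ : (fun x : R => x^-1) = (fun x => x * (x ^+ 2) `^ (-1))); last first.
  apply/funext => x; rewrite powR_inv1 ?sqr_ge0//.
  by have [->|x0] := eqVneq x 0; [rewrite invr0 mul0r|field].
apply: measurable_funM => //.
apply: (@measurableT_comp _ _ _ _ _ _ (fun y : R => y `^ (-1))).
  exact: measurable_powR.
exact: exprn_measurable.
Qed.

Lemma measurable_funV d (T : measurableType d) (R : realType) (D : set T) (f : T -> R) :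
  measurable_fun D f -> measurable_fun D (fun x => (f x)^-1).
Proof. move=> mf; apply: (@measurableT_comp _ _ _ _ _ _ (fun y : R => y^-1)) => //.
exact: measurable_invr. Qed.

Section cond_exp_ratio.
Context {R : realType} {d : measure_display} {Omega : measurableType d}.
Variables (P : probability Omega R) (G : set (set Omega)).
Hypotheses (sG : sigma_algebra setT G) (Gm : G `<=` d.-measurable).
Local Open Scope ereal_scope.
Variable S : Omega -> R.
Hypotheses (iS : P.-integrable setT (EFin \o S)) (S0 : forall w, (0 <= S w)%R).

Let e := cond_exp_ge0 P G (EFin \o S).
Let Pi w := ratio1 (S w) (fine (e w)).

Let e0 w : 0 <= e w. Proof. exact: cond_exp_ge0_ge0. Qed.

Let Sint := cond_exp_ge0_integrable sG Gm iS (fun w => S0 w).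

Let me : measurable_wrt G e. Proof. by have [[]] := Sint. Qed.

Let mS : measurable_fun setT S.
Proof. by apply/measurable_EFinP; exact: measurable_int iS. Qed.

Let Ge0 : G [set w | e w = 0].
Proof. by apply: (me (B := [set 0])); exact: emeasurable_set1. Qed.

(** The event lies in [G], so [S] and its conditional expectation have the same integral over it,
    namely 0, and [S] is nonnegative. *)
Let S_eq0 : \forall w \ae P, e w = 0 -> S w = 0%R.
Proof.
have [[_ _ eS] _] := Sint.
have m0 := Gm Ge0.
have : \int[P]_(w in [set w | e w = 0]) `|(S w)%:E| = 0.
  under eq_integral do rewrite gee0_abs ?lee_fin//.
  by rewrite -eS// integral0_eq// => w /=.
move/(ae_eq_integral_abs P m0 (measurable_funTS (measurable_int _ iS))).1.
by apply: filterS => w /= h /h [].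
Qed.

Lemma ratio1_ge0 w : (0 <= Pi w)%R.
Proof. by rewrite /Pi /ratio1; case: ifPn => // _; rewrite divr_ge0// fine_ge0. Qed.

Lemma measurable_ratio1 : measurable_fun setT Pi.
Proof.
have mfe : measurable_fun setT (fun w => fine (e w)).
  by apply: (@measurableT_comp _ _ _ _ _ _ (@fine R)); [exact: fine_measurable|]; exact: measurable_wrt_fun me.
rewrite /Pi /ratio1; apply: measurable_fun_ifT => //.
- apply: measurable_fun_eqr => //; exact: measurable_cst.
- apply: measurable_funM => //.
  exact: measurable_funV.
Qed.

(** [Pi] is not [G]-measurable, but [Pi \* X] is the sum of [S \* X] and [X], each with a
    [G]-measurable weight. Multiplication by [e] cancels the first weight and kills the second. *)
Lemma cond_exp_ge0_ratio1 (X : Omega -> R) :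
  P.-integrable setT (EFin \o X) -> (forall w, (0 <= X w)%R) ->
  P.-integrable setT (EFin \o (S \* X)%R) ->
  is_cond_exp_ge0 P G (EFin \o (Pi \* X)%R) (cond_exp_ge0 P G (EFin \o (Pi \* X)%R)) /\
  \forall w \ae P, e w * cond_exp_ge0 P G (EFin \o (Pi \* X)%R) w =
                   cond_exp_ge0 P G (EFin \o (S \* X)%R) w.
Proof.
move=> iX X0 iSX.
have SX0 w : (0 <= (S \* X) w)%R by exact: mulr_ge0.
have [XY _] := cond_exp_ge0_integrable sG Gm iX (fun w => X0 w).
have [SXY SXf] := cond_exp_ge0_integrable sG Gm iSX (fun w => SX0 w).
set YX := cond_exp_ge0 P G (EFin \o X) in XY *.
set YS := cond_exp_ge0 P G _ in SXY SXf *.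
have mX : measurable_fun setT (EFin \o X) := measurable_int _ iX.
have mSX : measurable_fun setT (EFin \o (S \* X)%R) := measurable_int _ iSX.
have mef : measurable_wrt G e := me.
(* [k] inverts [e] where it is nonzero and [k'] is the indicator of the remaining event: the two
   branches of [ratio1]. *)
pose k w : \bar R := if fine (e w) == 0%R then 0 else ((fine (e w))^-1)%:E.
pose k' w : \bar R := if fine (e w) == 0%R then 1 else 0.
have mfe : measurable_fun setT ((fun w => fine (e w)) : g_sigma_algebraType G -> R).
  apply: (@measurableT_comp _ _ _ _ _ _ (@fine R)); [exact: fine_measurable|]; exact: (measurable_wrtW sG mef).
have mk : measurable_wrt G k.
  apply: (measurable_wrtP sG _).2; apply: measurable_fun_ifT => //.
  - by apply: measurable_fun_eqr => //; exact: measurable_cst.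
  - apply/measurable_EFinP; exact: measurable_funV.
have mk' : measurable_wrt G k'.
  apply: (measurable_wrtP sG _).2; apply: measurable_fun_ifT => //.
  by apply: measurable_fun_eqr => //; exact: measurable_cst.
have k0 w : 0 <= k w.
  by rewrite /k; case: ifPn => // _; rewrite lee_fin invr_ge0 fine_ge0.
have k'0 w : 0 <= k' w by rewrite /k'; case: ifPn.
have V1 := cond_exp_ge0_pull_out sG Gm mSX (fun w => SX0 w) (integrable_lty measurableT iSX) mk k0 SXY.
have V2 := cond_exp_ge0_pull_out sG Gm mX (fun w => X0 w) (integrable_lty measurableT iX) mk' k'0 XY.
have mkT := measurable_wrt_fun Gm mk; have mkT' := measurable_wrt_fun Gm mk'.
have kSX0 w : 0 <= k w * ((S \* X)%R w)%:E by rewrite mule_ge0// lee_fin SX0.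
have kX0 w : 0 <= k' w * (X w)%:E by rewrite mule_ge0// lee_fin X0.
have V := cond_exp_ge0D sG Gm (emeasurable_funM mkT mSX) kSX0
  (emeasurable_funM mkT' mX) kX0 V1 V2.
have {}V : is_cond_exp_ge0 P G (EFin \o (Pi \* X)%R) ((k \* YS) \+ (k' \* YX)).
  suff -> : EFin \o (Pi \* X)%R = (k \* (EFin \o (S \* X)%R)) \+ (k' \* (EFin \o X)) by [].
  apply/funext => w; rewrite /= /k /k' /Pi /ratio1; case: ifPn => _.
    by rewrite mul0e mul1e add0e mul1r.
  by rewrite mul0e adde0 -EFinM; congr EFin; ring.
have VV := cond_exp_ge0P (ex_intro _ _ V).
split=> //.
have [_ efin] := Sint.
(* Where [e] vanishes so does [S], hence both sides of the claimed identity are 0 there. *)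
have SX_eq0 : \forall w \ae P, e w = 0 -> YS w = 0.
  have [mYS YS0 YSE] := SXY.
  have m0 := Gm Ge0.
  have : \int[P]_(w in [set w | e w = 0]) `|YS w| = 0.
    under eq_integral do rewrite gee0_abs//.
    rewrite YSE//.
    rewrite (ae_eq_integral (cst 0)) ?integral0//; first exact: measurable_funTS.
    by apply: filterS S_eq0 => w /= h /h ->; rewrite mul0r.
  move/(ae_eq_integral_abs P m0 (measurable_funTS (measurable_wrt_fun Gm mYS))).1.
  by apply: filterS => w /= h /h.
have U := cond_exp_ge0_unique sG Gm V VV.
apply: filterS3 U (filterI efin SXf) SX_eq0 => w <- [ef Sf] h.
rewrite /k /k'; have [fe0|fe0] := eqVneq (fine (e w)) 0%R.
  have ew0 : e w = 0 by rewrite -[LHS](fineK ef) fe0.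
  by rewrite h// ew0 mul0e.
have ee : e w = (fine (e w))%:E by rewrite fineK.
rewrite mul0e adde0 muleA {1}ee -EFinM divff//.
by rewrite /= ?mul1e.
Qed.

End cond_exp_ratio.

Lemma measurable_fun_ratio1 d (T : measurableType d) (R : realType) (f g : T -> R) :
  measurable_fun setT f -> measurable_fun setT g ->
  measurable_fun setT (fun w => ratio1 (f w) (g w)).
Proof.
move=> mf mg; apply: measurable_fun_ifT => //.
- by apply: measurable_fun_eqr => //; exact: measurable_cst.
- by apply: measurable_funM => //; exact: measurable_funV.
Qed.

Lemma ae_and d (T : measurableType d) (R : realType) (mu : {measure set T -> \bar R})
    (A B : T -> Prop) :
  (\forall w \ae mu, A w) -> (\forall w \ae mu, B w) -> \forall w \ae mu, A w /\ B w.
Proof. by move=> hA hB; apply: filterS2 hA hB. Qed.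

Section cond_exp_ratio_signed.
Context {R : realType} {d : measure_display} {Omega : measurableType d}.
Variables (P : probability Omega R) (G : set (set Omega)).
Hypotheses (sG : sigma_algebra setT G) (Gm : G `<=` d.-measurable).
Local Open Scope ereal_scope.
Variable S : Omega -> R.
Hypotheses (iS : P.-integrable setT (EFin \o S)) (S0 : \forall w \ae P, (0 <= S w)%R).

Let S' := (S^\+)%R.

Let S'0 w : (0 <= S' w)%R. Proof. exact: funrpos_ge0. Qed.

Let iS' : P.-integrable setT (EFin \o S'). Proof. exact: integrable_funrpos. Qed.

Let SS' : \forall w \ae P, S w = S' w.
Proof. by apply: filterS S0 => w h; rewrite /S' /funrpos; apply/esym/max_idPl. Qed.

Let e := cond_exp_ge0 P G (EFin \o S').
Let E := cond_exp P G (EFin \o S).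
Let Pi w := ratio1 (S w) (fine (E w)).

Lemma cond_exp_ae_ge0 : \forall w \ae P, E w = e w.
Proof.
rewrite /E (cond_exp_congr Gm (X' := EFin \o S')); last 3 first.
- exact: measurable_int iS.
- exact: measurable_int iS'.
- by apply: filterS SS' => w /= ->.
rewrite /cond_exp.
have -> : (EFin \o S')^\+ = EFin \o S'.
  by apply/funext => w; rewrite (ge0_funeposE (D := setT)) ?inE// => x _; rewrite lee_fin.
have -> : (EFin \o S')^\- = cst 0.
  by apply/funext => w; rewrite (ge0_funenegE (D := setT)) ?inE// => x _; rewrite lee_fin.
have i0 : P.-integrable setT (cst 0 : Omega -> \bar R) by exact: integrable0.
have [V _] := cond_exp_ge0_integrable sG Gm i0 (fun w => lexx _).
have V0 : is_cond_exp_ge0 P G (cst 0) (cst 0).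
  split=> // B mB; rewrite preimage_cst; case: ifPn => _; first exact: sub_setT.
  by apply/(sub_measurableE sG); exact: measurable0.
by apply: filterS (cond_exp_ge0_unique sG Gm V V0) => w ->; rewrite sube0.
Qed.

(** The two parts of [X] are treated separately. Weighted by [Pi] their conditional expectations may
    be infinite, but only where [E] is 0, and there both sides are 0. Where [E] is positive,
    finiteness of the parts weighted by [S] makes them finite, and the product distributes over the
    difference. *)
Lemma cond_exp_ratio (X : Omega -> R) :
  P.-integrable setT (EFin \o X) -> P.-integrable setT (EFin \o (S \* X)%R) ->
  \forall w \ae P, cond_exp P G (EFin \o (S \* X)%R) w =
                   E w * cond_exp P G (EFin \o (Pi \* X)%R) w.
Proof.
move=> iX iSX.
have mS := measurable_int _ iS; have mS' := measurable_int _ iS'.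
have mX := measurable_int _ iX.
have {}mS : measurable_fun setT S by apply/measurable_EFinP.
have {}mS' : measurable_fun setT S' by apply/measurable_EFinP.
have {}mX : measurable_fun setT X by apply/measurable_EFinP.
pose Pi' w := ratio1 (S' w) (fine (e w)).
have mPi : measurable_fun setT Pi.
  apply: measurable_fun_ratio1 => //.
  apply: (@measurableT_comp _ _ _ _ _ _ (@fine R)); first exact: fine_measurable.
  exact: cond_exp_measurable.
have mPi' : measurable_fun setT Pi' by exact: measurable_ratio1.
have PiPi' : \forall w \ae P, Pi w = Pi' w.
  by apply: filterS2 cond_exp_ae_ge0 SS' => w h1 h2; rewrite /Pi /Pi' h1 h2.
have Pi'0 w : (0 <= Pi' w)%R by exact: ratio1_ge0.
have iS'X : P.-integrable setT (EFin \o (S' \* X)%R).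
  apply: (le_integrable measurableT _ _ iSX).
    by apply/measurable_EFinP; exact: measurable_funM.
  move=> w _; rewrite lee_fin /= !normrM ler_wpM2r// /S' /funrpos.
  by rewrite maxEle; case: ifPn => //; rewrite normr0.
rewrite (cond_exp_congr Gm (X := EFin \o (S \* X)%R) (X' := EFin \o (S' \* X)%R)); last 3 first.
- exact: measurable_int iSX.
- exact: measurable_int iS'X.
- by apply: filterS SS' => w /= ->.
rewrite (cond_exp_congr Gm (X := EFin \o (Pi \* X)%R) (X' := EFin \o (Pi' \* X)%R)); last 3 first.
- by apply/measurable_EFinP; exact: measurable_funM.
- by apply/measurable_EFinP; exact: measurable_funM.
- by apply: filterS PiPi' => w /= ->.
have posM (k : Omega -> R) : (forall w, 0 <= k w)%R ->
    (EFin \o (k \* X)%R)^\+ = EFin \o (k \* X^\+)%R.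
  move=> k0; rewrite funerpos; apply/funext => w /=; congr EFin.
  by rewrite /funrpos maxr_pMr// mulr0.
have negM (k : Omega -> R) : (forall w, 0 <= k w)%R ->
    (EFin \o (k \* X)%R)^\- = EFin \o (k \* X^\-)%R.
  move=> k0; rewrite funerneg; apply/funext => w /=; congr EFin.
  by rewrite /funrneg maxr_pMr// mulr0 mulrN.
have iXp : P.-integrable setT (EFin \o X^\+%R) by exact: integrable_funrpos.
have iXn : P.-integrable setT (EFin \o X^\-%R) by exact: integrable_funrneg.
have iSXp : P.-integrable setT (EFin \o (S' \* X^\+)%R).
  by rewrite -posM//; apply: integrable_funepos.
have iSXn : P.-integrable setT (EFin \o (S' \* X^\-)%R).
  by rewrite -negM//; apply: integrable_funeneg.
have [_ Hp] := cond_exp_ge0_ratio1 sG Gm iS' S'0 iXp (funrpos_ge0 _) iSXp.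
have [_ Hn] := cond_exp_ge0_ratio1 sG Gm iS' S'0 iXn (funrneg_ge0 _) iSXn.
have [_ efin] := cond_exp_ge0_integrable sG Gm iS' (fun w => S'0 w).
have SX0p w : 0 <= (EFin \o (S' \* X^\+)%R) w by rewrite lee_fin mulr_ge0 ?funrpos_ge0.
have SX0n w : 0 <= (EFin \o (S' \* X^\-)%R) w by rewrite lee_fin mulr_ge0 ?funrneg_ge0.
have [_ pfin] := cond_exp_ge0_integrable sG Gm iSXp SX0p.
have [_ nfin] := cond_exp_ge0_integrable sG Gm iSXn SX0n.
have Hfin := ae_and pfin nfin.
apply: filterS3 (ae_and cond_exp_ae_ge0 efin) (ae_and Hp Hn) Hfin.
move=> w [-> ef] [hp hn]; rewrite /cond_exp !posM// !negM// -hp -hn.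
move=> [pf nf]; move: ef pf nf.
rewrite -/e.
have : 0 <= e w by exact: cond_exp_ge0_ge0.
move: (cond_exp_ge0_ge0 P G (EFin \o (Pi' \* X^\+)%R) w).
move: (cond_exp_ge0_ge0 P G (EFin \o (Pi' \* X^\-)%R) w).
rewrite -/Pi'.
move: (cond_exp_ge0 _ _ _ w) (cond_exp_ge0 _ _ _ w) => n p n0 p0.
rewrite le_eqVlt => /predU1P[<-|e0 ef]; first by rewrite !mul0e sube0.
have fin x : 0 <= x -> e w * x \is a fin_num -> x \is a fin_num.
  case: x => //= _; rewrite gt0_muley//.
move=> /(fin _ p0) pf /(fin _ n0) nf.
by rewrite muleBr// fin_num_adde_defr.
Qed.

End cond_exp_ratio_signed.

Lemma ereal_rat_between (R : realType) (x y : \bar R) : (x < y)%E ->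
  exists q : rat, ((x < (ratr q)%:E) && ((ratr q)%:E < y))%E.
Proof.
case: x y => [x| |] [y| |]//; rewrite ?lte_fin => xy.
- by have [q] := rat_in_itvoo xy; rewrite in_itv /= => h; exists q; rewrite !lte_fin.
- have [q] := rat_in_itvoo (ltr_pwDr ltr01 (lexx x)); rewrite in_itv /= => /andP[h _].
  by exists q; rewrite lte_fin h ltry.
- have yy : y - 1 < y by rewrite gtrBl.
  have [q] := rat_in_itvoo yy; rewrite in_itv /= => /andP[_ h].
  by exists q; rewrite lte_fin h ltNyr.
- by exists 0; rewrite ltNyr ltry.
Qed.

(** * Essential suprema and infima *)

Section essential_supremum.
Context {R : realType} {d : measure_display} {Omega : measurableType d}.
Variable P : probability Omega R.
Local Open Scope ereal_scope.

(** Exhaustion: probabilities of countable unions come arbitrarily close to their supremum, and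
    merging the approximating sequences attains it. One more set can then add no mass. *)
Lemma essential_union (I : Type) (D : set I) (C : I -> set Omega) :
  D !=set0 -> (forall i, D i -> measurable (C i)) ->
  exists2 s : nat -> I, (forall n, D (s n)) &
    forall i, D i -> P (C i `\` \bigcup_n C (s n)) = 0.
Proof.
move=> [i0 Di0] mC.
pose V := [set P (\bigcup_n C (s n)) | s in [set s : nat -> I | forall n, D (s n)]].
have mU (s : nat -> I) : (forall n, D (s n)) -> measurable (\bigcup_n C (s n)).
  by move=> Ds; apply: bigcupT_measurable => n; exact: mC.
have V0 : V (P (\bigcup_(n in [set: nat]) C i0)) by exists (fun=> i0).
have supV_fin : ereal_sup V \is a fin_num.
  rewrite ge0_fin_numE; last first.
    by apply: le_trans (ereal_sup_ubound V0); exact: measure_ge0.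
  apply: (@le_lt_trans _ _ 1); last exact: ltry.
  by apply: ge_ereal_sup => _ [s Ds <-]; apply: probability_le1; exact: mU.
have [S SD] : {S : nat -> nat -> I & forall k, (forall n, D (S k n)) /\
    ereal_sup V - k.+1%:R^-1%:E < P (\bigcup_n C (S k n))}.
  apply: (@choice _ _ (fun k s => (forall n, D (s n)) /\
    ereal_sup V - k.+1%:R^-1%:E < P (\bigcup_n C (s n)))) => k.
  have k0 : (0 < k.+1%:R^-1 :> R)%R by rewrite invr_gt0.
  by have [_ [s Ds <-] h] := ub_ereal_sup_adherent k0 supV_fin; exists s.
(* Pairs (k, n) are coded by integers, so one sequence runs through all [S k n]; [i0] fills the
   integers that code nothing. *)
pose t n := if @unpickle (nat * nat)%type n is Some ab then S ab.1 ab.2 else i0.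
have Dt n : D (t n) by rewrite /t; case: unpickle => // ab; exact: (SD _).1.
exists t => // i Di.
set U := \bigcup_n C (t n).
have mUt : measurable U by exact: mU.
have supU : ereal_sup V <= P U.
  apply/lee_addgt0Pr => e e0.
  pose k := Num.trunc e^-1.
  have ke : (k.+1%:R^-1 < e)%R.
    by rewrite -[ltRHS]invrK ltf_pV2 ?posrE ?invr_gt0// truncnS_gt.
  have [DS h] := SD k.
  rewrite -leeBlDr//; apply: (@le_trans _ _ (P (\bigcup_n C (S k n)))).
    apply: ltW; apply: le_lt_trans h; apply: leeB => //.
    by rewrite lee_fin ltW.
  apply: le_measure; rewrite ?inE//; first exact: mU.
  move=> w [n _ Cw]; exists (pickle (k, n)) => //.
  by rewrite /t pickleK.
(* Prepending [i] gives another competitor for the supremum that [U] already attains. *)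
pose t' n := if n is m.+1 then t m else i.
have Dt' n : D (t' n) by case: n.
have U'E : \bigcup_n C (t' n) = (C i `\` U) `|` U.
  apply/seteqP; split=> w.
  - move=> [[|n] _ /= Cw]; last by right; exists n.
    by have [Uw|nUw] := pselect (U w); [right|left].
  - by move=> [[Cw _]|[n _ Cw]]; [exists 0%N|exists n.+1].
have : P ((C i `\` U) `|` U) <= P U.
  rewrite -U'E; apply: le_trans supU; apply: ereal_sup_ubound.
  by exists t'.
have mD : measurable (C i `\` U) by apply: measurableD => //; exact: mC.
rewrite measureU//; last by rewrite setDKI.
rewrite -leeBrDr ?fin_num_measure// subee ?fin_num_measure// => h.
by apply/eqP; rewrite eq_le h measure_ge0.
Qed.

(** Exhaustion is applied to the superlevel sets at each rational level, and [Y] is the pointwise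
    supremum of the countably many variables selected. Where [X] exceeds [Y], a rational in between
    places the point in a superlevel set of [X] missed by the selection, and such points form a null
    event. *)
Lemma esssup_exists (S : set (Omega -> \bar R)) :
  (forall X, S X -> measurable_fun setT X) -> exists Y, is_esssup P S Y.
Proof.
move=> mS; have [->|/set0P S0] := eqVneq S set0.
  exists (cst -oo); split => // Y' _ _; apply: aeW => w; exact: leNye.
pose C (q : rat) (X : Omega -> \bar R) := X @^-1` `](ratr q)%:E, +oo[.
have mC q X : S X -> measurable (C q X).
  by move=> /mS mX; rewrite -[X in measurable X]setTI; apply: mX => //; exact: emeasurable_itv.
have [s /all_and2 [sS sC]] : {s : rat -> nat -> Omega -> \bar R & forall q,
    (forall n, S (s q n)) /\ forall X, S X -> P (C q X `\` \bigcup_n C q (s q n)) = 0}.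
  apply: (@choice _ _ (fun q (s : nat -> Omega -> \bar R) =>
    (forall n, S (s n)) /\ forall X, S X -> P (C q X `\` \bigcup_n C q (s n)) = 0)) => q.
  by have [s h1 h2] := essential_union S0 (mC q); exists s.
have [X0 SX0] := S0.
pose t n := if @unpickle (rat * nat)%type n is Some ab then s ab.1 ab.2 else X0.
have St n : S (t n) by rewrite /t; case: unpickle.
pose Y w := esups (t ^~ w) 0%N.
have tY n w : t n w <= Y w by apply: ereal_sup_ubound; exists n.
exists Y; split.
- by apply: measurable_fun_esups => n; exact: mS.
- move=> X SX.
  have : P.-negligible (\bigcup_(q : rat) (C q X `\` \bigcup_n C q (s q n))).
    rewrite (_ : \bigcup_(q : rat) _ =
      \bigcup_n (if @unpickle rat n is Some q then
         C q X `\` \bigcup_n C q (s q n) else set0)); last first.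
      apply/seteqP; split=> w [q _ Cw]; first by exists (pickle q); rewrite ?pickleK.
      by move: Cw; case: unpickle => // q' Cw; exists q'.
    apply: negligible_bigcup => n; case: unpickle => [q|]; last exact: negligible_set0.
    exists (C q X `\` \bigcup_n C q (s q n)); split=> //; last exact: sC.
    by apply: measurableD; [exact: mC|apply: bigcupT_measurable => m; exact: mC].
  apply: negligibleS => w /= /negP; rewrite -ltNge => YX.
  have [q /andP[Yq qX]] : exists q : rat, (Y w < (ratr q)%:E) && ((ratr q)%:E < X w).
    exact: ereal_rat_between.
  exists q => //; split; first by rewrite /C /= in_itv /= qX ?ltry.
  move=> [n _]; rewrite /C /= in_itv /= => /andP[+ _].
  move: (tY (pickle (q, n)) w); rewrite /t pickleK /= => h1 h2.
  by move: (lt_le_trans h2 h1); rewrite ltNge (ltW Yq).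
- move=> Y' _ SY'.
  have : \forall w \ae P, forall n, t n w <= Y' w.
    by apply/ae_foralln => n; exact: SY'.
  apply: filterS => w h; apply: ge_ereal_sup => _ [n _ <-]; exact: h.
Qed.

End essential_supremum.

Section essential_infimum.
Context {R : realType} {d : measure_display} {Omega : measurableType d}.
Variable P : probability Omega R.
Local Open Scope ereal_scope.

Lemma essinf_exists (S : set (Omega -> \bar R)) :
  (forall X, S X -> measurable_fun setT X) -> exists Y, is_essinf P S Y.
Proof.
move=> mS.
have mN (X : Omega -> \bar R) : measurable_fun setT X ->
    measurable_fun setT (fun w => - X w) by move=> mX; apply: (@measurableT_comp _ _ _ _ _ _ (-%E : \bar R -> \bar R)) => //;
    exact: oppe_measurable.
have [|Y [mY Y1 Y2]] := @esssup_exists _ _ _ P [set (fun w => - X w) | X in S].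
  by move=> _ [X SX <-]; apply: mN; exact: mS.
exists (fun w => - Y w); split; first exact: mN.
- move=> X SX; have /Y1 : [set (fun w => - X w) | X in S] (fun w => - X w) by exists X.
  by apply: filterS => w; rewrite leeNl.
- move=> Y' mY' SY'.
  have : \forall w \ae P, Y w <= - Y' w.
    apply: Y2; first exact: mN.
    by move=> _ [X SX <-]; apply: filterS (SY' X SX) => w; rewrite leeN2.
  by apply: filterS => w; rewrite leeNr.
Qed.

Lemma esssup_familyP (S : set (Omega -> \bar R)) :
  (forall X, S X -> measurable_fun setT X) -> is_esssup P S (esssup_family P S).
Proof. by move=> mS; apply: xgetPex; exact: esssup_exists. Qed.

Lemma essinf_familyP (S : set (Omega -> \bar R)) :
  (forall X, S X -> measurable_fun setT X) -> is_essinf P S (essinf_family P S).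
Proof. by move=> mS; apply: xgetPex; exact: essinf_exists. Qed.

End essential_infimum.

(** * Paths of controls *)

Section extended_path.
Context {R : realType} (T : R).
Hypothesis T_gt0 : 0 < T.
Implicit Types (x : R -> R) (t : R).

Lemma extend_lt0 x t : t < 0 -> extend T x t = 0.
Proof. by rewrite /extend => ->. Qed.

Lemma extend_ge0 x t : 0 <= t -> extend T x t = x (Num.min t T).
Proof. by rewrite /extend ltNge => ->. Qed.

Lemma extend_itv x t : 0 <= t <= T -> extend T x t = x t.
Proof. by move=> /andP[t0 tT]; rewrite extend_ge0// min_l. Qed.

Lemma extend_geT x t : T <= t -> extend T x t = x T.
Proof. by move=> tT; rewrite extend_ge0 ?min_r// (le_trans (ltW T_gt0)). Qed.

Lemma extend_right_continuous x : cadlag T x -> right_continuous (extend T x).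
Proof.
move=> [rc _] t; have [t0|t0] := ltP t 0.
  rewrite extend_lt0//; apply: cvg_near_cst.
  near=> s; have s0 : s < 0 by near: s; exact: nbhs_right_lt.
  by rewrite extend_lt0.
have [tT|tT] := ltP t T; last first.
  rewrite extend_geT//; apply: cvg_near_cst.
  near=> s.
  have ts : t < s by near: s; exact: nbhs_right_gt.
  by rewrite extend_geT// (le_trans tT)// ltW.
rewrite extend_itv ?t0 ?ltW//.
apply: cvg_trans (rc t _); last by rewrite t0 tT.
apply: near_eq_cvg; near=> s; rewrite extend_itv//.
have ts : t < s by near: s; exact: nbhs_right_gt.
have sT : s < T by near: s; exact: nbhs_right_lt.
by rewrite (le_trans t0 (ltW ts)) ltW.
Unshelve. all: end_near. Qed.

Lemma left_lim_cvg x t : nondecreasing (extend T x) ->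
  extend T x s @[s --> t^'-] --> left_lim T x t.
Proof.
move=> nd; apply: nondecreasing_at_left_is_cvgr.
  by near=> s => u v _ _; exact: nd.
near=> s; exists (extend T x t) => _ [u /= + <-]; rewrite in_itv /= => /andP[_ ut].
exact/nd/ltW.
Unshelve. all: end_near. Qed.

Lemma le_left_lim x s t : nondecreasing (extend T x) -> s < t ->
  extend T x s <= left_lim T x t.
Proof.
move=> nd st; apply: limr_ge; first exact: left_lim_cvg.
by near=> u; apply: nd; apply: ltW; near: u; exact: nbhs_left_gt.
Unshelve. all: end_near. Qed.

Lemma left_lim_le x s t : nondecreasing (extend T x) ->
  (forall u, u < t -> extend T x u <= s) -> left_lim T x t <= s.
Proof.
move=> nd H; apply: limr_le; first exact: left_lim_cvg.
by near=> u; apply: H; near: u; exact: nbhs_left_lt.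
Unshelve. all: end_near. Qed.

Lemma left_lim_gt x c t : nondecreasing (extend T x) -> c < left_lim T x t ->
  exists2 s, s < t & c < extend T x s.
Proof.
move=> nd ct; apply: contrapT => H; move: ct; apply/negP; rewrite -leNgt.
apply: left_lim_le => // u ut; rewrite leNgt; apply/negP => cu.
by apply: H; exists u.
Qed.

End extended_path.

(** * Generalised inverses of control paths and the inverse transform *)

Section quantile.
Context {R : realType} (T : R).
Hypothesis T_gt0 : 0 < T.
Implicit Types (x : R -> R) (t z : R).

(** A single path of [randomised_time]: by unfolding, [randomised_time T X Z w] is
    [quantile T (X^~ w) (Z w)]. The infimum of the empty set is 0. *)
Definition quantile x z : R := inf [set t | 0 <= t <= T /\ z < x t].

Lemma nondecreasing_itv x s t : nondecreasing (extend T x) ->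
  0 <= s -> s <= t -> t <= T -> x s <= x t.
Proof.
move=> nd s0 st tT; rewrite -(@extend_itv _ T x s) ?s0 ?(le_trans st)//.
by rewrite -(@extend_itv _ T x t) ?tT ?andbT ?(le_trans s0)//; exact: nd.
Qed.

Lemma quantile_itv x z : 0 <= quantile x z <= T.
Proof.
rewrite /quantile; set A := [set _ | _].
have [->|/set0P A0] := eqVneq A set0; first by rewrite inf0 lexx ltW.
apply/andP; split; first by apply: lb_le_inf => // t [/andP[]].
have [t At] := A0; apply: (@le_trans _ _ t); last by case: At => /andP[].
by apply: ge_inf => //; exists 0 => s [/andP[]].
Qed.

Lemma quantile_le x z t : 0 <= t <= T -> z < x t -> quantile x z <= t.
Proof. by move=> tT zt; apply: ge_inf => //; exists 0 => s [/andP[]]. Qed.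

(** A countable description, made for measurability: a time before [T] can be moved right to a
    rational one because the path is non-decreasing. The other two cases are a level that may be
    passed at [T] only, and the default value 0 for a level that is never passed. *)
Lemma quantile_ltP x z c : nondecreasing (extend T x) ->
  quantile x z < c <->
  (exists r : rat, [/\ 0 <= (ratr r : R) <= T, (ratr r : R) < c & z < x (ratr r)]) \/
  (T < c /\ z < x T) \/ (0 < c /\ x T <= z).
Proof.
move=> nd; split; last first.
  move=> [[r [rT rc zr]]|[[Tc zT]|[c0 zT]]].
  - exact: le_lt_trans (quantile_le rT zr) rc.
  - by apply: le_lt_trans Tc; case/andP: (quantile_itv x z).
  - rewrite /quantile (_ : [set _ | _] = set0) ?inf0//.
    apply/seteqP; split => // t [/andP[t0 tT]]; apply/negP; rewrite -leNgt.
    by apply: le_trans zT; exact: nondecreasing_itv.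
have [zT|zT] := leP (x T) z.
  rewrite /quantile (_ : [set _ | _] = set0) ?inf0//; last first.
    apply/seteqP; split => // t [/andP[t0 tT]]; apply/negP; rewrite -leNgt.
    by apply: le_trans zT; exact: nondecreasing_itv.
  by right; right.
have A0 : [set t | 0 <= t <= T /\ z < x t] !=set0.
  by exists T; split => //; rewrite lexx ltW.
have hA : has_inf [set t | 0 <= t <= T /\ z < x t].
  by split=> //; exists 0 => s [/andP[]].
move=> /(inf_lt A0)[t [/andP[t0 tT] zt] tc].
move: tT; rewrite le_eqVlt => /predU1P[tT|tT].
  by right; left; rewrite -tT.
left; have tm : t < Num.min c T by rewrite lt_min tc tT.
have [r] := rat_in_itvoo tm; rewrite in_itv /= lt_min => /and3P[tr rc rT].
exists r; split => //; first by rewrite (le_trans t0) ltW.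
by apply: lt_le_trans zt _; apply: nondecreasing_itv => //; exact: ltW.
Qed.

(** If the path were below [z] at [t], right continuity would keep it below for a while, and the
    infimum would be larger than [t]. *)
Lemma le_extend_quantile x z t : nondecreasing (extend T x) -> cadlag T x ->
  z < x T -> quantile x z <= t -> z <= extend T x t.
Proof.
move=> nd cx zT; rewrite leNgt => /negP qt; rewrite leNgt; apply/negP => tz.
apply: qt.
have tT : t < T.
  by rewrite ltNge; apply/negP => Tt; move: tz; rewrite extend_geT// ltNge ltW.
have [s [ts sT sz]] : exists s, [/\ t < s, s < T & extend T x s < z].
  have : \forall s \near t^'+, extend T x s < z.
    have rc : extend T x s @[s --> t^'+] --> extend T x t.
      exact: extend_right_continuous.
    exact: (cvgr_lt _ rc).
  move=> H; near (at_right t) => s; exists s; split.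
  - by near: s; exact: nbhs_right_gt.
  - by near: s; exact: nbhs_right_lt.
  - by near: s.
apply: (lt_le_trans ts); apply: lb_le_inf.
  by exists T; split => //; rewrite lexx ltW.
move=> u [/andP[u0 uT] zu]; rewrite leNgt; apply/negP => us.
have := nd _ _ (ltW us); rewrite extend_itv ?u0// leNgt => /negP; apply.
exact: lt_trans zu.
Unshelve. all: end_near. Qed.

End quantile.

Lemma measurable_fun_lt_set d (S : measurableType d) (R : realType) (f : S -> R) :
  (forall c, measurable [set w | f w < c]) -> measurable_fun setT f.
Proof.
move=> H mD; apply: (measurability _ (RGenInftyO.measurableE R)) => //.
by move=> _ [_ [c ->] <-]; rewrite setTI; exact: H.
Qed.

Section measurable_quantile.
Context {R : realType} (T : R) d (S : measurableType d) (xi : R -> S -> R).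
Hypothesis T_gt0 : 0 < T.
Hypothesis nd : forall w, nondecreasing (extend T (xi^~ w)).
Hypothesis mxi : forall t, 0 <= t <= T -> measurable_fun setT (xi t).

Lemma measurable_quantile :
  measurable_fun setT (fun wz : S * R => quantile T (xi^~ wz.1) wz.2).
Proof.
have mlt t : 0 <= t <= T -> measurable [set wz : S * R | wz.2 < xi t wz.1].
  move=> tT; rewrite -[X in measurable X]setTI; apply: measurable_fun_ltr => //.
  by apply: (@measurableT_comp _ _ _ _ _ _ (xi t)) => //; exact: mxi.
have mle : measurable [set wz : S * R | xi T wz.1 <= wz.2].
  rewrite -[X in measurable X]setTI; apply: measurable_fun_ler => //.
  by apply: (@measurableT_comp _ _ _ _ _ _ (xi T)) => //; apply: mxi; rewrite lexx ltW.
apply: measurable_fun_lt_set => c.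
rewrite (_ : [set _ | _] =
  (\bigcup_(r : rat) [set wz | 0 <= (ratr r : R) <= T /\ (ratr r : R) < c /\ wz.2 < xi (ratr r) wz.1])
  `|` ([set wz | T < c /\ wz.2 < xi T wz.1] `|` [set wz | 0 < c /\ xi T wz.1 <= wz.2])); last first.
  apply/seteqP; split => wz /=.
    move/(quantile_ltP T_gt0 _ _ (nd wz.1)) => [[r [? ? ?]]|]; last by right.
    by left; exists r.
  move=> H; apply/(quantile_ltP T_gt0 _ _ (nd wz.1)).
  by case: H => [[r _ [? [? ?]]]|]; [left; exists r|right].
have mand (b : bool) (A : set (S * R)) : (b -> measurable A) ->
    measurable [set wz | b /\ A wz].
  case: b => [mA|_].
    by rewrite (_ : [set _ | _] = A); [exact: mA|apply/seteqP; split => [w []|]].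
  by rewrite (_ : [set _ | _] = set0)//; apply/seteqP; split => [w []|].
apply: measurableU; last apply: measurableU.
- apply: bigcupT_measurable_rat => r.
  apply: (mand (0 <= (ratr r : R) <= T) [set wz | (ratr r : R) < c /\ wz.2 < xi (ratr r) wz.1]) => rT.
  by apply: (mand (ratr r < c) [set wz | wz.2 < xi (ratr r) wz.1]) => _; exact: mlt.
- apply: (mand (T < c) [set wz | wz.2 < xi T wz.1]) => _.
  by apply: mlt; rewrite lexx ltW.
- exact: (mand (0 < c) [set wz | xi T wz.1 <= wz.2]).
Qed.

End measurable_quantile.

Section uniform_variable.
Context {R : realType}.

Lemma measurable_measurableTypeR_id : measurable_fun setT (id : measurableTypeR R -> R).
Proof. by move=> _ B mB; rewrite setTI. Qed.

Lemma measurable_to_measurableTypeR d (S : measurableType d) (f : S -> R) :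
  measurable_fun setT f -> measurable_fun setT (f : S -> measurableTypeR R).
Proof. exact. Qed.

(* The uniform law on [R] with its Borel sigma-algebra, rather than on [measurableTypeR R]. *)
Definition unif : probability R R :=
  distribution (@uniform_prob R _ _ ltr01) (mfun_of measurable_measurableTypeR_id).

Lemma unifE (A : set R) : unif A = uniform_prob ltr01 A.
Proof. by []. Qed.

End uniform_variable.

Section distribution_path.
Context {R : realType} (T : R).
Hypothesis T_gt0 : 0 < T.
Implicit Types (x : R -> R) (t z : R).
Local Notation U := (unif (R := R)).

(* Paths of a control outside a null set: distribution functions of probability measures on [0, T]. *)
Record distribution_path x : Prop := DistributionPath {
  dpath_nondecreasing : nondecreasing (extend T x) ;
  dpath_cadlag : cadlag T x ;
  dpath_end : x T = 1 }.

Lemma uniform01E (A : set R) : measurable A ->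
  U A = lebesgue_measure (A `&` `[0, 1]).
Proof.
move=> mA; rewrite unifE; have := integral_uniform (@ltr01 R) (f := fun z => (\1_A z)%:E).
rewrite subr0 invr1 mul1e !integral_indic// setIT => -> //.
exact/measurable_EFinP.
Qed.

Variable x : R -> R.
Hypothesis dx : distribution_path x.
Let nd := dpath_nondecreasing dx.
Let cx := dpath_cadlag dx.
Let x1 := dpath_end dx.

Lemma extend_bound t : 0 <= extend T x t <= 1.
Proof.
apply/andP; split.
  have [t0|t0] := ltP t 0; first by rewrite extend_lt0.
  rewrite -(extend_lt0 T x (ltrN10 R)); apply: nd.
  by apply: le_trans t0.
rewrite -x1 -(extend_geT T_gt0 x (lexx T)); have [tT|tT] := leP t T; first exact: nd.
by rewrite !(extend_geT T_gt0)// ltW.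
Qed.

Lemma measurable_quantile_path : measurable_fun setT (quantile T x).
Proof.
have := @measurable_quantile R T _ R (fun t _ => x t) T_gt0 (fun=> nd)
  (fun t _ => measurable_cst (x t)).
move=> mq.
have mp : measurable_fun setT (fun z : R => (0%R, z) : R * R).
  by apply: measurable_fun_pair => //; exact: measurable_cst.
exact: (measurableT_comp mq mp).
Qed.

Let mq := measurable_quantile_path.

(** Within [0, 1] the event contains the levels below the value of the path at [t] and no level
    above it, except possibly 1: no time passes the level 1, so the infimum is 0 there by default. A
    single level has no mass. *)
Lemma quantile_le_prob t : U [set z | quantile T x z <= t] = (extend T x t)%:E.
Proof.
have mA : measurable [set z | quantile T x z <= t].
  rewrite -[X in measurable X]setTI.
  exact: (measurable_fun_ler mq (measurable_cst t)).
rewrite uniform01E//.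
have /andP[X0 X1] := extend_bound t.
apply/eqP; rewrite eq_le; apply/andP; split.
- apply: (@le_trans _ _ (lebesgue_measure (`[0%R, extend T x t] `|` [set 1%R] : set R))).
    apply: le_measure; rewrite ?inE.
    + exact: measurableI.
    + exact: measurableU.
    + move=> z [/= qt]; rewrite in_itv /= => /andP[z0].
      rewrite le_eqVlt => /predU1P[->|z1]; first by right.
      left; rewrite /= in_itv /= z0; apply: le_extend_quantile => //.
      by rewrite x1.
  apply: (@le_trans _ _ (lebesgue_measure (`[0%R, extend T x t] : set R) +
    lebesgue_measure ([set 1%R] : set R))%E); first exact: measureU2.
  rewrite lebesgue_measure_itv lebesgue_measure_set1 adde0 /=.
  by case: ifPn; rewrite ?sube0// => _; rewrite lee_fin.
- apply: (@le_trans _ _ (lebesgue_measure (`[0%R, extend T x t[ : set R))).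
    rewrite lebesgue_measure_itv /= lte_fin.
    have [_|X0'] := ltP 0 (extend T x t); first by rewrite sube0.
    by rewrite lee_fin.
  apply: le_measure; rewrite ?inE; [by []|exact: measurableI|].
  move=> z; rewrite /= !in_itv /= => /andP[z0 zX]; split; last first.
    by rewrite z0 (le_trans (ltW zX)).
  have t0 : 0 <= t.
    by rewrite leNgt; apply/negP => t0; move: zX; rewrite extend_lt0// ltNge z0.
  have [tT|/ltW tT] := leP t T.
    by apply: quantile_le => //; [rewrite t0|rewrite -(@extend_itv _ T)// t0].
  apply: le_trans tT; apply: quantile_le => //; first by rewrite lexx ltW.
  by rewrite x1; apply: lt_le_trans X1.
Qed.

(** Inverse transform: under the law of the generalised inverse an interval ]a, b] has the increment
    of the path as mass, and this determines the Stieltjes measure. *)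
Lemma stieltjes_quantile (B : set R) : measurable B ->
  stieltjes T x B = U (quantile T x @^-1` B).
Proof.
move=> mB; rewrite /stieltjes; case: pselect => [H|]; last first.
  by move=> /not_andP[]//; case; exact: extend_right_continuous.
pose m := distribution U (mfun_of (measurable_to_measurableTypeR mq)).
rewrite -[RHS]/(m B).
apply: (@lebesgue_stieltjes_measure_unique _ (cumulative_path H) m) => //.
move=> A [[a b] _ <-] /=.
rewrite /lebesgue_stieltjes_measure /measure_extension measurable_mu_extE/=; last exact: is_ocitv.
have [ba|ab] := leP b a.
  rewrite set_itv_ge ?bnd_simp -?leNgt// wlength0.
  by rewrite /m /distribution /pushforward preimage_set0 measure0.
rewrite wlength_itv_bnd ?ltW//=.
rewrite -[RHS]/(U (quantile T x @^-1` `]a, b]%classic)).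
rewrite (_ : quantile T x @^-1` _ =
  [set z | quantile T x z <= b] `\` [set z | quantile T x z <= a]); last first.
  apply/seteqP; split => z /=; rewrite in_itv /=.
    by move=> /andP[az zb]; split => //; apply/negP; rewrite -ltNge.
  by move=> [zb /negP]; rewrite -ltNge zb => ->.
have mA t : measurable [set z | quantile T x z <= t].
  rewrite -[X in measurable X]setTI.
  exact: (measurable_fun_ler mq (measurable_cst t)).
transitivity (U [set z | (quantile T x z <= b)%R] - U [set z | (quantile T x z <= a)%R])%E.
  by rewrite !quantile_le_prob.
rewrite measureD//; last first.
  by apply: le_lt_trans (probability_le1 _ _) (ltry 1).
rewrite setIidr//.
by move=> z /= za; rewrite (le_trans za)// ltW.
Qed.

End distribution_path.

Section path_measure.
Context {R : realType} (T : R).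
Hypothesis T_gt0 : 0 < T.
Implicit Types (x : R -> R) (t z : R).
Local Notation U := (unif (R := R)).
Variable x : R -> R.
Hypothesis dx : distribution_path T x.
Let nd := dpath_nondecreasing dx.
Let cx := dpath_cadlag dx.
Let x1 := dpath_end dx.
Let mq := measurable_quantile_path T_gt0 dx.
Local Notation mu := (stieltjes T x).

Lemma stieltjes_setT : mu setT = 1%E.
Proof. by rewrite (stieltjes_quantile T_gt0 dx)// preimage_setT probability_setT. Qed.

Lemma stieltjes_lty (A : set R) : measurable A -> (mu A < +oo)%E.
Proof.
move=> mA; apply: (@le_lt_trans _ _ 1%E); last exact: ltry.
by rewrite -stieltjes_setT; apply: le_measure; rewrite ?inE.
Qed.

Lemma stieltjes_itvNyc t : mu (`]-oo, t]%classic : set R) = (extend T x t)%:E.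
Proof.
rewrite (stieltjes_quantile T_gt0 dx)// -(quantile_le_prob T_gt0 dx); congr (U _).
Qed.

Lemma stieltjes_itvoy t : mu (`]t, +oo[%classic : set R) = (1 - extend T x t)%:E.
Proof.
rewrite -setCitvl -setTD measureD//; last exact: stieltjes_lty.
by rewrite setTI EFinB [X in (_ - X)%E]stieltjes_itvNyc; congr (_ - _)%E; exact: stieltjes_setT.
Qed.

Lemma quantile_lt_prob t : U [set z | quantile T x z < t] = (left_lim T x t)%:E.
Proof.
have mA : measurable [set z | quantile T x z < t].
  rewrite -[X in measurable X]setTI.
  exact: (measurable_fun_ltr mq (measurable_cst t)).
apply/eqP; rewrite eq_le; apply/andP; split.
- have l0 : 0 <= left_lim T x t.
    have t1 : t - 1 < t by rewrite gtrBl.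
    by apply: le_trans (le_left_lim nd t1); case/andP: (extend_bound T_gt0 dx (t - 1)).
  rewrite (uniform01E mA).
  apply: (@le_trans _ _ (lebesgue_measure (`[0%R, left_lim T x t] : set R) +
    lebesgue_measure ([set 1%R] : set R))%E); last first.
    rewrite lebesgue_measure_itv lebesgue_measure_set1 adde0 /=.
    by case: ifPn; rewrite ?sube0// => _; rewrite lee_fin.
  apply: (@le_trans _ _ (lebesgue_measure (`[0%R, left_lim T x t] `|` [set 1%R] : set R))).
    apply: le_measure; rewrite ?inE.
    + exact: measurableI.
    + exact: measurableU.
    + move=> z [/= qt]; rewrite in_itv /= => /andP[z0].
      rewrite le_eqVlt => /predU1P[->|z1]; first by right.
      left; rewrite /= in_itv /= z0.
      (* At the midpoint between the quantile and [t], still before [t], the path has reached the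
         level [z]; the left limit is at least its value there. *)
      have qt' : quantile T x z < (quantile T x z + t) / 2 by lra.
      have t't : (quantile T x z + t) / 2 < t by lra.
      apply: le_trans (le_left_lim nd t't).
      by apply: le_extend_quantile => //; [rewrite x1|exact: ltW].
  exact: measureU2.
- have : left_lim T x t <= fine (U [set z | quantile T x z < t]).
    apply: left_lim_le => // s st.
    rewrite -lee_fin fineK ?fin_num_measure// -(quantile_le_prob T_gt0 dx).
    apply: le_measure; rewrite ?inE//; last by move=> z /= zs; exact: le_lt_trans st.
    rewrite -[X in measurable X]setTI.
    exact: (measurable_fun_ler mq (measurable_cst s)).
  by rewrite -lee_fin fineK// fin_num_measure.
Qed.

Lemma stieltjes_itvNyo t : mu (`]-oo, t[%classic : set R) = (left_lim T x t)%:E.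
Proof.
rewrite (stieltjes_quantile T_gt0 dx)// -quantile_lt_prob; congr (U _).
Qed.

Lemma stieltjes_itvcy t : mu (`[t, +oo[%classic : set R) = (1 - left_lim T x t)%:E.
Proof.
rewrite -setCitvl -setTD measureD//; last exact: stieltjes_lty.
by rewrite setTI EFinB [X in (_ - X)%E]stieltjes_itvNyo; congr (_ - _)%E; exact: stieltjes_setT.
Qed.

Lemma stieltjes_set1 t : mu [set t] = (extend T x t - left_lim T x t)%:E.
Proof.
rewrite (_ : [set t] = `]-oo, t]%classic `\` `]-oo, t[%classic); last first.
  apply/seteqP; split => s /=; rewrite !in_itv /=.
    by move=> ->; rewrite lexx ltxx.
  by move=> [st /negP]; rewrite -leNgt => ts; apply/eqP; rewrite eq_le st.
rewrite measureD//; last exact: stieltjes_lty.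
rewrite setIidr; last by move=> s; rewrite /= !in_itv /=; exact: ltW.
by rewrite EFinB [X in (_ - X)%E]stieltjes_itvNyo; congr (_ - _)%E; exact: stieltjes_itvNyc.
Qed.

Lemma stieltjes_jump t : 0 <= t <= T -> mu [set t] = (jump T x t)%:E.
Proof. by move=> tT; rewrite stieltjes_set1 /jump extend_itv. Qed.

Lemma jump_ge0 t : 0 <= t <= T -> 0 <= jump T x t.
Proof. by move=> tT; rewrite -lee_fin -stieltjes_jump. Qed.

Lemma jump_le1 t : 0 <= t <= T -> jump T x t <= 1.
Proof.
move=> tT; rewrite -lee_fin -stieltjes_jump// -stieltjes_setT.
by apply: le_measure; rewrite ?inE.
Qed.

Lemma left_lim_bound t : 0 <= left_lim T x t <= 1.
Proof.
by rewrite -!lee_fin -quantile_lt_prob measure_ge0 probability_le1// -[X in measurable X]setTI;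
  exact: (measurable_fun_ltr mq (measurable_cst t)).
Qed.

Lemma stieltjes_atoms_countable : countable [set t | (0 < mu [set t])%E].
Proof.
have := pmf_gt0_countable (mfun_of mq : {RV U >-> R}).
apply: sub_countable; apply/subset_card_le => t /=.
rewrite /pmf -[mfun_of mq @^-1` _]/(quantile T x @^-1` [set t]).
by rewrite -(stieltjes_quantile T_gt0 dx)// => t0; rewrite fine_gt0// t0 stieltjes_lty.
Qed.

Lemma integral_stieltjes_quantile (D : set R) (phi : R -> \bar R) :
  measurable D -> measurable_fun D phi -> (forall t, D t -> (0 <= phi t)%E) ->
  (\int[mu]_(t in D) phi t = \int[U]_(z in quantile T x @^-1` D) phi (quantile T x z))%E.
Proof.
move=> mD mphi phi0.
pose m := distribution U (mfun_of (measurable_to_measurableTypeR mq)).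
rewrite (eq_measure_integral m); last first.
  by move=> A mA _; exact: stieltjes_quantile.
apply: ge0_integral_pushforward => //.
by move=> t /set_mem; exact: phi0.
Qed.

End path_measure.

(** * Measures on the line: determination by rays, sums over countable sets *)

Section finite_measures_on_line.
Context {R : realType}.
Local Open Scope ereal_scope.

(** Open rays are stable under intersection and generate the Borel sets; the rays from [- k] exhaust
    the line with finite mass. *)
Lemma eq_measure_rays (m1 m2 : {measure set (measurableTypeR R) -> \bar R}) :
  m1 setT < +oo ->
  (forall t, m1 (`]t, +oo[%classic : set R) = m2 (`]t, +oo[%classic : set R)) ->
  forall A : set R, measurable A -> m1 A = m2 A.
Proof.
move=> fin H A mA.
apply: (@measure_unique _ R (measurableTypeR R) (@RGenOInfty.G R)
  (fun k => `](- k%:R)%R, +oo[%classic) _ _ _ _ m1 m2 _ _ A mA) => //.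
- exact: RGenOInfty.measurableE.
- move=> _ _ [s ->] [t ->]; exists (Num.max s t).
  by apply/seteqP; split => u; rewrite /= !in_itv /= !andbT gt_max;
    [case=> -> ->|case/andP].
- by move=> i; exists (- i%:R)%R.
- apply/seteqP; split => // t _.
  exists (Num.trunc `|t|%R).+1 => //=; rewrite in_itv /= andbT.
  rewrite ltrNl; apply: le_lt_trans (truncnS_gt _).
  by rewrite -normrN ler_norm.
- by move=> _ [t ->]; exact: H.
- move=> k; apply: le_lt_trans fin; apply: le_measure; rewrite ?inE//.
Qed.

(** An injection into the integers cuts [C] into pieces of at most one point each. *)
Lemma integral_countable (m : {measure set (measurableTypeR R) -> \bar R}) (C : set R)
    (phi : R -> \bar R) : countable C -> measurable_fun C phi ->
  (forall t, 0 <= phi t) ->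
  \int[m]_(t in C) phi t = \esum_(t in C) (phi t * m [set t]).
Proof.
move=> /countable_injP[e inj] mphi phi0.
pose F n := [set t | C t /\ e t = n].
have F1 n t : F n t -> F n = [set t].
  move=> [Ct et]; apply/seteqP; split => [s [Cs es]|s ->//].
  by apply: inj; rewrite ?inE// et es.
have mF n : measurable (F n : set R).
  have [->|/set0P[t Ft]] := eqVneq (F n) set0; first exact: measurable0.
  by rewrite (F1 _ _ Ft); exact: measurable_set1.
have CE : C = \bigcup_n F n.
  by apply/seteqP; split => [t Ct|t [n _ []]//]; exists (e t).
have tF : trivIset setT F.
  by apply/trivIsetP => i j _ _ ij; apply/seteqP; split => // t [[_ ei] [_ ej]];
    move/eqP: ij; apply; rewrite -ei -ej.
rewrite CE ge0_integral_bigcup//; last by rewrite -CE.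
rewrite nneseries_sum_bigcup//; last by move=> t; exact: mule_ge0.
apply: eq_eseriesr => n _.
have [->|/set0P[t Ft]] := eqVneq (F n) set0.
  by rewrite integral_set0 esum_set0.
rewrite (F1 _ _ Ft) esum_set1; last exact: mule_ge0.
transitivity (\int[m]_(s in [set t]) cst (phi t) s).
  by apply: eq_integral => s /set_mem ->.
by rewrite integral_cst//; exact: measurable_set1.
Qed.

End finite_measures_on_line.

(** * Payoffs along paths *)

Section concatenation.
Context {R : realType} (T : R).
Hypothesis T_gt0 : 0 < T.
Variables (x y : R -> R) (lam : R).
Hypotheses (dx : distribution_path T x) (dy : distribution_path T y).
Hypothesis lam_itv : 0 <= lam <= T.

Lemma left_lim_local : (forall t, t < lam -> extend T x t = extend T y t) ->
  left_lim T x lam = left_lim T y lam.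
Proof.
move=> H.
have ndx := dpath_nondecreasing dx; have ndy := dpath_nondecreasing dy.
apply/eqP; rewrite eq_le; apply/andP; split; apply: left_lim_le => // u ul.
  by rewrite H//; exact: le_left_lim.
by rewrite -H//; exact: le_left_lim.
Qed.

(** After restriction to the times before [lam], the mass of a ray is the left limit at [lam] minus
    a value of the path before [lam], and both are shared by [x] and [y]. *)
Lemma stieltjes_before (A : set R) :
  (forall t, t < lam -> extend T x t = extend T y t) ->
  measurable A -> A `<=` `]-oo, lam[ -> stieltjes T x A = stieltjes T y A.
Proof.
move=> H mA Al.
have mD : measurable (`]-oo, lam[%classic : set (measurableTypeR R)) by exact: measurable_itv.
suff : mrestr (stieltjes T x) mD A = mrestr (stieltjes T y) mD A.
  by rewrite /mrestr setIidl.
apply: eq_measure_rays => //.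
- by rewrite /= /mrestr setTI; exact: stieltjes_lty.
- move=> t; rewrite /= /mscale /= /mrestr.
  have [lt|tl] := leP lam t.
    rewrite (_ : _ `&` _ = set0) ?measure0//.
    apply/seteqP; split => // s [/=]; rewrite !in_itv /= andbT => ts sl.
    by move: (lt_trans (le_lt_trans lt ts) sl); rewrite ltxx.
  have -> : `]t, +oo[%classic `&` `]-oo, lam[%classic = `]-oo, lam[%classic `\` `]-oo, t]%classic :> set R.
    apply/seteqP; split => s /=; rewrite !in_itv /= andbT.
      by move=> [ts sl]; split => //; apply/negP; rewrite -ltNge.
    by move=> [sl /negP]; rewrite -ltNge.
  have sub : (`]-oo, t]%classic : set R) `<=` `]-oo, lam[%classic.
    by move=> s; rewrite /= !in_itv /= => /le_lt_trans; exact.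
  have [mlx mly] := (stieltjes_lty T_gt0 dx mD, stieltjes_lty T_gt0 dy mD).
  rewrite !measureD// setIidr//.
  rewrite -[X in (X - _)%E]/(stieltjes T x (`]-oo, lam[%classic : set R)).
  rewrite -[X in (_ - X)%E = _]/(stieltjes T x (`]-oo, t]%classic : set R)).
  rewrite -[X in _ = (X - _)%E]/(stieltjes T y (`]-oo, lam[%classic : set R)).
  rewrite -[X in _ = (_ - X)%E]/(stieltjes T y (`]-oo, t]%classic : set R)).
  rewrite !(stieltjes_itvNyo T_gt0)// !(stieltjes_itvNyc T_gt0)//.
  by rewrite H// left_lim_local.
Qed.

Let a := left_lim T x lam.

Hypothesis y0 : left_lim T y lam = 0.
Hypothesis xy : forall t, lam <= t -> extend T x t = a + (1 - a) * extend T y t.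

Let a01 : 0 <= 1 - a.
Proof. by rewrite subr_ge0; case/andP: (left_lim_bound T_gt0 dx lam). Qed.

(** For rays that start at or after [lam] the factor comes from the affine relation [xy]. A ray that
    starts earlier is cut down to all times from [lam] on, and by [y0] the measure of [y] puts its
    whole mass 1 there. *)
Lemma stieltjes_after (A : set R) : measurable A -> A `<=` `[lam, +oo[ ->
  stieltjes T x A = ((1 - a)%:E * stieltjes T y A)%E.
Proof.
move=> mA Al.
have mD : measurable (`[lam, +oo[%classic : set (measurableTypeR R)) by exact: measurable_itv.
suff : mrestr (stieltjes T x) mD A = mscale (NngNum a01) (mrestr (stieltjes T y) mD) A.
  by rewrite /mscale /= /mrestr setIidl.
apply: eq_measure_rays => //.
- by rewrite /= /mrestr setTI; exact: stieltjes_lty.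
- move=> t; rewrite /= /mscale /= /mrestr.
  have [lt|tl] := leP lam t.
    rewrite setIidl; last first.
      move=> s; rewrite /= !in_itv /= !andbT => ts; exact: (le_trans lt (ltW ts)).
    rewrite !(stieltjes_itvoy T_gt0)// xy//.
    rewrite -[RHS]/(((1 - a) * (1 - extend T y t))%:E); congr EFin.
    by rewrite opprD addrA mulrBr mulr1.
  rewrite setIidr; last first.
    by move=> s; rewrite /= !in_itv /= !andbT => ls; exact: lt_le_trans ls.
  by rewrite !(stieltjes_itvcy T_gt0)// y0 subr0 mule1.
Qed.

Lemma jump_after t : lam <= t <= T -> jump T x t = (1 - a) * jump T y t.
Proof.
move=> /andP[lt tT].
have t0T : 0 <= t <= T by rewrite tT andbT (le_trans _ lt)//; case/andP: lam_itv.
apply: EFin_inj; rewrite -(stieltjes_jump T_gt0 dx)// EFinM -(stieltjes_jump T_gt0 dy)//.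
apply: stieltjes_after => //.
by move=> s ->; rewrite /= in_itv /= andbT.
Qed.

End concatenation.

Section path_functional.
Context {R : realType} (T : R).
Hypothesis T_gt0 : 0 < T.
Implicit Types (x y phi c : R -> R) (D : set R).

(** Stieltjes measures of distribution paths have mass 1, so this makes every integral below
    finite. *)
Definition bounded_path phi :=
  measurable_fun (`[0, T] : set R) phi /\ exists M, forall t, 0 <= t <= T -> `|phi t| <= M.

Lemma bounded_pathM phi c : bounded_path phi -> bounded_path c ->
  bounded_path (fun t => phi t * c t).
Proof.
move=> [mp [M pM]] [mc [N cN]]; split; first exact: measurable_funM.
exists (M * N) => t tT; rewrite normrM; apply: ler_pM => //; [exact: pM|exact: cN].
Qed.

Lemma bounded_survival y : distribution_path T y -> bounded_path (fun t => 1 - y t).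
Proof.
move=> dy; split.
  apply: measurable_funB; first exact: measurable_cst.
  apply: (eq_measurable_fun (extend T y)).
    by move=> t /set_mem; rewrite /= in_itv /= => tT; rewrite extend_itv.
  by apply: nondecreasing_measurable => //; exact: dpath_nondecreasing.
exists 1 => t tT; have := extend_bound T_gt0 dy t.
by rewrite extend_itv// => /andP[y0 y1]; rewrite ger0_norm ?subr_ge0// gerBl.
Qed.

Lemma bounded_jump y : distribution_path T y -> bounded_path (jump T y).
Proof.
move=> dy; have nd := dpath_nondecreasing dy; split; last first.
  exists 1 => t tT; rewrite ger0_norm; first exact: (jump_le1 T_gt0 dy).
  exact: (jump_ge0 T_gt0 dy).
apply: measurable_funB.
  apply: (eq_measurable_fun (extend T y)).
    by move=> t /set_mem; rewrite /= in_itv /= => tT; rewrite extend_itv.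
  exact: nondecreasing_measurable.
apply: nondecreasing_measurable => // s t st.
by apply: left_lim_le => // u us; apply: le_left_lim => //; exact: lt_le_trans st.
Qed.

Lemma bounded_path_integrable x D phi : distribution_path T x ->
  measurable D -> D `<=` `[0, T] -> bounded_path phi ->
  (stieltjes T x).-integrable D (EFin \o phi).
Proof.
move=> dx mD DT [mp [M pM]].
apply: measurable_bounded_integrable => //.
- exact: stieltjes_lty.
- exact: measurable_funS mp.
- exists M; split; first exact: num_real.
  move=> N MN t /DT /=; rewrite in_itv /= => tT.
  exact: le_trans (pM t tT) (ltW MN).
Qed.

(* Both sides are sums over the countably many atoms of dy. *)
Lemma signed_sum_integral x y D phi : distribution_path T x -> distribution_path T y ->
  measurable D -> D `<=` `[0, T] -> bounded_path phi ->
  signed_sum D (fun t => phi t * jump T y t * jump T x t) =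
  \int[stieltjes T x]_(t in D) (phi t * jump T y t).
Proof.
move=> dx dy mD DT bp.
have bj := bounded_jump dy; have bpj := bounded_pathM bp bj.
have DTi t : D t -> 0 <= t <= T by move=> /DT /=; rewrite in_itv.
have jx t : D t -> 0 <= jump T x t by move=> /DTi; exact: jump_ge0.
have jy t : D t -> 0 <= jump T y t by move=> /DTi; exact: jump_ge0.
pose C := [set t | (0 < stieltjes T y [set t])%E].
have cC : countable C by exact: stieltjes_atoms_countable.
have mC : measurable C by apply: countable_measurable => // t; exact: measurable_set1.
have main psi : bounded_path psi -> (forall t, D t -> 0 <= psi t) ->
    (forall t, D t -> ~ C t -> psi t = 0) ->
    (\esum_(t in D) (psi t * jump T x t)%:E = \int[stieltjes T x]_(t in D) (psi t)%:E)%E.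
  move=> [mpsi _] psi0 psiC.
  have mpD : measurable_fun D (EFin \o psi).
    by apply/measurable_EFinP; exact: measurable_funS mpsi.
  rewrite (esumID C) => [|t Dt]; last by rewrite lee_fin mulr_ge0 ?jx ?psi0.
  rewrite [X in (_ + X)%E]esum1 ?adde0; last first.
    by move=> t [Dt nCt]; rewrite psiC// mul0r.
  have mDC : measurable (D `&` C) by exact: measurableI.
  have mDC' : measurable (D `\` C) by exact: measurableD.
  rewrite -[in RHS](setUIDK D C) ge0_integral_setU//; first last.
  - apply/disj_setPRL => t [Dt nCt] [_ Ct]; exact: nCt.
  - by rewrite setUIDK => t Dt; rewrite lee_fin psi0.
  - by rewrite setUIDK.
  rewrite [X in (_ = _ + X)%E]integral0_eq ?adde0; last first.
    by move=> t [Dt nCt]; rewrite psiC.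
  transitivity (\int[stieltjes T x]_(t in D `&` C) (`|psi t|)%:E)%E; last first.
    by apply: eq_integral => t /set_mem[Dt _]; rewrite ger0_norm// psi0.
  rewrite integral_countable//; first last.
  - by apply/measurable_EFinP/measurableT_comp => //; apply: measurable_funS mpsi => // t [/DT].
  - by apply: sub_countable cC; apply: subset_card_le => t [].
  apply: eq_esum => t [Dt _].
  by rewrite ger0_norm ?psi0// (stieltjes_jump T_gt0 dx) ?DTi.
have pC t : D t -> ~ C t -> jump T y t = 0.
  move=> Dt /negP; rewrite -leNgt (stieltjes_jump T_gt0 dy) ?DTi// lee_fin => h.
  by apply/eqP; rewrite eq_le h jy.
rewrite /signed_sum /Rintegral integralE fineB; last 2 first.
- apply: integrable_pos_fin_num => //; exact: bounded_path_integrable.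
- apply: integrable_neg_fin_num => //; exact: bounded_path_integrable.
rewrite funerpos funerneg.
have bpos psi : bounded_path psi -> bounded_path psi^\+.
  move=> [mp [M pM]]; split; first exact: measurable_funrpos.
  exists M => t tT; apply: le_trans (pM t tT); rewrite /funrpos.
  by rewrite ger0_norm ?le_max ?lexx ?orbT// ge_max normr_ge0 ler_norm.
have bneg psi : bounded_path psi -> bounded_path psi^\-.
  move=> [mp [M pM]]; split; first exact: measurable_funrneg.
  exists M => t tT; apply: le_trans (pM t tT); rewrite /funrneg.
  by rewrite ger0_norm ?le_max ?lexx ?orbT// ge_max normr_ge0 -normrN ler_norm.
congr (fine _ - fine _).
- rewrite -main; [|exact: bpos|by move=> *; exact: funrpos_ge0|]; last first.
    by move=> t Dt nC; rewrite /funrpos pC// mulr0 maxxx.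
  by apply: eq_esum => t Dt; rewrite /funrpos maxr_pMl ?jx// mul0r.
- rewrite -main; [|exact: bneg|by move=> *; exact: funrneg_ge0|]; last first.
    by move=> t Dt nC; rewrite /funrneg pC// mulr0 oppr0 maxxx.
  apply: eq_esum => t Dt; rewrite /funrneg maxr_pMl ?jx// mul0r.
  by rewrite mulNr.
Qed.

End path_functional.

Lemma add3ACA (V : zmodType) (a a' b b' c c' : V) :
  (a + a') + (b + b') + (c + c') = (a + b + c) + (a' + b' + c').
Proof. by rewrite (addrACA a) (addrACA (a + b)). Qed.

Lemma scale3 (V : comPzRingType) (a b p q r : V) :
  a * (b * p) + b * (a * q) + a * (b * r) = a * b * (p + q + r).
Proof. by ring. Qed.

(** * Splitting, scaling and symmetry of the pathwise payoff *)

Section stopped_payoff.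
Context {R : realType} (T : R).
Hypothesis T_gt0 : 0 < T.
Variables f g h : R -> R.
Hypotheses (bf : bounded_path T f) (bg : bounded_path T g) (bh : bounded_path T h).
Implicit Types x y : R -> R.

(** The bracket of [J] along one pair of paths: by unfolding, the integrand of [J] is [Pi w] times
    this. *)
Definition path_payoff (theta : R) x y : R :=
  \int[stieltjes T x]_(t in `[theta, T[) (f t * (1 - y t)) +
  \int[stieltjes T y]_(t in `[theta, T[) (g t * (1 - x t)) +
  signed_sum `[theta, T] (fun t => h t * jump T y t * jump T x t).

(** The diagonal is written as an integral against the first path, the form in which it can be split
    and compared. Atoms at [theta] are left to the payoff from [theta] on. *)
Definition path_payoff_before (theta : R) x y : R :=
  \int[stieltjes T x]_(t in `[0, theta[) (f t * (1 - y t)) +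
  \int[stieltjes T y]_(t in `[0, theta[) (g t * (1 - x t)) +
  \int[stieltjes T x]_(t in `[0, theta[) (h t * jump T y t).

Lemma Rintegral_split x phi (b : bool) (lam : R) : distribution_path T x -> bounded_path T phi ->
  0 <= lam <= T ->
  \int[stieltjes T x]_(t in [set` Interval (BLeft 0) (BSide b T)]) phi t =
  \int[stieltjes T x]_(t in `[0, lam[) phi t +
  \int[stieltjes T x]_(t in [set` Interval (BLeft lam) (BSide b T)]) phi t.
Proof.
move=> dx bp /andP[l0 lT].
rewrite -Rintegral_setU//.
- congr Rintegral; rewrite -itv_bndbnd_setU//; rewrite bnd_simp//.
- apply: bounded_path_integrable => //; first exact: measurableU.
  move=> t [] /=; rewrite !in_itv /= => /andP[t1 t2].
    by rewrite t1 (le_trans (ltW t2)).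
  rewrite (le_trans l0 t1)/=; move: t2; case: (b) => //=; exact: ltW.
- apply/disj_setPRL => t /=; rewrite !in_itv /= => /andP[lt _] /andP[_].
  by rewrite ltNge lt.
Qed.

Lemma path_payoff_split lam x y : distribution_path T x -> distribution_path T y ->
  0 <= lam <= T ->
  path_payoff 0 x y = path_payoff_before lam x y + path_payoff lam x y.
Proof.
move=> dx dy lamT; rewrite /path_payoff /path_payoff_before.
have bx := bounded_survival T_gt0 dx; have by_ := bounded_survival T_gt0 dy.
have bj := bounded_jump T_gt0 dy.
have /andP[l0 lT] := lamT.
rewrite !(signed_sum_integral T_gt0)//; last first.
  by move=> t; rewrite /= !in_itv /= => /andP[lt ->]; rewrite (le_trans l0).
have bf' := bounded_pathM bf by_; have bg' := bounded_pathM bg bx; have bh' := bounded_pathM bh bj.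
rewrite (Rintegral_split true dx bf' lamT) (Rintegral_split true dy bg' lamT)
  (Rintegral_split false dx bh' lamT).
by rewrite add3ACA.
Qed.

Lemma Rintegral_before x x' phi lam : distribution_path T x -> distribution_path T x' ->
  0 <= lam <= T -> bounded_path T phi ->
  (forall t, 0 <= t < lam -> x t = x' t) ->
  \int[stieltjes T x]_(t in `[0, lam[) phi t = \int[stieltjes T x']_(t in `[0, lam[) phi t.
Proof.
move=> dx dx' lamT bp xx'; have /andP[l0 lT] := lamT.
rewrite /Rintegral (eq_measure_integral (stieltjes T x'))// => A mA Al.
apply: (@stieltjes_before _ T T_gt0 x x' lam dx dx') => //.
- move=> t tl; have [t0|t0] := ltP t 0; first by rewrite !extend_lt0.
  have tT : 0 <= t <= T by rewrite t0 (le_trans (ltW tl)).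
  by rewrite !extend_itv// xx'// t0.
- by move=> t /Al /=; rewrite !in_itv /= => /andP[].
Qed.

Lemma path_payoff_before_eq lam x y x' y' :
  distribution_path T x -> distribution_path T y ->
  distribution_path T x' -> distribution_path T y' -> 0 <= lam <= T ->
  (forall t, 0 <= t < lam -> x t = x' t) -> (forall t, 0 <= t < lam -> y t = y' t) ->
  path_payoff_before lam x y = path_payoff_before lam x' y'.
Proof.
move=> dx dy dx' dy' lamT xx' yy'; rewrite /path_payoff_before.
have bx := bounded_survival T_gt0 dx; have by_ := bounded_survival T_gt0 dy.
have bj := bounded_jump T_gt0 dy.
have bf' := bounded_pathM bf by_; have bg' := bounded_pathM bg bx; have bh' := bounded_pathM bh bj.
rewrite (Rintegral_before dx dx' lamT bf' xx') (Rintegral_before dy dy' lamT bg' yy')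
  (Rintegral_before dx dx' lamT bh' xx').
have jy t : 0 <= t < lam -> jump T y t = jump T y' t.
  move=> /andP[t0 tl]; rewrite /jump yy' ?t0//; congr (_ - _).
  apply: left_lim_local => // s st; have [s0|s0] := ltP s 0; first by rewrite !extend_lt0.
  have sl := lt_trans st tl; have sT : s <= T.
    by rewrite (le_trans (ltW sl))//; case/andP: lamT.
  by rewrite !extend_itv ?s0// yy' ?s0.
congr (_ + _ + _); apply: eq_Rintegral => t /set_mem; rewrite /= in_itv /= => tl.
- by rewrite yy'.
- by rewrite xx'.
- by rewrite jy.
Qed.

Lemma Rintegral_after x x' phi (D : set R) lam :
  distribution_path T x -> distribution_path T x' -> 0 <= lam <= T ->
  bounded_path T phi -> measurable D -> D `<=` `[lam, T] ->
  left_lim T x' lam = 0 ->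
  (forall t, lam <= t <= T -> x t = left_lim T x lam + (1 - left_lim T x lam) * x' t) ->
  \int[stieltjes T x]_(t in D) phi t =
  (1 - left_lim T x lam) * \int[stieltjes T x']_(t in D) phi t.
Proof.
move=> dx dx' lamT bp mD DT x'0 xx'.
have /andP[l0 lT] := lamT.
have a0 : 0 <= 1 - left_lim T x lam.
  by rewrite subr_ge0; case/andP: (left_lim_bound T_gt0 dx lam).
have DT' : D `<=` `[0, T].
  by move=> t /DT /=; rewrite !in_itv /= => /andP[lt ->]; rewrite (le_trans l0).
have [mp _] := bp.
have mpD : measurable_fun D (EFin \o phi).
  by apply/measurable_EFinP; exact: measurable_funS mp.
have scale psi : measurable_fun D psi -> (forall t, 0 <= psi t)%E ->
    (\int[stieltjes T x]_(t in D) psi t =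
     (1 - left_lim T x lam)%:E * \int[stieltjes T x']_(t in D) psi t)%E.
  move=> mpsi psi0.
  rewrite (eq_measure_integral (mscale (NngNum a0) (stieltjes T x'))).
    by rewrite ge0_integral_mscale.
  move=> A mA AD; rewrite /= /mscale /=.
  apply: stieltjes_after => //; last first.
    by move=> t /AD /DT /=; rewrite !in_itv /= andbT => /andP[].
  move=> t lt; have [tT|/ltW tT] := leP t T.
    by rewrite !extend_itv ?tT ?(le_trans l0)// xx'// lt.
  by rewrite !extend_geT// xx'// lT lexx.
have ix' : (stieltjes T x').-integrable D (EFin \o phi) by exact: bounded_path_integrable.
rewrite /Rintegral integralE scale; [|exact: measurable_funepos|exact: funepos_ge0].
rewrite [X in (_ - X)%E]scale; [|exact: measurable_funeneg|exact: funeneg_ge0].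
have mD' : measurable (D : set (measurableTypeR R)) by exact: mD.
have fp := integrable_pos_fin_num mD' ix'; have fn := integrable_neg_fin_num mD' ix'.
rewrite [in RHS]integralE -muleBr//; last by rewrite fin_num_adde_defr.
by rewrite fineM// fin_numB fp fn.
Qed.

(** Every term is bilinear in the remaining masses: the measure contributes the factor of one
    player, and the integrand, a survival function or a jump, that of the other. *)
Lemma path_payoff_after lam x y x' y' :
  distribution_path T x -> distribution_path T y ->
  distribution_path T x' -> distribution_path T y' -> 0 <= lam <= T ->
  left_lim T x' lam = 0 -> left_lim T y' lam = 0 ->
  (forall t, lam <= t <= T -> x t = left_lim T x lam + (1 - left_lim T x lam) * x' t) ->
  (forall t, lam <= t <= T -> y t = left_lim T y lam + (1 - left_lim T y lam) * y' t) ->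
  path_payoff lam x y =
  (1 - left_lim T x lam) * (1 - left_lim T y lam) * path_payoff lam x' y'.
Proof.
move=> dx dy dx' dy' lamT x'0 y'0 xx' yy'; rewrite /path_payoff.
have /andP[l0 lT] := lamT.
have bx := bounded_survival T_gt0 dx; have by_ := bounded_survival T_gt0 dy.
have bj := bounded_jump T_gt0 dy.
have bx' := bounded_survival T_gt0 dx'; have by_' := bounded_survival T_gt0 dy'.
have bj' := bounded_jump T_gt0 dy'.
have lTT : `[lam, T] `<=` `[0, T].
  by move=> t; rewrite /= !in_itv /= => /andP[lt ->]; rewrite (le_trans l0).
have oc : `[lam, T[ `<=` `[lam, T].
  by move=> t; rewrite /= !in_itv /= => /andP[lt /ltW ->]; rewrite lt.
have oT := subset_trans oc lTT.
rewrite !(signed_sum_integral T_gt0)//.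
have bf' := bounded_pathM bf by_; have bg' := bounded_pathM bg bx; have bh' := bounded_pathM bh bj.
have cf' := bounded_pathM bf by_'; have cg' := bounded_pathM bg bx'; have ch' := bounded_pathM bh bj'.
rewrite (Rintegral_after dx dx' lamT bf' _ oc x'0 xx')//.
rewrite (Rintegral_after dy dy' lamT bg' _ oc y'0 yy')//.
rewrite (Rintegral_after dx dx' lamT bh' _ _ x'0 xx')//.
have e1 : \int[stieltjes T x']_(t in `[lam, T[) (f t * (1 - y t)) =
    (1 - left_lim T y lam) * \int[stieltjes T x']_(t in `[lam, T[) (f t * (1 - y' t)).
  rewrite -RintegralZl//; last exact: bounded_path_integrable.
  apply: eq_Rintegral => t /set_mem; rewrite /= in_itv /= => /andP[lt tT].
  by rewrite yy' ?lt ?ltW//; ring.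
have e2 : \int[stieltjes T y']_(t in `[lam, T[) (g t * (1 - x t)) =
    (1 - left_lim T x lam) * \int[stieltjes T y']_(t in `[lam, T[) (g t * (1 - x' t)).
  rewrite -RintegralZl//; last exact: bounded_path_integrable.
  apply: eq_Rintegral => t /set_mem; rewrite /= in_itv /= => /andP[lt tT].
  by rewrite xx' ?lt ?ltW//; ring.
have e3 : \int[stieltjes T x']_(t in `[lam, T]) (h t * jump T y t) =
    (1 - left_lim T y lam) * \int[stieltjes T x']_(t in `[lam, T]) (h t * jump T y' t).
  rewrite -RintegralZl//; last exact: bounded_path_integrable.
  apply: eq_Rintegral => t /set_mem; rewrite /= in_itv /= => ltT.
  rewrite (jump_after T_gt0 dy dy' lamT y'0 _ ltT); first ring.
  move=> s ls; have [sT|/ltW sT] := leP s T.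
    by rewrite !extend_itv ?sT ?(le_trans l0)// yy'// ls.
  by rewrite !extend_geT// yy'// lT lexx.
by rewrite e1 e2 e3 scale3.
Qed.

(** The left-hand side books the diagonal under [y] instead of [x] and lists the common atom at [T]
    apart. The diagonal sum is symmetric in the two paths, so [signed_sum_integral] applies with the
    roles exchanged, and the closed interval is cut at [T]. *)
Lemma path_payoff_bar lam x y :
  distribution_path T x -> distribution_path T y -> 0 <= lam <= T ->
  \int[stieltjes T x]_(t in `[lam, T[) ((1 - y t) * f t) +
  \int[stieltjes T y]_(t in `[lam, T[) ((1 - x t) * g t + h t * jump T x t) +
  h T * jump T y T * jump T x T = path_payoff lam x y.
Proof.
move=> dx dy lamT; rewrite /path_payoff.
have /andP[l0 lT] := lamT.
have lTT : `[lam, T] `<=` `[0, T].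
  by move=> t; rewrite /= !in_itv /= => /andP[lt ->]; rewrite (le_trans l0).
have oT : `[lam, T[ `<=` `[0, T].
  by move=> t; rewrite /= !in_itv /= => /andP[lt /ltW ->]; rewrite (le_trans l0).
have bx := bounded_survival T_gt0 dx.
have bj := bounded_jump T_gt0 dx.
have bg' := bounded_pathM bx bg; have bh' := bounded_pathM bh bj.
rewrite RintegralD//; [|exact: bounded_path_integrable|exact: bounded_path_integrable].
rewrite -!addrA; congr (_ + _); first by apply: eq_Rintegral => t _; rewrite mulrC.
congr (_ + _); first by apply: eq_Rintegral => t _; rewrite mulrC.
have -> : (fun t => h t * jump T y t * jump T x t) = (fun t => h t * jump T x t * jump T y t).
  by apply/funext => t; ring.
rewrite (signed_sum_integral T_gt0)//.
have -> : `[lam, T]%classic = `[lam, T[%classic `|` [set T] :> set R.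
  by rewrite setUitv1// bnd_simp.
rewrite Rintegral_setU//.
- congr (_ + _).
  have TT : 0 <= T <= T by rewrite lexx ltW.
  transitivity (\int[stieltjes T y]_(t in [set T]) (cst (h T * jump T x T) t)).
    by rewrite Rintegral_cst// (stieltjes_jump T_gt0 dy)//= mulrAC.
  by apply: eq_Rintegral => t /set_mem ->.
- apply: bounded_path_integrable => //; first exact: measurableU.
  by move=> t [/oT//|->]; rewrite /= in_itv /= lexx ltW.
- by apply/disj_setPRL => t -> /=; rewrite in_itv /= ltxx andbF.
Qed.

End stopped_payoff.

Lemma measurable_fun_countable d1 d2 d3 (S1 : measurableType d1) (S2 : measurableType d2)
    (S3 : measurableType d3) (k : S1 -> nat) (f : nat -> S2 -> S3) :
  (forall n, measurable [set s | k s = n]) -> (forall n, measurable_fun setT (f n)) ->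
  measurable_fun setT (fun s : S1 * S2 => f (k s.1) s.2).
Proof.
move=> mk mf _ B mB; rewrite setTI.
rewrite (_ : _ @^-1` _ = \bigcup_n ([set s | k s = n] `*` (f n @^-1` B))); last first.
  apply/seteqP; split => [[s1 s2] /= Bs|[s1 s2] [n _ [/= <-]]//].
  by exists (k s1).
apply: bigcupT_measurable => n; apply: measurableX => //.
by rewrite -[X in measurable X]setTI; exact: mf.
Qed.

Lemma cvg_at_right_seq (R : realType) (x : R -> R) (l t : R) (u : nat -> R) :
  x s @[s --> t^'+] --> l -> u n @[n --> \oo] --> t -> (forall n, t < u n) ->
  x (u n) @[n --> \oo] --> l.
Proof.
move=> xl ut tu; apply: (cvg_comp u x) xl.
move=> A [e /= e0 eA]; have := ut; move=> /cvgrPdist_lt /(_ _ e0).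
by apply: filterS => n un; exact: eA.
Qed.

(** * Payoffs of randomised times *)

Section joint_measurability.
Context {R : realType} (T : R) d (S : measurableType d) (X : R -> S -> R).
Hypothesis T_gt0 : 0 < T.
Hypothesis cX : forall w, cadlag T (X^~ w).
Hypothesis mX : forall t, 0 <= t <= T -> measurable_fun setT (X t).

Let grid n k : R := Num.min T (k.+1%:R / n.+1%:R).

(** The path is sampled at a grid point strictly to the right of [t], and right continuity gives the
    limit; [T] itself is kept apart. Since only the measurability of each [X t] enters, this applies
    to Omega with the smaller sigma-algebra [FF T], beyond what [Lb] provides. *)
Lemma cadlag_jointly_measurable :
  measurable_fun setT (fun tw : R * S => if 0 <= tw.1 <= T then X tw.1 tw.2 else 0).
Proof.
pose k n (t : R) := Num.trunc (t * n.+1%:R).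
pose Z n (tw : R * S) := if 0 <= tw.1 <= T then
  (if tw.1 < T then X (grid n (k n tw.1)) tw.2 else X T tw.2) else 0.
apply: (@measurable_fun_cvg _ _ _ _ Z).
  move=> n.
  have mk m : measurable [set s | k n s = m].
    have mle p : measurable [set s | (k n s <= p)%N].
      rewrite (_ : [set s | _] = `]-oo, (p.+1%:R / n.+1%:R)[%classic)//.
      by apply/seteqP; split=> s /=; rewrite in_itv /= truncn_le_nat ltr_pdivlMr.
    case: m => [|m].
      rewrite (_ : [set s | _] = [set s | (k n s <= 0)%N])//.
      by apply/seteqP; split=> s /=; rewrite leqn0; [move=> ->|move/eqP].
    rewrite (_ : [set s | _] = [set s | (k n s <= m.+1)%N] `\` [set s | (k n s <= m)%N]).
      exact: measurableD.
    apply/seteqP; split=> s /=; first by move=> ->; split => //; rewrite ltnn.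
    by move=> [h1 /negP]; rewrite -ltnNge => h2; apply/eqP; rewrite eqn_leq h1.
  apply: measurable_fun_ifT.
  - apply: measurable_and; apply: measurable_fun_ler => //; exact: measurable_cst.
  - apply: measurable_fun_ifT.
    + by apply: measurable_fun_ltr => //; exact: measurable_cst.
    + apply: (measurable_fun_countable (f := fun m => X (grid n m))) => // m.
      apply: mX; rewrite ge_min lexx/= le_min (ltW T_gt0)/=.
      by rewrite divr_ge0.
    + by apply: (@measurableT_comp _ _ _ _ _ _ (X T)) => //; apply: mX; rewrite lexx ltW.
  - exact: measurable_cst.
move=> [t w] _; rewrite /Z /=; have [tT|tT] := boolP (0 <= t <= T); last exact: cvg_cst.
have /andP[t0 tT0] := tT.
have [tT'|tT'] := ltP t T; last first.
  have -> : t = T by apply/eqP; rewrite eq_le tT0 tT'.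
  exact: cvg_cst.
have tk n : t < (k n t).+1%:R / n.+1%:R.
  by rewrite ltr_pdivlMr// truncnS_gt.
apply: (@cvg_at_right_seq R (X^~ w) (X t w) t (fun n => grid n (k n t))).
- by have [+ _] := cX w; apply; rewrite t0 tT'.
- apply: (@squeeze_cvgr _ _ _ _ (fun=> t) (fun n => t + n.+1%:R^-1)).
  + near=> n; rewrite /grid ltW ?lt_min ?tT' ?tk//=.
    rewrite ge_min; apply/orP; right; rewrite ler_pdivrMr// mulrDl mulVf// -natr1 lerD2r.
    by rewrite truncn_le mulr_ge0.
  + exact: cvg_cst.
  + rewrite -[X in _ --> X]addr0; apply: cvgD; first exact: cvg_cst.
    exact: cvg_harmonic.
- by move=> n; rewrite /grid lt_min tT' tk.
Unshelve. all: end_near. Qed.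

End joint_measurability.

Lemma eq_measure_rectangles d1 d2 (S1 : measurableType d1) (S2 : measurableType d2)
    (R : realType) (m1 m2 : {measure set (S1 * S2) -> \bar R}) :
  (m1 setT < +oo)%E ->
  (forall A B, measurable A -> measurable B -> m1 (A `*` B) = m2 (A `*` B)) ->
  forall C, measurable C -> m1 C = m2 C.
Proof.
move=> fin H C mC.
apply: (@measure_unique _ R (S1 * S2)%type
  [set A `*` B | A in measurable & B in measurable] (fun=> setT) _ _ _ _ m1 m2 _ _ C mC).
- exact: measurable_prod_measurableType.
- move=> _ _ [A mA [B mB <-]] [A' mA' [B' mB' <-]].
  exists (A `&` A'); first exact: measurableI.
  by exists (B `&` B'); [exact: measurableI|rewrite setXI].
- by move=> _; exists setT => //; exists setT => //; rewrite setXTT.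
- by rewrite bigcup_const.
- by move=> _ [A mA [B mB <-]]; exact: H.
- by [].
Qed.

(** * Averaging over two independent uniform devices *)

Section independent_devices.
Context {R : realType} {d} {Omega : measurableType d} (P : probability Omega R).
Context {dS} {S : measurableType dS} (iota : Omega -> S) (Z1 Z2 : Omega -> R).
Hypotheses (miota : measurable_fun setT iota) (mZ1 : measurable_fun setT Z1)
  (mZ2 : measurable_fun setT Z2).
Local Notation U := (unif (R := R)).
Local Open Scope ereal_scope.
Hypothesis indep : forall A B1 B2, measurable A -> measurable B1 -> measurable B2 ->
  P (iota @^-1` A `&` Z1 @^-1` B1 `&` Z2 @^-1` B2) = P (iota @^-1` A) * U B1 * U B2.

Let PS := distribution P (mfun_of miota).
Let mpair : measurable_fun setT (fun w => (iota w, Z1 w)).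
Proof. exact: measurable_fun_pair. Qed.
Let Q := distribution P (mfun_of mpair).
Let mtriple : measurable_fun setT (fun w => ((iota w, Z1 w), Z2 w)).
Proof. exact: measurable_fun_pair. Qed.
Let Q3 := distribution P (mfun_of mtriple).

Let QE E : measurable E -> (PS \x U) E = Q E.
Proof.
apply: product_measure_unique => A B mA mB.
have := indep mA mB measurableT.
by rewrite preimage_setT setIT probability_setT mule1 => <-.
Qed.

Let Q3E E : measurable E -> (Q \x U) E = Q3 E.
Proof.
apply: product_measure_unique => A B mA mB.
have mZB : measurable (Z2 @^-1` B) by rewrite -[X in measurable X]setTI; exact: mZ2.
have c0 : (0 <= fine (U B))%R by rewrite fine_ge0.
have UB : (fine (U B))%:E = U B by rewrite fineK// fin_num_measure.
(* For fixed [B] both sides are finite measures of [A]; by [indep] they agree on rectangles. *)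
suff : pushforward (mrestr P mZB) (fun w => (iota w, Z1 w)) A = mscale (NngNum c0) Q A.
  rewrite /mscale /= UB muleC => <-.
  by rewrite /Q3 /distribution /pushforward /= /mrestr.
apply: eq_measure_rectangles => //.
- by rewrite /= /pushforward preimage_setT /mrestr setTI; apply: le_lt_trans (probability_le1 _ _) (ltry 1).
- move=> A1 B1 mA1 mB1; rewrite /= /mscale /= UB /pushforward /mrestr.
  rewrite -[LHS]/(P (iota @^-1` A1 `&` Z1 @^-1` B1 `&` Z2 @^-1` B)) indep//.
  have := indep mA1 mB1 measurableT.
  rewrite preimage_setT setIT probability_setT mule1 => h.
  by rewrite muleC -h.
Qed.

Lemma integral_independent_devices (F : (S * R) * R -> \bar R) :
  measurable_fun setT F -> (forall c, 0 <= F c) ->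
  \int[P]_w F ((iota w, Z1 w), Z2 w) =
  \int[P]_w \int[U]_z1 \int[U]_z2 F ((iota w, z1), z2).
Proof.
move=> mF F0.
transitivity (\int[Q3]_c F c).
  by rewrite ge0_integral_distribution.
rewrite (eq_measure_integral (Q \x U)); last by move=> A mA _; exact/esym/Q3E.
rewrite fubini_tonelli1//.
have mG : measurable_fun setT (fubini_F U F) by exact: measurable_fun_fubini_tonelli_F.
have G0 c : 0 <= fubini_F U F c by exact: integral_ge0.
rewrite (eq_measure_integral (PS \x U)); last by move=> A mA _; exact/esym/QE.
rewrite fubini_tonelli1// ge0_integral_distribution//.
- exact: measurable_fun_fubini_tonelli_F.
- by move=> s; exact: integral_ge0.
Qed.

End independent_devices.

Section randomised_kernel.
Context {R : realType} (T : R) {dS} {S : measurableType dS} (xi zeta : R -> S -> R).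
Hypothesis T_gt0 : 0 < T.
Hypotheses (dxi : forall s, distribution_path T (xi^~ s))
  (dzeta : forall s, distribution_path T (zeta^~ s)).
Hypotheses (mxi : forall t, 0 <= t <= T -> measurable_fun setT (xi t))
  (mzeta : forall t, 0 <= t <= T -> measurable_fun setT (zeta t)).
Local Notation U := (unif (R := R)).
Local Open Scope ereal_scope.
Variables (C : set (R * R)) (phi : R * S -> \bar R).
Hypotheses (mC : measurable C) (mphi : measurable_fun setT phi) (phi0 : forall c, 0 <= phi c).

(** The average over the devices, at fixed [s], of [phi] at the time generated by [xi] on the event
    that the pair of times lies in [C]. Taking the strict order or equality for [C] yields the terms
    of the payoff. *)
Definition randomised_kernel (s : S) : \bar R :=
  \int[stieltjes T (xi^~ s)]_t (phi (t, s) * stieltjes T (zeta^~ s) (xsection C t)).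

Definition randomised_integrand (c : (S * R) * R) : \bar R :=
  let t := quantile T (xi^~ c.1.1) c.1.2 in
  phi (t, c.1.1) * (\1_C (t, quantile T (zeta^~ c.1.1) c.2))%:E.

Lemma randomised_integrand_ge0 c : 0 <= randomised_integrand c.
Proof. by rewrite mule_ge0. Qed.

Lemma measurable_randomised_integrand : measurable_fun setT randomised_integrand.
Proof.
have mq1 : measurable_fun setT (fun c : (S * R) * R => quantile T (xi^~ c.1.1) c.1.2).
  have m := measurable_quantile T_gt0 (fun s => dpath_nondecreasing (dxi s)) mxi.
  exact: (measurableT_comp m measurable_fst).
have mq2 : measurable_fun setT (fun c : (S * R) * R => quantile T (zeta^~ c.1.1) c.2).
  have m := measurable_quantile T_gt0 (fun s => dpath_nondecreasing (dzeta s)) mzeta.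
  apply: (measurableT_comp m (g := fun c : (S * R) * R => (c.1.1, c.2))).
  apply: measurable_fun_pair => //.
  exact: (measurableT_comp measurable_fst measurable_fst).
apply: emeasurable_funM.
  apply: (measurableT_comp mphi (g := fun c : (S * R) * R =>
    (quantile T (xi^~ c.1.1) c.1.2, c.1.1))).
  apply: measurable_fun_pair => //.
  exact: (measurableT_comp measurable_fst measurable_fst).
apply/measurable_EFinP.
apply: (measurableT_comp (measurable_indic mC) (g := fun c : (S * R) * R =>
  (quantile T (xi^~ c.1.1) c.1.2, quantile T (zeta^~ c.1.1) c.2))).
exact: measurable_fun_pair.
Qed.

(** The inverse transform is used twice: for the section of [C] under [zeta], then for the time
    integral under [xi]. *)
Lemma randomised_kernelE s : randomised_kernel s =
  \int[U]_z1 \int[U]_z2 randomised_integrand ((s, z1), z2).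
Proof.
have mq2 := measurable_quantile_path T_gt0 (dzeta s).
have sec t : \int[U]_z2 (phi (t, s) * (\1_C (t, quantile T (zeta^~ s) z2))%:E) =
    phi (t, s) * stieltjes T (zeta^~ s) (xsection C t).
  have mx : measurable (xsection C t) by exact: measurable_xsection.
  have mqx : measurable (quantile T (zeta^~ s) @^-1` xsection C t).
    by rewrite -[X in measurable X]setTI; exact: mq2.
  rewrite (stieltjes_quantile T_gt0 (dzeta s))//.
  rewrite -[in RHS](setIT (_ @^-1` _)) -integral_indic// -ge0_integralZl//.
  - apply: eq_integral => z _; congr (_ * (_)%:E).
    by rewrite !indicE; congr ((nat_of_bool _)%:R)%R; apply/idP/idP; rewrite !inE /xsection /= ?inE.
  - by apply/measurable_EFinP; exact: measurable_indic.
rewrite /randomised_kernel (integral_stieltjes_quantile T_gt0 (dxi s))//.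
- by rewrite preimage_setT; apply: eq_integral => z _; rewrite /randomised_integrand /= sec.
- apply: emeasurable_funM.
    apply: (measurableT_comp mphi (g := fun t => (t, s))).
    by apply: measurable_fun_pair => //; exact: measurable_cst.
  apply: (eq_measurable_fun (fun t => distribution U (mfun_of mq2) (xsection C t))).
    move=> t _; rewrite (stieltjes_quantile T_gt0 (dzeta s))//.
    exact: measurable_xsection.
  exact: measurable_fun_xsection.
- by move=> t _; rewrite mule_ge0.
Qed.

(** The Stieltjes measures vary with [s], so measurability is read off the double integral against
    the fixed law [U]. *)
Lemma measurable_randomised_kernel : measurable_fun setT randomised_kernel.
Proof.
have -> : randomised_kernel = fubini_F U (fubini_F U randomised_integrand).
  by apply/funext => s; exact: randomised_kernelE.
have m := measurable_randomised_integrand.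
apply: measurable_fun_fubini_tonelli_F; last first.
  by move=> c; apply: integral_ge0 => z _; exact: randomised_integrand_ge0.
by apply: measurable_fun_fubini_tonelli_F => // c; exact: randomised_integrand_ge0.
Qed.

Lemma randomised_kernel_ge0 s : 0 <= randomised_kernel s.
Proof. by apply: integral_ge0 => t _; rewrite mule_ge0. Qed.

End randomised_kernel.

Section signed_kernel.
Context {R : realType} (T : R) {dS} {S : measurableType dS} (xi zeta : R -> S -> R).
Hypothesis T_gt0 : 0 < T.
Hypotheses (dxi : forall s, distribution_path T (xi^~ s))
  (dzeta : forall s, distribution_path T (zeta^~ s)).
Hypotheses (mxi : forall t, 0 <= t <= T -> measurable_fun setT (xi t))
  (mzeta : forall t, 0 <= t <= T -> measurable_fun setT (zeta t)).
Local Notation U := (unif (R := R)).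
Variables (C : set (R * R)) (phi : R -> S -> R).
Hypotheses (mC : measurable C)
  (mphi : measurable_fun setT (fun c : R * S => phi c.1 c.2)).

Let phip (c : R * S) : \bar R := (Num.max (phi c.1 c.2) 0)%:E.
Let phin (c : R * S) : \bar R := (Num.max (- phi c.1 c.2) 0)%:E.

Let mphip : measurable_fun setT phip.
Proof. by apply/measurable_EFinP; apply: measurable_maxr => //; exact: measurable_cst. Qed.

Let mphin : measurable_fun setT phin.
Proof.
apply/measurable_EFinP; apply: measurable_maxr; last exact: measurable_cst.
exact: (measurableT_comp (@oppr_measurable R setT) mphi).
Qed.

Let phip0 c : (0 <= phip c)%E. Proof. by rewrite lee_fin le_max lexx orbT. Qed.
Let phin0 c : (0 <= phin c)%E. Proof. by rewrite lee_fin le_max lexx orbT. Qed.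

Let Kp := randomised_kernel T xi zeta C phip.
Let Kn := randomised_kernel T xi zeta C phin.

(** The two parts stay separate because Tonelli's theorem treats nonnegative kernels without
    integrability; both are finite wherever [phi] is bounded along the path. *)
Definition signed_kernel (s : S) : R := fine (Kp s) - fine (Kn s).

Lemma section_le1 s t : (stieltjes T (zeta^~ s) (xsection C t) <= 1)%E.
Proof.
rewrite -(stieltjes_setT T_gt0 (dzeta s)); apply: le_measure; rewrite ?inE//.
exact: measurable_xsection.
Qed.

Lemma measurable_section s : measurable_fun setT
  (fun t => stieltjes T (zeta^~ s) (xsection C t)).
Proof.
have mq := measurable_quantile_path T_gt0 (dzeta s).
apply: (eq_measurable_fun (fun t => distribution U (mfun_of mq) (xsection C t))).
  move=> t _; rewrite (stieltjes_quantile T_gt0 (dzeta s))//.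
  exact: measurable_xsection.
exact: measurable_fun_xsection.
Qed.

Let K_bound s M (psi : R * S -> \bar R) : measurable_fun setT psi -> (forall c, 0 <= psi c)%E ->
  (forall t, psi (t, s) <= M%:E)%E -> (randomised_kernel T xi zeta C psi s <= M%:E)%E.
Proof.
move=> mpsi psi0 psiM.
have M0 : (0 <= M%:E)%E by apply: le_trans (psi0 (0, s)) (psiM 0).
apply: (@le_trans _ _ (\int[stieltjes T (xi^~ s)]_t cst M%:E t)%E); last first.
  by rewrite integral_cst// stieltjes_setT// mule1.
apply: ge0_le_integral => //.
- by move=> t _; rewrite mule_ge0.
- apply: emeasurable_funM; last exact: measurable_section.
  apply: (measurableT_comp mpsi (g := fun t => (t, s))).
  by apply: measurable_fun_pair => //; exact: measurable_cst.
- by move=> t _ /=; rewrite -[leRHS]mule1; apply: lee_pmul => //; exact: section_le1.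
Qed.

Lemma signed_kernelE s M : (forall t, `|phi t s| <= M) ->
  signed_kernel s = \int[stieltjes T (xi^~ s)]_t
    (phi t s * fine (stieltjes T (zeta^~ s) (xsection C t))).
Proof.
move=> phiM.
have fs t : (fine (stieltjes T (zeta^~ s) (xsection C t)))%:E =
    stieltjes T (zeta^~ s) (xsection C t).
  rewrite fineK// ge0_fin_numE//.
  by apply: le_lt_trans (section_le1 s t) (ltry 1).
have KpM : (Kp s <= M%:E)%E.
  by apply: K_bound => // t; rewrite lee_fin ge_max (le_trans _ (phiM t)) ?ler_norm//=;
    apply: le_trans (phiM t).
have KnM : (Kn s <= M%:E)%E.
  by apply: K_bound => // t; rewrite lee_fin ge_max (le_trans _ (phiM t)) ?ler_normNr//=;
    [apply: le_trans (phiM t)|rewrite -normrN ler_norm].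
have fKp : Kp s \is a fin_num.
  by rewrite ge0_fin_numE ?randomised_kernel_ge0//; apply: le_lt_trans KpM (ltry _).
have fKn : Kn s \is a fin_num.
  by rewrite ge0_fin_numE ?randomised_kernel_ge0//; apply: le_lt_trans KnM (ltry _).
rewrite /signed_kernel -fineB// /Rintegral; congr fine.
rewrite [RHS]integralE; congr (_ - _)%E.
- apply: eq_integral => t _; rewrite -[X in (_ * X)%E]fs /phip /= -EFinM.
  rewrite funeposE -EFin_max; congr EFin.
  by rewrite maxr_pMl ?mul0r// fine_ge0.
- apply: eq_integral => t _; rewrite -[X in (_ * X)%E]fs /phin /= -EFinM.
  rewrite funenegE -EFin_max; congr EFin.
  by rewrite maxr_pMl ?mul0r ?mulNr// fine_ge0.
Qed.

Section expectation.
Context {d} {Omega : measurableType d} (P : probability Omega R).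
Variables (iota : Omega -> S) (Z1 Z2 : Omega -> R) (M : Omega -> R).
Hypotheses (miota : measurable_fun setT iota) (mZ1 : measurable_fun setT Z1)
  (mZ2 : measurable_fun setT Z2).
Hypothesis indep : forall A B1 B2, measurable A -> measurable B1 -> measurable B2 ->
  (P (iota @^-1` A `&` Z1 @^-1` B1 `&` Z2 @^-1` B2) = P (iota @^-1` A) * U B1 * U B2)%E.
Hypothesis iM : P.-integrable setT (EFin \o M).
Hypothesis phiM : \forall w \ae P, forall t, `|phi t (iota w)| <= M w.

Let tau w := quantile T (xi^~ (iota w)) (Z1 w).
Let sigma w := quantile T (zeta^~ (iota w)) (Z2 w).

Let integral_K psi : measurable_fun setT psi -> (forall c, 0 <= psi c)%E ->
  (\int[P]_w randomised_kernel T xi zeta C psi (iota w) =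
   \int[P]_w randomised_integrand T xi zeta C psi ((iota w, Z1 w), Z2 w))%E.
Proof.
move=> mpsi psi0.
rewrite (integral_independent_devices miota mZ1 mZ2 indep).
- by apply: eq_integral => w _; rewrite randomised_kernelE.
- exact: measurable_randomised_integrand.
- by move=> c; exact: randomised_integrand_ge0.
Qed.

Let integrable_K psi : measurable_fun setT psi -> (forall c, 0 <= psi c)%E ->
  (\forall w \ae P, forall t, (psi (t, iota w) <= (M w)%:E)%E) ->
  P.-integrable setT (randomised_kernel T xi zeta C psi \o iota).
Proof.
move=> mpsi psi0 psiM.
have mK := measurable_randomised_kernel T_gt0 dxi dzeta mxi mzeta mC mpsi psi0.
have mKi : measurable_fun setT (randomised_kernel T xi zeta C psi \o iota).
  exact: (measurableT_comp mK miota).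
apply/integrableP; split; first exact: mKi.
apply: (@le_lt_trans _ _ (\int[P]_w (`|M w|)%:E)%E); last first.
  by have /integrableP[_] := iM.
apply: ae_ge0_le_integral => //.
- exact: (measurableT_comp (@abse_measurable R setT) mKi).
- by move: (measurable_int _ iM) => /measurable_EFinP mM; apply/measurable_EFinP; exact: measurableT_comp.
apply: filterS psiM => w h _ /=.
rewrite gee0_abs ?randomised_kernel_ge0//.
apply: (le_trans (K_bound mpsi psi0 h)).
by rewrite lee_fin ler_norm.
Qed.

Let Mp : \forall w \ae P, forall t, (phip (t, iota w) <= (M w)%:E)%E.
Proof.
apply: filterS phiM => w h t; rewrite lee_fin ge_max (le_trans _ (h t)) ?ler_norm//=.
exact: le_trans (h t).
Qed.

Let Mn : \forall w \ae P, forall t, (phin (t, iota w) <= (M w)%:E)%E.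
Proof.
apply: filterS phiM => w h t; rewrite lee_fin ge_max (le_trans _ (h t)) /=; last first.
  by rewrite -normrN ler_norm.
exact: le_trans (h t).
Qed.

Let fine_integrable (k : Omega -> \bar R) : P.-integrable setT k -> (forall w, 0 <= k w)%E ->
  P.-integrable setT (fun w => (fine (k w))%:E) /\
  (\int[P]_w (fine (k w))%:E = \int[P]_w k w)%E.
Proof.
move=> ik k0.
have mk := measurable_int _ ik.
have mfk : measurable_fun setT (fun w => (fine (k w))%:E).
  by apply/measurable_EFinP; apply: (measurableT_comp (@fine_measurable R setT measurableT)).
split.
  apply: le_integrable ik => // w _ /=.
  by case: (k w) (k0 w) => //= _; rewrite normr0 leey.
apply: ae_eq_integral => //.
by apply: filterS (integrable_ae measurableT ik) => w /(_ I) h _; rewrite fineK.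
Qed.

Let Kge0 psi : (forall c, 0 <= psi c)%E ->
  forall w, (0 <= (randomised_kernel T xi zeta C psi \o iota) w)%E.
Proof. by move=> psi0 w; exact: randomised_kernel_ge0. Qed.

Lemma integrable_signed_kernel : P.-integrable setT (fun w => (signed_kernel (iota w))%:E).
Proof.
have [ip _] := fine_integrable (integrable_K mphip phip0 Mp) (Kge0 phip0).
have [i_ _] := fine_integrable (integrable_K mphin phin0 Mn) (Kge0 phin0).
exact: (integrableB measurableT ip i_).
Qed.

Lemma expectation_signed_kernel :
  (\int[P]_w (signed_kernel (iota w))%:E =
   \int[P]_w (phi (tau w) (iota w) * \1_C (tau w, sigma w))%:E)%E.
Proof.
have [ip ep] := fine_integrable (integrable_K mphip phip0 Mp) (Kge0 phip0).
have [i_ en] := fine_integrable (integrable_K mphin phin0 Mn) (Kge0 phin0).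
rewrite (integralB measurableT ip i_) ep en !integral_K// [RHS]integralE.
congr (_ - _)%E; apply: eq_integral => w _; rewrite /randomised_integrand /=.
- rewrite funeposE -EFinM -EFin_max; congr EFin.
  by rewrite maxr_pMl ?mul0r.
- rewrite funenegE -EFinM -EFinN -EFin_max; congr EFin.
  by rewrite maxr_pMl ?mul0r ?mulNr.
Qed.

Lemma integrable_randomised_payoff :
  P.-integrable setT (fun w => (phi (tau w) (iota w) * \1_C (tau w, sigma w))%:E).
Proof.
have mtau : measurable_fun setT tau.
  have m := measurable_quantile T_gt0 (fun s => dpath_nondecreasing (dxi s)) mxi.
  apply: (measurableT_comp m (g := fun w => (iota w, Z1 w))).
  exact: measurable_fun_pair.
have msigma : measurable_fun setT sigma.
  have m := measurable_quantile T_gt0 (fun s => dpath_nondecreasing (dzeta s)) mzeta.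
  apply: (measurableT_comp m (g := fun w => (iota w, Z2 w))).
  exact: measurable_fun_pair.
have mF : measurable_fun setT (fun w => phi (tau w) (iota w) * \1_C (tau w, sigma w)).
  apply: measurable_funM.
    apply: (measurableT_comp mphi (g := fun w => (tau w, iota w))).
    exact: measurable_fun_pair.
  apply: (measurableT_comp (measurable_indic mC) (g := fun w => (tau w, sigma w))).
  exact: measurable_fun_pair.
apply/integrableP; split; first exact/measurable_EFinP.
apply: (@le_lt_trans _ _ (\int[P]_w (`|M w|)%:E)%E); last first.
  by have /integrableP[_] := iM.
apply: ae_ge0_le_integral => //.
- by apply: measurableT_comp => //; exact/measurable_EFinP.
- by move: (measurable_int _ iM) => /measurable_EFinP mM; apply/measurable_EFinP; exact: measurableT_comp.
apply: filterS phiM => w h _; rewrite abse_EFin lee_fin normrM.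
apply: (@le_trans _ _ `|phi (tau w) (iota w)|).
  by rewrite ler_piMr// indicE; case: (_ \in _); rewrite ?normr1 ?normr0.
exact: le_trans (h _) (ler_norm _).
Qed.

End expectation.

End signed_kernel.

Lemma integral_add3_eq d (S : measurableType d) (R : realType)
    (mu : {measure set S -> \bar R}) (a b c a' b' c' : S -> R) :
  mu.-integrable setT (fun w => (a w)%:E) -> mu.-integrable setT (fun w => (b w)%:E) ->
  mu.-integrable setT (fun w => (c w)%:E) -> mu.-integrable setT (fun w => (a' w)%:E) ->
  mu.-integrable setT (fun w => (b' w)%:E) -> mu.-integrable setT (fun w => (c' w)%:E) ->
  (\int[mu]_w (a w)%:E = \int[mu]_w (a' w)%:E)%E ->
  (\int[mu]_w (b w)%:E = \int[mu]_w (b' w)%:E)%E ->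
  (\int[mu]_w (c w)%:E = \int[mu]_w (c' w)%:E)%E ->
  (\int[mu]_w (a w + b w + c w)%:E = \int[mu]_w (a' w + b' w + c' w)%:E)%E.
Proof.
have add3 (u v t : S -> R) : mu.-integrable setT (fun w => (u w)%:E) ->
    mu.-integrable setT (fun w => (v w)%:E) -> mu.-integrable setT (fun w => (t w)%:E) ->
    (\int[mu]_w (u w + v w + t w)%:E =
     \int[mu]_w (u w)%:E + \int[mu]_w (v w)%:E + \int[mu]_w (t w)%:E)%E.
  move=> iu iv it.
  by rewrite -integralD// -integralD//; exact: (integrableD measurableT iu iv).
move=> ia ib ic ia' ib' ic' ea eb ec.
by rewrite add3// add3// ea eb ec.
Qed.

Section payoff_kernel.
Context {R : realType} (T : R) {dS} {S : measurableType dS}.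
Variables (f g h : R -> S -> R) (theta : S -> R) (xi zeta : R -> S -> R).
Hypothesis T_gt0 : 0 < T.
Hypotheses (dxi : forall s, distribution_path T (xi^~ s))
  (dzeta : forall s, distribution_path T (zeta^~ s)).
Hypotheses (mxi : forall t, 0 <= t <= T -> measurable_fun setT (xi t))
  (mzeta : forall t, 0 <= t <= T -> measurable_fun setT (zeta t)).
Hypotheses
  (mf : measurable_fun setT (fun c : R * S => if 0 <= c.1 <= T then f c.1 c.2 else 0))
  (mg : measurable_fun setT (fun c : R * S => if 0 <= c.1 <= T then g c.1 c.2 else 0))
  (mh : measurable_fun setT (fun c : R * S => if 0 <= c.1 <= T then h c.1 c.2 else 0)).
Hypotheses (mtheta : measurable_fun setT theta) (theta_itv : forall s, 0 <= theta s <= T).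

(** The outer test selects the times of integration; the inner one reproduces the form in which the
    payoffs are jointly measurable. *)
Definition cut_open (phi : R -> S -> R) t s : R :=
  if theta s <= t < T then (if 0 <= t <= T then phi t s else 0) else 0.
Definition cut_closed (phi : R -> S -> R) t s : R :=
  if theta s <= t <= T then (if 0 <= t <= T then phi t s else 0) else 0.

Definition lt_pairs : set (R * R) := [set c | c.1 < c.2].
Definition eq_pairs : set (R * R) := [set c | c.1 = c.2].

Lemma measurable_lt_pairs : measurable lt_pairs.
Proof.
rewrite -[X in measurable X]setTI.
exact: (@measurable_fun_ltr _ (R * R)%type R setT fst snd measurable_fst measurable_snd).
Qed.

Lemma measurable_eq_pairs : measurable eq_pairs.
Proof.
rewrite (_ : eq_pairs = [set c | c.1 <= c.2] `&` [set c | c.2 <= c.1]); last first.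
  by apply/seteqP; split => c /=; [move=> ->; rewrite lexx|move=> [? ?]; apply/eqP; rewrite eq_le; apply/andP].
apply: measurableI; rewrite -[X in measurable X]setTI.
  exact: (@measurable_fun_ler _ (R * R)%type R setT fst snd measurable_fst measurable_snd).
exact: (@measurable_fun_ler _ (R * R)%type R setT snd fst measurable_snd measurable_fst).
Qed.

Lemma xsection_lt_pairs t : xsection lt_pairs t = `]t, +oo[%classic.
Proof. by apply/seteqP; split => s; rewrite /xsection /= inE in_itv /= andbT. Qed.

Lemma xsection_eq_pairs t : xsection eq_pairs t = [set t].
Proof. by apply/seteqP; split => s; rewrite /xsection /= inE /eq_pairs /= => ->. Qed.

Let mth : measurable_fun setT (fun c : R * S => theta c.2).
Proof. exact: (measurableT_comp mtheta measurable_snd). Qed.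

Lemma measurable_cut_open (phi : R -> S -> R) :
  measurable_fun setT (fun c : R * S => if 0 <= c.1 <= T then phi c.1 c.2 else 0) ->
  measurable_fun setT (fun c : R * S => cut_open phi c.1 c.2).
Proof.
move=> mp; apply: measurable_fun_ifT => //.
apply: measurable_and.
  exact: measurable_fun_ler.
by apply: measurable_fun_ltr => //; exact: measurable_cst.
Qed.

Lemma measurable_cut_closed (phi : R -> S -> R) :
  measurable_fun setT (fun c : R * S => if 0 <= c.1 <= T then phi c.1 c.2 else 0) ->
  measurable_fun setT (fun c : R * S => cut_closed phi c.1 c.2).
Proof.
move=> mp; apply: measurable_fun_ifT => //.
apply: measurable_and.
  exact: measurable_fun_ler.
by apply: measurable_fun_ler => //; exact: measurable_cst.
Qed.

(** A stand-in for [path_payoff] built from kernels, whose dependence on [s] is measurable. In the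
    second term the players exchange roles, so [lt_pairs] there means that the second player stops
    first. *)
Definition payoff_kernel (s : S) : R :=
  signed_kernel T xi zeta lt_pairs (cut_open f) s +
  signed_kernel T zeta xi lt_pairs (cut_open g) s +
  signed_kernel T xi zeta eq_pairs (cut_closed h) s.

Lemma cut_open_bound (phi : R -> S -> R) s M : (forall t, 0 <= t <= T -> `|phi t s| <= M) ->
  forall t, `|cut_open phi t s| <= M.
Proof.
move=> H t; have M0 : 0 <= M.
  by apply: le_trans (H 0 _); rewrite // lexx ltW.
rewrite /cut_open; case: ifPn => _; last by rewrite normr0.
by case: ifPn => [|_]; [exact: H|rewrite normr0].
Qed.

Lemma cut_closed_bound (phi : R -> S -> R) s M : (forall t, 0 <= t <= T -> `|phi t s| <= M) ->
  forall t, `|cut_closed phi t s| <= M.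
Proof.
move=> H t; have M0 : 0 <= M.
  by apply: le_trans (H 0 _); rewrite // lexx ltW.
rewrite /cut_closed; case: ifPn => _; last by rewrite normr0.
by case: ifPn => [|_]; [exact: H|rewrite normr0].
Qed.

Lemma section_bounded_path (phi : R -> S -> R) s M :
  measurable_fun setT (fun c : R * S => if 0 <= c.1 <= T then phi c.1 c.2 else 0) ->
  (forall t, 0 <= t <= T -> `|phi t s| <= M) -> bounded_path T (phi^~ s).
Proof.
move=> mp pM; split; last by exists M.
apply: (eq_measurable_fun (fun t : R => if 0 <= t <= T then phi t s else 0 : R)).
  by move=> t /set_mem; rewrite /= in_itv /= => ->.
apply: measurable_funTS.
apply: (measurableT_comp mp (g := fun t => (t, s))).
by apply: measurable_fun_pair => //; exact: measurable_cst.
Qed.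

Lemma payoff_kernelE s M :
  (forall t, 0 <= t <= T -> `|f t s| <= M) -> (forall t, 0 <= t <= T -> `|g t s| <= M) ->
  (forall t, 0 <= t <= T -> `|h t s| <= M) ->
  payoff_kernel s =
  path_payoff T (f^~ s) (g^~ s) (h^~ s) (theta s) (xi^~ s) (zeta^~ s).
Proof.
move=> fM gM hM.
have /andP[th0 thT] := theta_itv s.
have openE (phi : R -> S -> R) x (c : R -> R) :
    \int[stieltjes T x]_(t in `[theta s, T[) (phi t s * c t) =
    \int[stieltjes T x]_t (cut_open phi t s * c t).
  rewrite Rintegral_mkcond; apply: eq_Rintegral => t _.
  rewrite patchE /cut_open; case: ifPn.
    rewrite inE /= in_itv /= => /andP[th tT].
    by rewrite th tT (le_trans th0 th) (ltW tT).
  by rewrite notin_setE /= in_itv /= => /negP/negbTE ->; rewrite mul0r.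
rewrite /payoff_kernel /path_payoff.
rewrite (signed_kernelE T_gt0 dxi dzeta measurable_lt_pairs (measurable_cut_open mf)
  (cut_open_bound fM)).
rewrite (signed_kernelE T_gt0 dzeta dxi measurable_lt_pairs (measurable_cut_open mg)
  (cut_open_bound gM)).
rewrite (signed_kernelE T_gt0 dxi dzeta measurable_eq_pairs (measurable_cut_closed mh)
  (cut_closed_bound hM)).
congr (_ + _ + _).
- rewrite openE//; apply: eq_Rintegral => t _.
  rewrite xsection_lt_pairs (stieltjes_itvoy T_gt0)//= /cut_open.
  case: ifPn => [/andP[th tT]|_]; last by rewrite !mul0r.
  by rewrite extend_itv// (le_trans th0 th) ltW.
- rewrite openE//; apply: eq_Rintegral => t _.
  rewrite xsection_lt_pairs (stieltjes_itvoy T_gt0)//= /cut_open.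
  case: ifPn => [/andP[th tT]|_]; last by rewrite !mul0r.
  by rewrite extend_itv// (le_trans th0 th) ltW.
- rewrite (signed_sum_integral T_gt0)//; last 2 first.
  + by move=> t /=; rewrite !in_itv /= => /andP[th ->]; rewrite (le_trans th0).
  + exact: section_bounded_path hM.
  rewrite [RHS]Rintegral_mkcond; apply: eq_Rintegral => t _.
  rewrite patchE xsection_eq_pairs; case: ifPn; last first.
    by rewrite notin_setE /= in_itv /= /cut_closed => /negP/negbTE ->; rewrite mul0r.
  rewrite inE /= in_itv /= /cut_closed => /andP[th tT].
  have tT' : 0 <= t <= T by rewrite (le_trans th0 th).
  by rewrite th tT (le_trans th0 th)/= (stieltjes_jump T_gt0).
Qed.

Section expectation.
Context {d} {Omega : measurableType d} (P : probability Omega R).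
Variables (iota : Omega -> S) (Z1 Z2 : Omega -> R) (M : Omega -> R).
Local Notation U := (unif (R := R)).
Hypotheses (miota : measurable_fun setT iota) (mZ1 : measurable_fun setT Z1)
  (mZ2 : measurable_fun setT Z2).
Hypothesis indep : forall A B1 B2, measurable A -> measurable B1 -> measurable B2 ->
  (P (iota @^-1` A `&` Z1 @^-1` B1 `&` Z2 @^-1` B2) = P (iota @^-1` A) * U B1 * U B2)%E.
Hypothesis iM : P.-integrable setT (EFin \o M).
Hypothesis fghM : \forall w \ae P, forall t, 0 <= t <= T ->
  [/\ `|f t (iota w)| <= M w, `|g t (iota w)| <= M w & `|h t (iota w)| <= M w].

Let indep' A B1 B2 : measurable A -> measurable B1 -> measurable B2 ->
  (P (iota @^-1` A `&` Z2 @^-1` B1 `&` Z1 @^-1` B2) = P (iota @^-1` A) * U B1 * U B2)%E.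
Proof. by move=> mA mB1 mB2; rewrite setIAC indep// muleAC. Qed.

Let fM : \forall w \ae P, forall t, `|cut_open f t (iota w)| <= M w.
Proof. by apply: filterS fghM => w H; apply: cut_open_bound => t /H[]. Qed.
Let gM : \forall w \ae P, forall t, `|cut_open g t (iota w)| <= M w.
Proof. by apply: filterS fghM => w H; apply: cut_open_bound => t /H[]. Qed.
Let hM : \forall w \ae P, forall t, `|cut_closed h t (iota w)| <= M w.
Proof. by apply: filterS fghM => w H; apply: cut_closed_bound => t /H[]. Qed.

Let mlt := measurable_lt_pairs.
Let meq := measurable_eq_pairs.
Let mcf := measurable_cut_open mf.
Let mcg := measurable_cut_open mg.
Let mch := measurable_cut_closed mh.

Let i1 : P.-integrable setT (fun w => (signed_kernel T xi zeta lt_pairs (cut_open f) (iota w))%:E).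
Proof. exact: (integrable_signed_kernel T_gt0 dxi dzeta mxi mzeta mlt mcf miota iM fM). Qed.
Let i2 : P.-integrable setT (fun w => (signed_kernel T zeta xi lt_pairs (cut_open g) (iota w))%:E).
Proof. exact: (integrable_signed_kernel T_gt0 dzeta dxi mzeta mxi mlt mcg miota iM gM). Qed.
Let i3 : P.-integrable setT (fun w => (signed_kernel T xi zeta eq_pairs (cut_closed h) (iota w))%:E).
Proof. exact: (integrable_signed_kernel T_gt0 dxi dzeta mxi mzeta meq mch miota iM hM). Qed.

Lemma integrable_payoff_kernel : P.-integrable setT (fun w => (payoff_kernel (iota w))%:E).
Proof. exact: (integrableD measurableT (integrableD measurableT i1 i2) i3). Qed.

Lemma payoff_kernel_ae : \forall w \ae P, payoff_kernel (iota w) =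
  path_payoff T (f^~ (iota w)) (g^~ (iota w)) (h^~ (iota w)) (theta (iota w))
    (xi^~ (iota w)) (zeta^~ (iota w)).
Proof.
by apply: filterS fghM => w H; apply: (payoff_kernelE (M := M w)) => t /H[].
Qed.

Let tau w := quantile T (xi^~ (iota w)) (Z1 w).
Let sigma w := quantile T (zeta^~ (iota w)) (Z2 w).

Definition randomised_payoff w : R :=
  if tau w < sigma w then f (tau w) (iota w) else
  if tau w == sigma w then h (tau w) (iota w) else g (sigma w) (iota w).

Hypothesis theta0 : theta = cst 0.

(** Whoever stops strictly first stops before [T], so the half-open cut-offs lose nothing; a tie may
    occur at [T], which is why the third one is closed. *)
Let randomised_payoffE w : randomised_payoff w =
  cut_open f (tau w) (iota w) * \1_lt_pairs (tau w, sigma w) +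
  cut_open g (sigma w) (iota w) * \1_lt_pairs (sigma w, tau w) +
  cut_closed h (tau w) (iota w) * \1_eq_pairs (tau w, sigma w).
Proof.
have ttau : 0 <= tau w <= T by exact: quantile_itv.
have tsigma : 0 <= sigma w <= T by exact: quantile_itv.
have /andP[tau0 tauT] := ttau; have /andP[sigma0 sigmaT] := tsigma.
have lt1 (s t : R) : (\1_lt_pairs (s, t) : R) = (s < t)%R%:R.
  by rewrite indicE; congr ((nat_of_bool _)%:R); apply/idP/idP; rewrite inE.
have eq1 (s t : R) : (\1_eq_pairs (s, t) : R) = (s == t)%:R.
  by rewrite indicE; congr ((nat_of_bool _)%:R); apply/idP/eqP; rewrite inE.
rewrite /randomised_payoff !lt1 eq1 /cut_open /cut_closed theta0 /= ttau tsigma.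
have [ts|st|<-] := ltgtP (tau w) (sigma w).
- by rewrite tau0 (lt_le_trans ts sigmaT)/= mulr1 !mulr0 !addr0.
- by rewrite sigma0 (lt_le_trans st tauT)/= mulr1 !mulr0 addr0 add0r.
- by rewrite mulr1 !mulr0 !add0r.
Qed.

Let r1 := integrable_randomised_payoff T_gt0 dxi dzeta mxi mzeta mlt mcf miota mZ1 mZ2 iM fM.
Let r2 := integrable_randomised_payoff T_gt0 dzeta dxi mzeta mxi mlt mcg miota mZ2 mZ1 iM gM.
Let r3 := integrable_randomised_payoff T_gt0 dxi dzeta mxi mzeta meq mch miota mZ1 mZ2 iM hM.

Lemma measurable_randomised_payoff : measurable_fun setT randomised_payoff.
Proof.
have m1 := measurable_int _ r1; have m2 := measurable_int _ r2; have m3 := measurable_int _ r3.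
apply: (eq_measurable_fun _ (fun w _ => esym (randomised_payoffE w))).
by apply: measurable_funD; [apply: measurable_funD|]; apply/measurable_EFinP.
Qed.

Lemma expectation_payoff_kernel :
  (\int[P]_w (payoff_kernel (iota w))%:E = \int[P]_w (randomised_payoff w)%:E)%E.
Proof.
have e1 := expectation_signed_kernel T_gt0 dxi dzeta mxi mzeta mlt mcf miota mZ1 mZ2 indep iM fM.
have e2 := expectation_signed_kernel T_gt0 dzeta dxi mzeta mxi mlt mcg miota mZ2 mZ1 indep' iM gM.
have e3 := expectation_signed_kernel T_gt0 dxi dzeta mxi mzeta meq mch miota mZ1 mZ2 indep iM hM.
apply: (etrans (integral_add3_eq i1 i2 i3 r1 r2 r3 e1 e2 e3)).
by apply: eq_integral => w _; rewrite randomised_payoffE.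
Qed.

End expectation.

End payoff_kernel.

(** By right continuity the supremum over [0, T] is already a supremum over the rational times and
    [T], hence measurable. It is integrable by [Lb], thus almost surely finite and replaceable by a
    real variable. *)
Lemma Lb_dominated (R : realType) d (Omega : measurableType d) (P : probability Omega R) (T : R)
    (X : R -> Omega -> R) : 0 < T -> Lb P T X ->
  (forall t, 0 <= t <= T -> measurable_fun setT (X t)) ->
  exists2 M : Omega -> R, P.-integrable setT (EFin \o M) &
    \forall w \ae P, forall t, 0 <= t <= T -> `|X t w| <= M w.
Proof.
move=> T_gt0 [cX _ iX] mX.
(* [r] enumerates the rational times of [0, T]. Every other code is sent to [T], a time that right
   continuity cannot reach. *)
pose r n : R := if @unpickle rat n is Some q then
  (if 0 <= (ratr q : R) <= T then ratr q else T) else T.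
have rT n : 0 <= r n <= T.
  have TT : 0 <= T <= T by rewrite lexx ltW.
  by rewrite /r; case: unpickle => // q; case: ifPn.
pose N w := esups (fun n => `|X (r n) w|%:E) 0%N.
have leN n w : (`|X (r n) w|%:E <= N w)%E by apply: ereal_sup_ubound; exists n.
have N0 w : (0 <= N w)%E by apply: le_trans (leN 0%N w); rewrite lee_fin.
have mN : measurable_fun setT N.
  apply: measurable_fun_esups => n; apply/measurable_EFinP.
  by apply: measurableT_comp => //; exact: mX.
have NX w t : 0 <= t <= T -> (`|X t w|%:E <= N w)%E.
  move=> /andP[t0 tT]; have [tT'|Tt] := ltP t T; last first.
    have -> : t = T by apply/eqP; rewrite eq_le tT.
    (* The rational -1 lies outside [0, T], so its code is sent to [T]. *)
    have := leN (pickle (-1 : rat)) w.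
    rewrite /r pickleK rmorphN1 (_ : (0 <= -1 <= T) = false)//.
    by apply/negbTE; rewrite negb_and -ltNge ltrN10.
  rewrite leNgt; apply/negP => NXt.
  have [m mE] : exists m, N w = m%:E.
    by move: NXt (N0 w); case: (N w) => [m|//|//] _ _; exists m.
  move: NXt; rewrite mE lte_fin => mX'.
  have rc : `|X s w| @[s --> t^'+] --> `|X t w|.
    by apply: cvg_norm; have [+ _] := cX w; apply; rewrite t0 tT'.
  have [e /= e0 He] : \forall s \near t^'+, m < `|X s w| by exact: (cvgr_gt _ rc).
  have tm : t < Num.min (t + e) T by rewrite lt_min tT' ltrDl e0.
  have [q] := rat_in_itvoo tm; rewrite in_itv /= lt_min => /and3P[tq qe qT].
  have := He (ratr q); rewrite /= => /(_ _ tq).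
  have -> : `|t - ratr q| < e by rewrite ltr0_norm ?subr_lt0// opprB ltrBlDl.
  move=> /(_ erefl); have := leN (pickle q) w.
  rewrite /r pickleK (le_trans t0 (ltW tq)) (ltW qT) mE lee_fin => h1 h2.
  by move: (lt_le_trans h2 h1); rewrite ltxx.
have NE w : ereal_sup [set `|X t w|%:E | t in `[0, T]] = N w.
  apply/eqP; rewrite eq_le; apply/andP; split.
    by apply: ge_ereal_sup => _ [t /= + <-]; rewrite in_itv /= => tT; exact: NX.
  apply: ge_ereal_sup => _ [n _ <-]; apply: ereal_sup_ubound.
  by exists (r n) => //=; rewrite in_itv /= rT.
have iN : P.-integrable setT N.
  apply/integrableP; split => //.
  under eq_integral do rewrite gee0_abs// -NE.
  exact: iX.
exists (fine \o N).
  apply: le_integrable iN => //.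
    by apply/measurable_EFinP; apply: (measurableT_comp (@fine_measurable R setT measurableT)).
  move=> w _ /=; case: (N w) (N0 w) => //= _; by rewrite normr0 leey.
apply: filterS (integrable_ae measurableT iN) => w /(_ I) h t tT.
by rewrite -lee_fin /= fineK// NX.
Qed.

(** * Truncation and concatenation of controls *)

Section path_surgery.
Context {R : realType} (T : R).
Hypothesis T_gt0 : 0 < T.
Implicit Types x y : R -> R.

(** Left limits come for free from monotonicity. *)
Lemma distribution_path_of y : nondecreasing (extend T y) ->
  (forall t, 0 <= t < T -> y s @[s --> t^'+] --> y t) -> y T = 1 -> distribution_path T y.
Proof.
move=> nd rc yT; split => //; split => // t /andP[t0 tT].
apply: (@cvgP _ _ (left_lim T y t)); apply: cvg_trans (left_lim_cvg (t := t) nd).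
apply: near_eq_cvg; near=> s.
have s0 : 0 < s by near: s; exact: nbhs_left_gt.
have st : s < t by near: s; exact: nbhs_left_lt.
by rewrite extend_itv// ltW//= (le_trans (ltW st)).
Unshelve. all: end_near. Qed.

Lemma distribution_path_cst1 : distribution_path T (fun=> 1).
Proof.
apply: distribution_path_of => // [s t st|t _]; last exact: cvg_cst.
rewrite /extend; case: ifPn => s0; case: ifPn => t0 //.
by move: s0; rewrite (le_lt_trans st t0).
Qed.

(** The bound [t <= T] lets concatenation with the path's own truncation return [x] at every real
    [t], so that [conc_trunc] yields an equality of functions. *)
Definition conc_path x y lam : R -> R := fun t =>
  if lam <= t <= T then left_lim T x lam + (1 - left_lim T x lam) * y t else x t.

(** [truncated] along a single path. If no mass is left, the convention for 0/0 gives the unit step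
    at [lam], still a distribution path. *)
Definition trunc_path x lam : R -> R := fun t =>
  if lam <= t then ratio1 (x t - left_lim T x lam) (1 - left_lim T x lam) else 0.

Variables (x : R -> R) (lam : R).
Hypotheses (dx : distribution_path T x) (lam_itv : 0 <= lam <= T).
Let a := left_lim T x lam.
Let nd := dpath_nondecreasing dx.

Let lam0 : 0 <= lam. Proof. by case/andP: lam_itv. Qed.
Let lamT : lam <= T. Proof. by case/andP: lam_itv. Qed.

Let a0 : 0 <= a. Proof. by case/andP: (left_lim_bound T_gt0 dx lam). Qed.
Let a1 : 0 <= 1 - a. Proof. by rewrite subr_ge0; case/andP: (left_lim_bound T_gt0 dx lam). Qed.

Lemma le_minT t : (lam <= Num.min t T) = (lam <= t).
Proof. by rewrite le_min lamT andbT. Qed.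

Lemma extend_conc y t : extend T (conc_path x y lam) t =
  if lam <= t then a + (1 - a) * extend T y t else extend T x t.
Proof.
rewrite /extend; case: ifPn => t0; last by rewrite /conc_path le_minT ge_min lexx orbT andbT.
by rewrite leNgt (lt_le_trans t0).
Qed.

Lemma extend_trunc t : extend T (trunc_path x lam) t =
  if lam <= t then ratio1 (extend T x t - a) (1 - a) else 0.
Proof.
rewrite /extend; case: ifPn => t0; last by rewrite /trunc_path le_minT.
by rewrite leNgt (lt_le_trans t0).
Qed.

Lemma left_lim_le_extend t : lam <= t -> a <= extend T x t.
Proof. by move=> lt; apply: left_lim_le => // u ul; apply/nd/ltW/(lt_le_trans ul). Qed.

Lemma distribution_path_conc y : distribution_path T y ->
  distribution_path T (conc_path x y lam).
Proof.
move=> dy; have ndy := dpath_nondecreasing dy; apply: distribution_path_of.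
- move=> s t st; rewrite !extend_conc; case: ifPn => ls; case: ifPn => lt.
  + by rewrite lerD2l ler_wpM2l//; exact: ndy.
  + by move: lt; rewrite (le_trans ls st).
  + rewrite -ltNge in ls; apply: (le_trans (le_left_lim nd ls)).
    by rewrite lerDl mulr_ge0//; case/andP: (extend_bound T_gt0 dy t).
  + exact: nd.
- move=> t tT.
  have [rcx _] := dpath_cadlag dx; have [rcy _] := dpath_cadlag dy.
  have /andP[_ tT'] := tT.
  rewrite {2}/conc_path (ltW tT') andbT; case: ifPn => lt.
    apply: (@cvg_trans _ (a + (1 - a) * y s @[s --> t^'+])); last first.
      by apply: cvgD; [exact: cvg_cst|apply: cvgMr; exact: rcy].
    apply: near_eq_cvg; near=> s; rewrite /conc_path.
    have ts : t < s by near: s; exact: nbhs_right_gt.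
    have sT : s < T by near: s; exact: nbhs_right_lt.
    by rewrite (ltW sT) (le_trans lt)// ltW.
  rewrite -ltNge in lt; apply: cvg_trans (rcx t tT).
  apply: near_eq_cvg; near=> s; rewrite /conc_path.
  have sl : s < lam by near: s; exact: nbhs_right_lt.
  by rewrite leNgt sl.
- by rewrite /conc_path lamT lexx (dpath_end dy) mulr1 addrC subrK.
Unshelve. all: end_near. Qed.

Lemma distribution_path_trunc : distribution_path T (trunc_path x lam).
Proof.
have [rcx _] := dpath_cadlag dx.
apply: distribution_path_of.
- move=> s t st; rewrite !extend_trunc; case: ifPn => ls; case: ifPn => lt //.
  + rewrite /ratio1; case: ifPn => // _.
    by rewrite ler_wpM2r ?invr_ge0// lerD2r; exact: nd.
  + by move: lt; rewrite (le_trans ls st).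
  + rewrite /ratio1; case: ifPn => // _.
    by rewrite divr_ge0// subr_ge0 left_lim_le_extend.
- move=> t tT; rewrite {2}/trunc_path; case: ifPn => lt; last first.
    rewrite -ltNge in lt; apply: cvg_near_cst; near=> s; rewrite /trunc_path.
    have sl : s < lam by near: s; exact: nbhs_right_lt.
    by rewrite leNgt sl.
  apply: (@cvg_trans _ (ratio1 (x s - a) (1 - a) @[s --> t^'+])).
    apply: near_eq_cvg; near=> s; rewrite /trunc_path.
    have ts : t < s by near: s; exact: nbhs_right_gt.
    by rewrite (le_trans lt)// ltW.
  rewrite /ratio1; case: (1 - left_lim T x lam == 0); first exact: cvg_cst.
  by apply: cvgMl; apply: cvgB; [exact: rcx|exact: cvg_cst].
- rewrite /trunc_path lamT /ratio1 (dpath_end dx); case: ifPn => // h.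
  by rewrite divff.
Unshelve. all: end_near. Qed.

Lemma left_lim_trunc : left_lim T (trunc_path x lam) lam = 0.
Proof.
have ndt := dpath_nondecreasing distribution_path_trunc.
apply/eqP; rewrite eq_le; apply/andP; split.
  by apply: left_lim_le => // u ul; rewrite extend_trunc ifN// -ltNge.
by case/andP: (left_lim_bound T_gt0 distribution_path_trunc lam).
Qed.

(** In the degenerate case of left limit 1, monotonicity pins the path to 1 from [lam] on, so the
    identity survives. *)
Lemma trunc_pathK t : 0 <= t <= T -> lam <= t -> x t = a + (1 - a) * trunc_path x lam t.
Proof.
move=> tT lt; rewrite /trunc_path lt /ratio1 -/a; case: ifPn => [/eqP e|e].
  rewrite mulr1 addrC subrK; apply/eqP; rewrite eq_le.
  rewrite -(@extend_itv _ T x t)//; have /andP[_ ->] /= := extend_bound T_gt0 dx t.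
  have -> : 1 = a by apply/eqP; rewrite -subr_eq0 e.
  exact: left_lim_le_extend.
by rewrite mulrC mulfVK// addrC subrK.
Qed.

Lemma conc_trunc t : conc_path x (trunc_path x lam) lam t = x t.
Proof.
rewrite /conc_path; case: ifPn => // /andP[lt tT].
by rewrite -trunc_pathK// tT (le_trans lam0).
Qed.

End path_surgery.

Lemma measurable_fun_gt_set d (S : measurableType d) (R : realType) (f : S -> R) :
  (forall c, measurable [set w | c < f w]) -> measurable_fun setT f.
Proof.
move=> H mD; apply: (measurability _ (RGenOInfty.measurableE R)) => //.
move=> _ [_ [c ->] <-]; rewrite setTI (_ : _ @^-1` _ = [set w | c < f w])//.
by apply/seteqP; split => w; rewrite /= in_itv /= andbT.
Qed.

(** * Adaptedness of regularised, truncated and concatenated controls *)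

Section adapted_controls.
Context {R : realType} {d : measure_display} {Omega : measurableType d}.
Variables (P : probability Omega R) (T : R) (G : R -> set (set Omega)).
Hypotheses (T_gt0 : 0 < T) (fG : usual_filtration P T G).
Implicit Types xi : R -> Omega -> R.

(** The two variables differ on a null event, all of whose subsets belong to [G t]. *)
Lemma ae_eq_adapted (X Y : Omega -> R) t : 0 <= t <= T -> measurable_wrt (G t) X ->
  (\forall w \ae P, X w = Y w) -> measurable_wrt (G t) Y.
Proof.
move=> tT mX XY.
have sG := filtration_sigma_algebra fG tT.
have nG := filtration_null_sets fG tT.
pose N := [set w | X w <> Y w].
have GN B : B `<=` N -> G t B.
  by move=> BN; apply: nG; exact: negligibleS BN XY.
move=> B mB.
have mE (A : set Omega) : G t A <-> measurable (A : set (g_sigma_algebraType (G t))).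
  exact: (sub_measurableE sG).
have -> : Y @^-1` B = ((X @^-1` B) `\` (N `&` X @^-1` B)) `|` (N `&` Y @^-1` B).
  apply/seteqP; split => w /=.
    have [e|e] := pselect (X w = Y w); last by right.
    by rewrite -e => Bx; left; split => // -[].
  move=> [[Bx nN]|[]//].
  by have [<-//|e] := pselect (X w = Y w); exfalso; apply: nN.
apply/mE; apply: measurableU.
  apply: measurableD; apply/mE; first exact: mX.
  by apply: GN => w [].
by apply/mE; apply: GN => w [].
Qed.

(** Although it consults the terminal value, it stays adapted, since it alters the control on a null
    event only. The constant path 1 is the distribution function of the unit mass at 0. *)
Definition regular_control xi t w : R := if xi T w == 1 then xi t w else 1.

Lemma regular_control_ae theta xi : controls P T G theta xi ->
  \forall w \ae P, forall t, regular_control xi t w = xi t w.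
Proof.
by move=> [_ _ _ _]; apply: filterS => w xT t; rewrite /regular_control xT eqxx.
Qed.

Lemma regular_control_path theta xi : controls P T G theta xi ->
  forall w, distribution_path T ((regular_control xi)^~ w).
Proof.
move=> [_ cx nx _ _] w; rewrite /regular_control.
by case: eqVneq => [e|_]; [|exact: distribution_path_cst1].
Qed.

Lemma regular_control_adapted theta xi : controls P T G theta xi ->
  adapted T G (regular_control xi).
Proof.
move=> cxi t tT; have [ax _ _ _ _] := cxi.
apply: (ae_eq_adapted tT (ax t tT)).
by apply: filterS (regular_control_ae cxi) => w ->.
Qed.

Lemma controls_of theta xi : adapted T G xi -> (forall w, distribution_path T (xi^~ w)) ->
  (\forall w \ae P, left_lim T (xi^~ w) (theta w) = 0) -> controls P T G theta xi.
Proof.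
move=> ax dx l0; split => //.
- by move=> w; exact: dpath_cadlag (dx w).
- by move=> w; exact: dpath_nondecreasing (dx w).
- by apply: aeW => w; exact: dpath_end (dx w).
Qed.

(** The extension by 0 to negative times makes the initial condition automatic. *)
Lemma controls0_of xi : adapted T G xi -> (forall w, distribution_path T (xi^~ w)) ->
  controls P T G (cst 0) xi.
Proof.
move=> ax dx; apply: controls_of => //; apply: aeW => w /=.
apply/eqP; rewrite eq_le; apply/andP; split; last by case/andP: (left_lim_bound T_gt0 (dx w) 0).
apply: left_lim_le; first exact: dpath_nondecreasing (dx w).
by move=> u u0; rewrite extend_lt0.
Qed.

Variable lambda : Omega -> R.
Hypotheses (lambda_itv : forall w, 0 <= lambda w <= T)
  (lambda_stopping : forall t, 0 <= t <= T -> G t [set w | lambda w <= t]).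

Let sG t : 0 <= t <= T -> sigma_algebra setT (G t).
Proof. by move=> tT; exact: (filtration_sigma_algebra fG tT). Qed.

Let mG t A : 0 <= t <= T -> G t A -> measurable (A : set (g_sigma_algebraType (G t))).
Proof. by move=> tT GA; exact: (sub_measurableE (sG tT) A).1. Qed.

Let adapted_fun xi t : adapted T G xi -> 0 <= t <= T ->
  measurable_fun setT (xi t : g_sigma_algebraType (G t) -> R).
Proof. by move=> ax tT; exact: (measurable_wrtW (sG tT) (ax t tT)). Qed.

Let mlam t : 0 <= t <= T ->
  measurable_fun setT ((fun w => lambda w <= t) : g_sigma_algebraType (G t) -> bool).
Proof.
move=> tT; apply: (measurable_fun_bool true).
by rewrite setTI; apply: mG => //; exact: lambda_stopping.
Qed.

(** The left limit exceeds [c] exactly when the path does so at some rational time before [lambda].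
    Once [lambda w <= t], that rational precedes [t], and all conditions on it are known at time
    [t]. *)
Lemma left_lim_adapted xi t : adapted T G xi -> (forall w, distribution_path T (xi^~ w)) ->
  0 <= t <= T -> measurable_fun setT ((fun w => if lambda w <= t then
    left_lim T (xi^~ w) (lambda w) else 0) : g_sigma_algebraType (G t) -> R).
Proof.
move=> ax dx tT; apply: measurable_fun_gt_set => c.
have [c0|c0] := ltP c 0.
  rewrite (_ : [set _ | _] = setT); first exact: measurableT.
  apply/seteqP; split => // w _ /=; case: ifPn => // _.
  by apply: lt_le_trans c0 _; case/andP: (left_lim_bound T_gt0 (dx w) (lambda w)).
rewrite (_ : [set _ | _] = \bigcup_(r : rat)
  ([set w | lambda w <= t] `&` [set w | (ratr r : R) < lambda w /\ c < extend T (xi^~ w) (ratr r)])).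
  apply: bigcupT_measurable_rat => r.
  have [rt|rt] := ltP t (ratr r).
    rewrite (_ : _ `&` _ = set0); first exact: measurable0.
    by apply/seteqP; split => // w [/= lt [rl _]]; move: (lt_trans (le_lt_trans lt rt) rl); rewrite ltxx.
  have [r0|r0] := ltP (ratr r : R) 0.
    rewrite (_ : _ `&` _ = set0); first exact: measurable0.
    by apply/seteqP; split => // w [/= _ [_]]; rewrite extend_lt0// ltNge c0.
  have rT : 0 <= (ratr r : R) <= T by rewrite r0 (le_trans rt)//; case/andP: tT.
  have -> : [set w | lambda w <= t] `&`
      [set w | (ratr r : R) < lambda w /\ c < extend T (xi^~ w) (ratr r)] =
      [set w | lambda w <= t] `&` (~` [set w | lambda w <= ratr r] `&` [set w | c < xi (ratr r) w]).
    congr (_ `&` _); apply/seteqP; split => w /=; rewrite extend_itv//.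
      by move=> [h1 h2]; split => //; apply/negP; rewrite -ltNge.
    by move=> [/negP]; rewrite -ltNge.
  have tT' : t <= T by case/andP: tT.
  apply: measurableI; first by apply: mG => //; exact: lambda_stopping.
  apply: measurableI.
    apply: measurableC; apply: mG => //.
    exact: (filtration_mono fG r0 rt tT' (lambda_stopping rT)).
  apply: mG => //; apply: (filtration_mono fG r0 rt tT').
  have := ax _ rT (`]c, +oo[%classic : set R) (measurable_itv _).
  by congr (G _ _); apply/seteqP; split => w; rewrite /= in_itv /= andbT.
apply/seteqP; split => w /=.
  case: ifPn => lt; last by rewrite ltNge c0.
  move=> /(left_lim_gt (dpath_nondecreasing (dx w)))[s sl cs].
  have [r] := rat_in_itvoo sl; rewrite in_itv /= => /andP[sr rl].
  exists r => //; split => //; split => //.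
  by apply: lt_le_trans cs _; apply: (dpath_nondecreasing (dx w)); exact: ltW.
move=> [r _ [/= -> [rl cr]]]; apply: lt_le_trans cr _.
by apply: le_left_lim => //; exact: dpath_nondecreasing (dx w).
Qed.

Definition trunc_control xi t w : R := trunc_path T (xi^~ w) (lambda w) t.

(* On A, keep xi before lambda and spend the remaining mass 1 - xi_{lambda-} along x. *)
Definition conc_control xi x (A : set Omega) t w : R :=
  if w \in A then conc_path T (xi^~ w) (x^~ w) (lambda w) t else xi t w.

Lemma trunc_control_adapted xi : adapted T G xi -> (forall w, distribution_path T (xi^~ w)) ->
  adapted T G (trunc_control xi).
Proof.
move=> ax dx t tT; apply: (measurable_wrtP (sG tT) _).2.
have ml := left_lim_adapted ax dx tT.
have mx := adapted_fun ax tT.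
pose a w := if lambda w <= t then left_lim T (xi^~ w) (lambda w) else 0.
apply: (eq_measurable_fun ((fun w => if lambda w <= t then ratio1 (xi t w - a w) (1 - a w) else 0)
   : g_sigma_algebraType (G t) -> R)).
  by move=> w _; rewrite /trunc_control /trunc_path /a /=; case: (lambda w <= t).
apply: measurable_fun_ifT; [exact: mlam| |exact: measurable_cst].
apply: measurable_fun_ratio1; first exact: measurable_funB.
by apply: measurable_funB => //; exact: measurable_cst.
Qed.

(** [A] need not be known at time [t], but [conc_control] consults it only once [lambda] has passed;
    the last hypothesis is the condition that defines the stopped sigma-algebra. *)
Lemma conc_control_adapted xi x A : adapted T G xi -> (forall w, distribution_path T (xi^~ w)) ->
  adapted T G x -> (forall t, 0 <= t <= T -> G t (A `&` [set w | lambda w <= t])) ->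
  adapted T G (conc_control xi x A).
Proof.
move=> axi dxi ax GA t tT; apply: (measurable_wrtP (sG tT) _).2.
have ml := left_lim_adapted axi dxi tT.
have mxi := adapted_fun axi tT; have mx := adapted_fun ax tT.
pose a w := if lambda w <= t then left_lim T (xi^~ w) (lambda w) else 0.
apply: (eq_measurable_fun ((fun w => if (w \in A) && (lambda w <= t)
   then a w + (1 - a w) * x t w else xi t w) : g_sigma_algebraType (G t) -> R)).
  have /andP[_ tT'] := tT.
  move=> w _; rewrite /conc_control /conc_path /a tT' andbT.
  by case: (w \in A) => //=; case: (lambda w <= t).
apply: measurable_fun_ifT => //.
  apply: (measurable_fun_bool true); rewrite setTI.
  apply: mG => //; have := GA t tT; congr (G _ _).
  by apply/seteqP; split => w /=; [move=> [wA ->]; rewrite andbT; apply/mem_set|move=> /andP[/set_mem]].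
apply: measurable_funD => //; apply: measurable_funM => //.
by apply: measurable_funB => //; exact: measurable_cst.
Qed.

End adapted_controls.

Lemma mulr_telescope (V : comPzRingType) (b p q r : V) : b + p * r = b + p * q + p * (r - q).
Proof. by ring. Qed.

Section payoff_surgery.
Context {R : realType} (T : R).
Hypothesis T_gt0 : 0 < T.
Variables f g h : R -> R.
Hypotheses (bf : bounded_path T f) (bg : bounded_path T g) (bh : bounded_path T h).
Variables (x y : R -> R) (lam : R).
Hypotheses (dx : distribution_path T x) (dy : distribution_path T y) (lam_itv : 0 <= lam <= T).

Lemma path_payoff_trunc : path_payoff T f g h lam x y =
  (1 - left_lim T x lam) * (1 - left_lim T y lam) *
  path_payoff T f g h lam (trunc_path T x lam) (trunc_path T y lam).
Proof.
have /andP[l0 _] := lam_itv.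
apply: path_payoff_after => //.
- exact: distribution_path_trunc.
- exact: distribution_path_trunc.
- exact: left_lim_trunc.
- exact: left_lim_trunc.
- by move=> t /andP[lt tT]; apply: trunc_pathK => //; rewrite tT (le_trans l0).
- by move=> t /andP[lt tT]; apply: trunc_pathK => //; rewrite tT (le_trans l0).
Qed.

Lemma left_lim_conc z z' : distribution_path T z -> distribution_path T z' ->
  left_lim T (conc_path T z z' lam) lam = left_lim T z lam.
Proof.
move=> dz dz'; apply: left_lim_local => //; first exact: distribution_path_conc.
by move=> t tl; rewrite extend_conc// ifN// -ltNge.
Qed.

(** The parts before [lam] cancel. From [lam] on, old and new payoffs carry the same product of
    remaining masses, because concatenation preserves the left limits. *)
Lemma path_payoff_conc x' y' : distribution_path T x' -> distribution_path T y' ->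
  left_lim T x' lam = 0 -> left_lim T y' lam = 0 ->
  path_payoff T f g h 0 (conc_path T x x' lam) (conc_path T y y' lam) =
  path_payoff T f g h 0 x y + (1 - left_lim T x lam) * (1 - left_lim T y lam) *
    (path_payoff T f g h lam x' y' -
     path_payoff T f g h lam (trunc_path T x lam) (trunc_path T y lam)).
Proof.
move=> dx' dy' x'0 y'0.
have cx := distribution_path_conc T_gt0 dx lam_itv dx'.
have cy := distribution_path_conc T_gt0 dy lam_itv dy'.
have before z z' t : 0 <= t < lam -> conc_path T z z' lam t = z t.
  by move=> /andP[_ tl]; rewrite /conc_path leNgt tl.
rewrite (path_payoff_split T_gt0 bf bg bh cx cy lam_itv).
rewrite (path_payoff_split T_gt0 bf bg bh dx dy lam_itv).
rewrite (path_payoff_before_eq T_gt0 bf bg bh cx cy dx dy lam_itv (before x x') (before y y')).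
rewrite path_payoff_trunc.
have -> : path_payoff T f g h lam (conc_path T x x' lam) (conc_path T y y' lam) =
    (1 - left_lim T x lam) * (1 - left_lim T y lam) * path_payoff T f g h lam x' y'.
  rewrite -(left_lim_conc dx dx') -(left_lim_conc dy dy').
  apply: path_payoff_after => // t ltT; rewrite {1}/conc_path ltT left_lim_conc//.
exact: mulr_telescope.
Qed.

End payoff_surgery.

(** * Stopped information, perturbed integrals and saddle points of families *)

Lemma sigma_algebraI (T : Type) (G G' : set (set T)) :
  sigma_algebra setT G -> sigma_algebra setT G' -> sigma_algebra setT (G `&` G').
Proof.
move=> [G0 GC GU] [G'0 G'C G'U]; split => //.
- by move=> A [GA G'A]; split; [exact: GC|exact: G'C].
- by move=> A GA; split; [apply: GU|apply: G'U] => i; case: (GA i).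
Qed.

Lemma sigma_algebra_stopped (R : realType) (d : measure_display) (Omega : measurableType d)
    (T : R) (F : R -> set (set Omega)) (lambda : Omega -> R) : 0 <= T ->
  (forall t, 0 <= t <= T -> sigma_algebra setT (F t)) ->
  (forall t, 0 <= t <= T -> F t [set w | lambda w <= t]) ->
  sigma_algebra setT (stopped_sigma_algebra T F lambda).
Proof.
move=> T0 sF Fl.
have TT : 0 <= T <= T by rewrite T0 lexx.
have FI t A B : 0 <= t <= T -> F t A -> F t B -> F t (A `&` B).
  by move=> tT; rewrite !(sub_measurableE (sF _ tT)); exact: measurableI.
split.
- by split=> [|t tT]; rewrite ?set0I; [case: (sF _ TT)|case: (sF _ tT)].
- move=> A [FA At]; split; first by case: (sF T TT) => _ + _; exact.
  (* The complement is taken relative to the event that [lambda] has passed, since only the trace of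
     [A] on it is known at time [t]. *)
  move=> t tT; rewrite (_ : _ `&` _ = (setT `\` (A `&` [set w | lambda w <= t])) `&`
      [set w | lambda w <= t]).
    apply: FI => //; last exact: Fl.
    by case: (sF t tT) => _ + _; apply; exact: At.
  apply/seteqP; split => w /= [[_ nA] l]; split => //; split => //.
    by move=> [].
  by move=> Aw; apply: nA.
- move=> A FA; split; first by case: (sF T TT) => _ _; apply => i; case: (FA i).
  move=> t tT; rewrite setI_bigcupl; case: (sF t tT) => _ _; apply => i.
  by case: (FA i) => _; exact.
Qed.

(** Off [A] the two integrals agree and cancel; on [A] the finite integral of [U] cancels, which
    leaves the comparison of [Y] and [Y']. *)
Lemma le_integral_perturbation d (Omega : measurableType d) (R : realType)
    (P : {measure set Omega -> \bar R}) (A : set Omega) (U W Y Y' : Omega -> R) :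
  measurable A -> P.-integrable setT (EFin \o U) -> P.-integrable setT (EFin \o W) ->
  P.-integrable setT (EFin \o Y) -> P.-integrable setT (EFin \o Y') ->
  (\forall w \ae P, W w = if w \in A then U w + (Y' w - Y w) else U w) ->
  (\int[P]_w (U w)%:E <= \int[P]_w (W w)%:E)%E ->
  (\int[P]_(w in A) (Y w)%:E <= \int[P]_(w in A) (Y' w)%:E)%E.
Proof.
move=> mA iU iW iY iY' WE.
have iA (X : Omega -> R) : P.-integrable setT (EFin \o X) -> P.-integrable A (EFin \o X).
  by move=> iX; exact: integrableS iX.
have iC (X : Omega -> R) : P.-integrable setT (EFin \o X) -> P.-integrable (~` A) (EFin \o X).
  by move=> iX; apply: integrableS iX => //; exact: measurableC.
have mC : measurable (~` A) by exact: measurableC.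
have split_int (X : Omega -> R) : P.-integrable setT (EFin \o X) ->
    (\int[P]_w (X w)%:E = \int[P]_(w in A) (X w)%:E + \int[P]_(w in ~` A) (X w)%:E)%E.
  move=> iX; rewrite -(setUv A) integral_setU//; last 2 first.
    - by rewrite setUv; exact: measurable_int iX.
    - exact/disj_setPCl.
have EC : (\int[P]_(w in ~` A) (W w)%:E = \int[P]_(w in ~` A) (U w)%:E)%E.
  apply: ae_eq_integral => //.
  - exact: measurable_int (iC _ iW).
  - exact: measurable_int (iC _ iU).
  - by apply: filterS WE => w -> nA; rewrite memNset.
have EA : (\int[P]_(w in A) (W w)%:E = \int[P]_(w in A) (U w)%:E +
    (\int[P]_(w in A) (Y' w)%:E - \int[P]_(w in A) (Y w)%:E))%E.
  rewrite -(integralB mA (iA _ iY') (iA _ iY)).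
  rewrite -(integralD mA (iA _ iU) (integrableB mA (iA _ iY') (iA _ iY))).
  apply: ae_eq_integral => //.
  - exact: measurable_int (iA _ iW).
  - exact: measurable_int (integrableD mA (iA _ iU) (integrableB mA (iA _ iY') (iA _ iY))).
  - by apply: filterS WE => w -> wA; rewrite mem_set.
rewrite (split_int _ iU) (split_int _ iW) EC EA.
have := integrable_fin_num mC (iC _ iU); have := integrable_fin_num mA (iA _ iU).
have := integrable_fin_num mA (iA _ iY); have := integrable_fin_num mA (iA _ iY').
rewrite /=.
move: (\int[P]_(w in A) (Y' w)%:E)%E (\int[P]_(w in A) (Y w)%:E)%E
  (\int[P]_(w in A) (U w)%:E)%E (\int[P]_(w in ~` A) (U w)%:E)%E.
move=> [a| |] [b| |] [c| |] [e| |]//= _ _ _ _.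
rewrite -!EFinB -!EFinD !lee_fin; lra.
Qed.

Section saddle_of_family.
Context {R : realType} {d : measure_display} {Omega : measurableType d}.
Variables (P : probability Omega R) (A B : Type) (C1 : set A) (C2 : set B).
Variables (J : A -> B -> Omega -> \bar R) (a0 : A) (b0 : B) (D : set Omega).
Hypotheses (mJ : forall a b, measurable_fun setT (J a b)) (mD : measurable D)
  (C1a0 : C1 a0) (C2b0 : C2 b0).
Hypotheses
  (Jmin : forall a, C1 a -> \forall w \ae P, D w -> (J a0 b0 w <= J a b0 w)%E)
  (Jmax : forall b, C2 b -> \forall w \ae P, D w -> (J a0 b w <= J a0 b0 w)%E).

(** Essential bounds compare variables on the whole space, while the saddle inequalities hold on [D]
    only; infinite values off [D] make them global. *)
Let below w := if w \in D then J a0 b0 w else -oo%E.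
Let above w := if w \in D then J a0 b0 w else +oo%E.

Let m_in : measurable_fun setT (fun w => w \in D).
Proof.
apply: (measurable_fun_bool true); rewrite setTI.
by rewrite (_ : _ @^-1` _ = D)//; apply/seteqP; split => w /=; [move/set_mem|move/mem_set].
Qed.

Let mbelow : measurable_fun setT below.
Proof. by apply: measurable_fun_ifT. Qed.

Let mabove : measurable_fun setT above.
Proof. by apply: measurable_fun_ifT. Qed.

(** Each inner supremum dominates the payoff against [b0], hence the saddle value, and the choice
    [a0] does not exceed it. The other order is symmetric. *)
Lemma saddle_essinf_esssup : \forall w \ae P, D w ->
  J a0 b0 w = essinf_family P [set esssup_family P [set J a b | b in C2] | a in C1] w /\
  essinf_family P [set esssup_family P [set J a b | b in C2] | a in C1] w =
  esssup_family P [set essinf_family P [set J a b | a in C1] | b in C2] w.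
Proof.
set up := fun a => esssup_family P [set J a b | b in C2].
set lo := fun b => essinf_family P [set J a b | a in C1].
have upP a : is_esssup P [set J a b | b in C2] (up a).
  by apply: esssup_familyP => _ [b _ <-]; exact: mJ.
have loP b : is_essinf P [set J a b | a in C1] (lo b).
  by apply: essinf_familyP => _ [a _ <-]; exact: mJ.
have [_ U1 U2] : is_essinf P [set up a | a in C1] (essinf_family P [set up a | a in C1]).
  by apply: essinf_familyP => _ [a _ <-]; case: (upP a).
have [_ L1 L2] : is_esssup P [set lo b | b in C2] (esssup_family P [set lo b | b in C2]).
  by apply: esssup_familyP => _ [b _ <-]; case: (loP b).
have h1 : \forall w \ae P, (below w <= essinf_family P [set up a | a in C1] w)%E.
  apply: U2 => // _ [a Ca <-]; have [_ ua _] := upP a.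
  apply: filterS2 (Jmin Ca) (ua _ (ex_intro2 _ _ b0 C2b0 erefl)) => w h /(le_trans _); apply.
  by rewrite /below; case: (pselect (D w)) => Dw; [rewrite mem_set//; exact: h|rewrite memNset// leNye].
have h2 : \forall w \ae P, (up a0 w <= above w)%E.
  have [_ _ ua] := upP a0; apply: ua => // _ [b Cb <-]; apply: filterS (Jmax Cb) => w h.
  by rewrite /above; case: (pselect (D w)) => Dw; [rewrite mem_set//; exact: h|rewrite memNset// leey].
have h3 : \forall w \ae P, (below w <= lo b0 w)%E.
  have [_ _ lb] := loP b0; apply: lb => // _ [a Ca <-]; apply: filterS (Jmin Ca) => w h.
  by rewrite /below; case: (pselect (D w)) => Dw; [rewrite mem_set//; exact: h|rewrite memNset// leNye].
have h4 : \forall w \ae P, (esssup_family P [set lo b | b in C2] w <= above w)%E.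
  apply: L2 => // _ [b Cb <-]; have [_ lb _] := loP b.
  apply: filterS2 (Jmax Cb) (lb _ (ex_intro2 _ _ a0 C1a0 erefl)) => w h /le_trans; apply.
  by rewrite /above; case: (pselect (D w)) => Dw; [rewrite mem_set//; exact: h|rewrite memNset// leey].
have h5 := U1 _ (ex_intro2 _ _ a0 C1a0 erefl).
have h6 := L1 _ (ex_intro2 _ _ b0 C2b0 erefl).
apply: filterS3 (ae_and h1 h2) (ae_and h3 h4) (ae_and h5 h6).
move=> w [{}h1 {}h2] [{}h3 {}h4] [{}h5 {}h6] Dw.
move: h1 h2 h3 h4; rewrite /below /above mem_set// => h1 h2 h3 h4.
have UV : J a0 b0 w = essinf_family P [set up a | a in C1] w.
  by apply/eqP; rewrite eq_le h1 (le_trans h5).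
split => //; rewrite -UV; apply/eqP; rewrite eq_le h4 andbT.
exact: le_trans h3 h6.
Qed.

End saddle_of_family.

Lemma perturbation_sym (V : zmodType) (u p q : V) : u = u + (p - q) + (q - p).
Proof. by rewrite -addrA -(opprB p q) subrr addr0. Qed.

Lemma le_subst (R : realType) (a b c e : \bar R) : a = b -> c = e -> (a <= c)%E -> (b <= e)%E.
Proof. by move=> -> ->. Qed.

Lemma le_pmul2l_eq (R : realType) (e a b a' b' : \bar R) : (0 < e)%E -> e \is a fin_num ->
  a' = (e * a)%E -> b' = (e * b)%E -> (a' <= b')%E -> (a <= b)%E.
Proof. by move=> e0 ef -> ->; rewrite lee_pmul2l. Qed.

(** * The saddle point after lambda *)

Section game_with_partial_information.
Context {R : realType} {d : measure_display} {Omega : measurableType d}.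
Variables (P : probability Omega R) (T : R) (FF F1 F2 : R -> set (set Omega)).
Variables (f g h : R -> Omega -> R) (lambda : Omega -> R).
Hypotheses (T_gt0 : 0 < T) (P_complete : measure_is_complete P)
  (FF_filtration : usual_filtration P T FF)
  (F1_filtration : usual_filtration P T F1) (F2_filtration : usual_filtration P T F2)
  (F12_sub : forall t, 0 <= t <= T -> <<s F1 t `|` F2 t >> `<=` FF t)
  (f_Lb : Lb P T f) (g_Lb : Lb P T g) (h_Lb : Lb P T h)
  (f_adapted : adapted T FF f) (g_adapted : adapted T FF g) (h_adapted : adapted T FF h)
  (lambda_stopping : stopping_times T (fun t => F1 t `&` F2 t) (cst 0) lambda).

(** The devices are independent of [FF T] only, so this is the space on which they are averaged
    out. *)
Local Notation S := (g_sigma_algebraType (FF T)).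

Let TT : 0 <= T <= T. Proof. by rewrite lexx ltW. Qed.
Let sFF : sigma_algebra setT (FF T). Proof. exact: (filtration_sigma_algebra FF_filtration TT). Qed.
Let FFm : FF T `<=` d.-measurable. Proof. exact: (filtration_sub FF_filtration TT). Qed.

Let FF_T t : 0 <= t <= T -> FF t `<=` FF T.
Proof. by move=> /andP[t0 tT]; exact: (filtration_mono FF_filtration t0 tT (lexx T)). Qed.

Let F1_FF t : 0 <= t <= T -> F1 t `<=` FF t.
Proof. by move=> tT A FA; apply: F12_sub => //; apply: sub_gen_smallest; left. Qed.

Let F2_FF t : 0 <= t <= T -> F2 t `<=` FF t.
Proof. by move=> tT A FA; apply: F12_sub => //; apply: sub_gen_smallest; right. Qed.

Let miota : measurable_fun setT (idfun : Omega -> S).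
Proof. exact: measurable_subidfun. Qed.

Let adapted_S (F : R -> set (set Omega)) X t : (forall t, 0 <= t <= T -> F t `<=` FF t) ->
  adapted T F X -> 0 <= t <= T -> measurable_fun setT (X t : S -> R).
Proof.
move=> FFF ax tT; apply: (measurable_wrtW sFF) => B mB.
by apply: (FF_T tT); apply: (FFF _ tT); exact: ax.
Qed.

Lemma lambda_itv w : 0 <= lambda w <= T.
Proof. by have [/(_ w)] := lambda_stopping. Qed.

Let lambda_F1 t : 0 <= t <= T -> F1 t [set w | lambda w <= t].
Proof. by move=> tT; have [_ /(_ t tT)[]] := lambda_stopping. Qed.

Let lambda_F2 t : 0 <= t <= T -> F2 t [set w | lambda w <= t].
Proof. by move=> tT; have [_ /(_ t tT)[]] := lambda_stopping. Qed.

Let mlambda : measurable_fun setT (lambda : S -> R).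
Proof.
apply: measurable_fun_gt_set => c.
have [c0|c0] := ltP c 0.
  rewrite (_ : [set _ | _] = setT); first exact: measurableT.
  by apply/seteqP; split => // w _ /=; apply: lt_le_trans c0 _; case/andP: (lambda_itv w).
have [cT|cT] := leP c T; last first.
  rewrite (_ : [set _ | _] = set0); first exact: measurable0.
  apply/seteqP; split => // w /= /(lt_trans cT); apply/negP; rewrite -leNgt.
  by case/andP: (lambda_itv w).
have cT' : 0 <= c <= T by rewrite c0.
rewrite (_ : [set _ | _] = ~` [set w | lambda w <= c]).
  apply: measurableC; apply: (sub_measurableE sFF _).1.
  by apply: (FF_T cT'); apply: (F1_FF cT'); exact: lambda_F1.
by apply/seteqP; split => w /=; rewrite ltNge => /negP.
Qed.

Lemma payoff_dominated : exists2 M : Omega -> R, P.-integrable setT (EFin \o M) &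
  \forall w \ae P, forall t, 0 <= t <= T ->
    [/\ `|f t w| <= M w, `|g t w| <= M w & `|h t w| <= M w].
Proof.
have mX X : adapted T FF X -> forall t, 0 <= t <= T -> measurable_fun setT (X t : Omega -> R).
  move=> aX t tT; apply: measurable_wrt_fun (aX t tT).
  exact: (filtration_sub FF_filtration tT).
have [Mf iMf fM] := Lb_dominated T_gt0 f_Lb (mX _ f_adapted).
have [Mg iMg gM] := Lb_dominated T_gt0 g_Lb (mX _ g_adapted).
have [Mh iMh hM] := Lb_dominated T_gt0 h_Lb (mX _ h_adapted).
exists (fun w => `|Mf w| + `|Mg w| + `|Mh w|).
  have a M' : P.-integrable setT (EFin \o M') -> P.-integrable setT (fun w => `|M' w|%:E).
    by move=> iM; exact: integrable_norm.
  exact: (integrableD measurableT (integrableD measurableT (a _ iMf) (a _ iMg)) (a _ iMh)).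
apply: filterS3 fM gM hM => w fM gM hM t tT; split.
- by apply: (le_trans (fM t tT)); rewrite (le_trans (ler_norm _))// -addrA lerDl addr_ge0.
- apply: (le_trans (gM t tT)); rewrite (le_trans (ler_norm _))//.
  by rewrite -addrA addrCA lerDl addr_ge0.
- by apply: (le_trans (hM t tT)); rewrite (le_trans (ler_norm _))// lerDr addr_ge0.
Qed.

Let joint X : (forall w, cadlag T (X^~ w)) -> adapted T FF X ->
  measurable_fun setT (fun c : R * S => if 0 <= c.1 <= T then X c.1 c.2 else 0).
Proof.
move=> cX aX; apply: cadlag_jointly_measurable => // t tT.
exact: (@adapted_S FF X t (fun _ _ => @subset_refl _ _) aX tT).
Qed.

Let jf := joint (let: And3 c _ _ := f_Lb in c) f_adapted.
Let jg := joint (let: And3 c _ _ := g_Lb in c) g_adapted.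
Let jh := joint (let: And3 c _ _ := h_Lb in c) h_adapted.

(** Regularised controls: the requirements hold on every path. The left limit at [lambda] is treated
    separately, where it matters. *)
Definition pathwise_control (F : R -> set (set Omega)) (x : R -> Omega -> R) :=
  adapted T F x /\ forall w, distribution_path T (x^~ w).

(** An integrable stand-in for the pathwise payoff, equal to it almost surely by
    [payoff_from_ae]. *)
Definition payoff_from (theta : Omega -> R) (x z : R -> Omega -> R) : Omega -> R :=
  @payoff_kernel R T _ S f g h theta x z.

Section pathwise_controls.
Variables (theta : Omega -> R) (x z : R -> Omega -> R).
Hypotheses (nx : pathwise_control F1 x) (nz : pathwise_control F2 z).
Hypotheses (mtheta : measurable_fun setT (theta : S -> R))
  (theta_itv : forall w, 0 <= theta w <= T).

Let dx : forall s : S, distribution_path T (x^~ s) := nx.2.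
Let dz : forall s : S, distribution_path T (z^~ s) := nz.2.
Let mx t : 0 <= t <= T -> measurable_fun setT (x t : S -> R).
Proof. exact: (adapted_S F1_FF nx.1). Qed.
Let mz t : 0 <= t <= T -> measurable_fun setT (z t : S -> R).
Proof. exact: (adapted_S F2_FF nz.1). Qed.

Lemma integrable_payoff_from : P.-integrable setT (EFin \o payoff_from theta x z).
Proof.
have [M iM fghM] := payoff_dominated.
exact: (@integrable_payoff_kernel R T _ S f g h theta x z T_gt0 dx dz mx mz jf jg jh mtheta
  _ Omega P idfun M miota iM fghM).
Qed.

Lemma payoff_from_ae : \forall w \ae P, payoff_from theta x z w =
  path_payoff T (f^~ w) (g^~ w) (h^~ w) (theta w) (x^~ w) (z^~ w).
Proof.
have [M iM fghM] := payoff_dominated.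
exact: (@payoff_kernel_ae R T _ S f g h theta x z T_gt0 dx dz jf jg jh mtheta theta_itv
  _ Omega P idfun M fghM).
Qed.

End pathwise_controls.

Lemma bounded_payoffs_ae : \forall w \ae P,
  [/\ bounded_path T (f^~ w), bounded_path T (g^~ w) & bounded_path T (h^~ w)].
Proof.
have [M iM fghM] := payoff_dominated.
apply: filterS fghM => w H; split.
- by apply: (section_bounded_path (S := S) (M := M w) jf) => t /H[].
- by apply: (section_bounded_path (S := S) (M := M w) jg) => t /H[].
- by apply: (section_bounded_path (S := S) (M := M w) jh) => t /H[].
Qed.

Lemma pathwise_regular_control1 theta x : controls P T F1 theta x -> pathwise_control F1 (regular_control T x).
Proof.
move=> cx; split; last exact: regular_control_path cx.
exact: (regular_control_adapted F1_filtration cx).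
Qed.

Lemma pathwise_regular_control2 theta z : controls P T F2 theta z -> pathwise_control F2 (regular_control T z).
Proof.
move=> cz; split; last exact: regular_control_path cz.
exact: (regular_control_adapted F2_filtration cz).
Qed.

Let mcst0 : measurable_fun setT (cst 0 : S -> R). Proof. exact: measurable_cst. Qed.

(** The right-hand side does not mention the devices: the expected payoff depends on the controls
    only, and regularisation affects a null event. *)
Lemma expectation_payoff x z (Z1 Z2 : {RV P >-> R}) :
  controls P T F1 (cst 0) x -> controls P T F2 (cst 0) z ->
  randomisation_devices (FF T) Z1 Z2 ->
  ('E_P[payoff f g h (randomised_time T x Z1) (randomised_time T z Z2)] =
   \int[P]_w (payoff_from (cst 0) (regular_control T x) (regular_control T z) w)%:E)%E.
Proof.
move=> cx cz [uZ1 uZ2 ind].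
have [M iM fghM] := payoff_dominated.
have nx := pathwise_regular_control1 cx; have nz := pathwise_regular_control2 cz.
set x' := regular_control T x in nx *; set z' := regular_control T z in nz *.
have mx t : 0 <= t <= T -> measurable_fun setT (x' t : S -> R) := adapted_S F1_FF nx.1.
have mz t : 0 <= t <= T -> measurable_fun setT (z' t : S -> R) := adapted_S F2_FF nz.1.
have indep (A : set S) (B1 B2 : set R) : measurable A -> measurable B1 -> measurable B2 ->
    (P (idfun @^-1` A `&` Z1 @^-1` B1 `&` Z2 @^-1` B2) =
     P (idfun @^-1` A) * unif B1 * unif B2)%E.
  move=> mA mB1 mB2; rewrite [X in P X](_ : _ = Z1 @^-1` B1 `&` Z2 @^-1` B2 `&` A); last first.
    by rewrite [LHS]setIC [LHS]setIC -[LHS]setIA setIC.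
  rewrite ind//; last exact: (sub_measurableE sFF _).2.
  have := uZ1 _ mB1; have := uZ2 _ mB2; rewrite /distribution /pushforward => -> ->.
  by rewrite muleC muleA.
have E1 := @expectation_payoff_kernel R T _ S f g h (cst 0) x' z' T_gt0 nx.2 nz.2 mx mz jf jg jh mcst0
  _ Omega P idfun Z1 Z2 M miota (measurable_funPT Z1) (measurable_funPT Z2) indep iM fghM erefl.
have mE := @measurable_randomised_payoff R T _ S f g h (cst 0) x' z' T_gt0 nx.2 nz.2 mx mz jf jg jh mcst0
  _ Omega P idfun Z1 Z2 M miota (measurable_funPT Z1) (measurable_funPT Z2) iM fghM erefl.
rewrite /payoff_from [RHS]E1 unlock.
have ae : \forall w \ae P, (randomised_payoff T f g h x' z' idfun Z1 Z2 w)%:E =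
    (payoff f g h (randomised_time T x Z1) (randomised_time T z Z2) w)%:E.
  apply: filterS2 (regular_control_ae cx) (regular_control_ae cz) => w ex ez.
  have e1 : quantile T (x'^~ w) (Z1 w) = randomised_time T x Z1 w.
    by congr (quantile T _ _); apply/funext => t; rewrite /x' ex.
  have e2 : quantile T (z'^~ w) (Z2 w) = randomised_time T z Z2 w.
    by congr (quantile T _ _); apply/funext => t; rewrite /z' ez.
  by rewrite /randomised_payoff /payoff /= e1 e2.
apply: ae_eq_integral => //.
(* The payoff of the original controls agrees with a measurable variable almost surely only;
   completeness of [P] makes it measurable. *)
- apply: (ae_measurable_fun P_complete (f := EFin \o randomised_payoff T f g h x' z' idfun Z1 Z2)).
    by apply: filterS ae => w h' _; exact: h'.
  exact/measurable_EFinP.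
- exact/measurable_EFinP.
- by apply: filterS ae => w h' _; exact/esym/h'.
Qed.

Lemma regular_control_id F x : pathwise_control F x -> regular_control T x = x.
Proof.
by move=> [_ dx]; apply/funext => t; apply/funext => w;
  rewrite /regular_control (dpath_end (dx w)) eqxx.
Qed.

(** * Optimality at time 0 and deviations from [lambda] on *)

Section saddle_point.
Variables (xi0 zeta0 : R -> Omega -> R).
Hypothesis optimal : optimal_pair P T FF F1 F2 f g h xi0 zeta0.
Let xi := regular_control T xi0.
Let zeta := regular_control T zeta0.

Lemma saddle_point1 x : pathwise_control F1 x ->
  (\int[P]_w (payoff_from (cst 0) xi zeta w)%:E <= \int[P]_w (payoff_from (cst 0) x zeta w)%:E)%E.
Proof.
move=> nx; have [cxi czeta [Z1 [Z2 [dev _ H]]]] := optimal.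
have cx : controls P T F1 (cst 0) x by apply: controls0_of => //; case: nx.
have E1 := expectation_payoff cxi czeta dev.
have E2 := expectation_payoff cx czeta dev.
rewrite (regular_control_id nx) in E2.
(* The deviating player keeps the device of the optimal strategy, so [dev] serves for both
   payoffs. *)
have := H Z1 (randomised_time T x Z1) dev (ex_intro2 _ _ x cx erefl).
exact: (le_subst E1 E2).
Qed.

Lemma saddle_point2 z : pathwise_control F2 z ->
  (\int[P]_w (payoff_from (cst 0) xi z w)%:E <= \int[P]_w (payoff_from (cst 0) xi zeta w)%:E)%E.
Proof.
move=> nz; have [cxi czeta [Z1 [Z2 [dev H _]]]] := optimal.
have cz : controls P T F2 (cst 0) z by apply: controls0_of => //; case: nz.
have E1 := expectation_payoff cxi czeta dev.
have E2 := expectation_payoff cxi cz dev.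
rewrite (regular_control_id nz) in E2.
have := H Z2 (randomised_time T z Z2) dev (ex_intro2 _ _ z cz erefl).
exact: (le_subst E2 E1).
Qed.

Let cxi : controls P T F1 (cst 0) xi0. Proof. by case: optimal. Qed.
Let czeta : controls P T F2 (cst 0) zeta0. Proof. by case: optimal. Qed.
Let nxi : pathwise_control F1 xi. Proof. exact: pathwise_regular_control1 cxi. Qed.
Let nzeta : pathwise_control F2 zeta. Proof. exact: pathwise_regular_control2 czeta. Qed.

Let G := common_at T F1 F2 lambda.

Let sF1 t : 0 <= t <= T -> sigma_algebra setT (F1 t).
Proof. exact: (filtration_sigma_algebra F1_filtration). Qed.
Let sF2 t : 0 <= t <= T -> sigma_algebra setT (F2 t).
Proof. exact: (filtration_sigma_algebra F2_filtration). Qed.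

Let sG : sigma_algebra setT G.
Proof.
apply: sigma_algebra_stopped; first exact: ltW.
  by move=> t tT; apply: sigma_algebraI; [exact: sF1|exact: sF2].
by move=> t tT; split; [exact: lambda_F1|exact: lambda_F2].
Qed.

Let Gm : G `<=` d.-measurable.
Proof. by move=> A [[F1A _] _]; exact: (filtration_sub F1_filtration TT F1A). Qed.

Let G_F1 A t : G A -> 0 <= t <= T -> F1 t (A `&` [set w | lambda w <= t]).
Proof. by move=> [_ GA] /GA[]. Qed.

Let G_F2 A t : G A -> 0 <= t <= T -> F2 t (A `&` [set w | lambda w <= t]).
Proof. by move=> [_ GA] /GA[]. Qed.

Lemma pathwise_trunc1 x : pathwise_control F1 x -> pathwise_control F1 (trunc_control T lambda x).
Proof.
move=> [ax dx]; split; first refine (trunc_control_adapted T_gt0 F1_filtration lambda_F1 ax dx).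
by move=> w; refine (distribution_path_trunc T_gt0 (dx w) (lambda_itv w)).
Qed.

Lemma pathwise_trunc2 x : pathwise_control F2 x -> pathwise_control F2 (trunc_control T lambda x).
Proof.
move=> [ax dx]; split; first refine (trunc_control_adapted T_gt0 F2_filtration lambda_F2 ax dx).
by move=> w; refine (distribution_path_trunc T_gt0 (dx w) (lambda_itv w)).
Qed.

Lemma left_lim_trunc_control F x w : pathwise_control F x ->
  left_lim T ((trunc_control T lambda x)^~ w) (lambda w) = 0.
Proof. by move=> [_ dx]; refine (left_lim_trunc T_gt0 (dx w) (lambda_itv w)). Qed.

Lemma pathwise_conc F y x A : (forall w, distribution_path T (y^~ w)) ->
  (forall w, distribution_path T (x^~ w)) ->
  adapted T F (conc_control T lambda y x A) -> pathwise_control F (conc_control T lambda y x A).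
Proof.
move=> dy dx ac; split => // w; rewrite /conc_control; case: (w \in A); last exact: dy.
by apply: distribution_path_conc => //; exact: lambda_itv.
Qed.

Lemma pathwise_conc1 x A : pathwise_control F1 x -> G A -> pathwise_control F1 (conc_control T lambda xi x A).
Proof.
move=> [ax dx] GA; apply: pathwise_conc => //; first exact: nxi.2.
apply: (conc_control_adapted T_gt0 F1_filtration lambda_F1 nxi.1 nxi.2 ax).
by move=> t; exact: G_F1.
Qed.

Lemma pathwise_conc2 x A : pathwise_control F2 x -> G A -> pathwise_control F2 (conc_control T lambda zeta x A).
Proof.
move=> [ax dx] GA; apply: pathwise_conc => //; first exact: nzeta.2.
apply: (conc_control_adapted T_gt0 F2_filtration lambda_F2 nzeta.1 nzeta.2 ax).
by move=> t; exact: G_F2.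
Qed.

(** Not deviating is itself a concatenation, so [payoff_conc_ae] covers the deviations of either
    player alone. *)
Lemma conc_trunc_control F x A : pathwise_control F x ->
  conc_control T lambda x (trunc_control T lambda x) A = x.
Proof.
move=> [_ dx]; apply/funext => t; apply/funext => w; rewrite /conc_control.
by case: (w \in A) => //; refine (conc_trunc T_gt0 (dx w) (lambda_itv w) t).
Qed.

Let Sv := survival T xi zeta lambda.
Let trxi := trunc_control T lambda xi.
Let trzeta := trunc_control T lambda zeta.
Let ntrxi : pathwise_control F1 trxi. Proof. exact: pathwise_trunc1. Qed.
Let ntrzeta : pathwise_control F2 trzeta. Proof. exact: pathwise_trunc2. Qed.

Let zero_itv (w : Omega) : 0 <= (cst 0 w : R) <= T. Proof. by rewrite /= lexx ltW. Qed.

Lemma payoff_conc_ae x z A : pathwise_control F1 x -> pathwise_control F2 z -> G A ->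
  (forall w, left_lim T (x^~ w) (lambda w) = 0) ->
  (forall w, left_lim T (z^~ w) (lambda w) = 0) ->
  \forall w \ae P,
    payoff_from (cst 0) (conc_control T lambda xi x A) (conc_control T lambda zeta z A) w =
    if w \in A then payoff_from (cst 0) xi zeta w +
      (Sv w * payoff_from lambda x z w - Sv w * payoff_from lambda trxi trzeta w)
    else payoff_from (cst 0) xi zeta w.
Proof.
move=> nx nz GA x0 z0.
have h1 := payoff_from_ae (pathwise_conc1 nx GA) (pathwise_conc2 nz GA) mcst0 zero_itv.
have h2 := payoff_from_ae nxi nzeta mcst0 zero_itv.
have h3 := payoff_from_ae nx nz mlambda lambda_itv.
have h4 := payoff_from_ae ntrxi ntrzeta mlambda lambda_itv.
apply: filterS3 bounded_payoffs_ae (ae_and h1 h2) (ae_and h3 h4) => w [bf bg bh] [-> ->] [-> ->].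
rewrite -mulrBr /conc_control; case: (w \in A) => //.
refine (path_payoff_conc T_gt0 bf bg bh (nxi.2 w) (nzeta.2 w) (lambda_itv w)
  (nx.2 w) (nz.2 w) (x0 w) (z0 w)).
Qed.

Let Sv01 w : 0 <= Sv w <= 1.
Proof.
have /andP[a0 a1] := left_lim_bound T_gt0 (nxi.2 w) (lambda w).
have /andP[b0 b1] := left_lim_bound T_gt0 (nzeta.2 w) (lambda w).
by rewrite mulr_ge0 ?subr_ge0//= mulr_ile1 ?subr_ge0// lerBlDr lerDl.
Qed.

Let measurable_left_lim F x : usual_filtration P T F ->
  (forall t, 0 <= t <= T -> F t [set w | lambda w <= t]) -> pathwise_control F x ->
  measurable_fun setT (fun w : Omega => left_lim T (x^~ w) (lambda w)).
Proof.
move=> fF Fl [ax dx].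
have sF := filtration_sigma_algebra fF TT.
have := left_lim_adapted T_gt0 fF Fl ax dx TT.
move/(measurable_wrtP sF)/(measurable_wrt_fun (filtration_sub fF TT)).
by apply: eq_measurable_fun => w _; have /andP[_ ->] := lambda_itv w.
Qed.

Let mSv : measurable_fun setT (Sv : Omega -> R).
Proof.
apply: measurable_funM; apply: measurable_funB; try exact: measurable_cst.
- exact: measurable_left_lim F1_filtration lambda_F1 nxi.
- exact: measurable_left_lim F2_filtration lambda_F2 nzeta.
Qed.

Let iSv : P.-integrable setT (EFin \o Sv).
Proof.
apply: measurable_bounded_integrable => //; first by rewrite (le_lt_trans (probability_le1 P _))// ltry.
exists 1; split; first exact: num_real.
move=> M M1 w _; have /andP[s0 s1] := Sv01 w.
by rewrite /= ger0_norm// (le_trans s1)// ltW.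
Qed.

Let iSvM x z : pathwise_control F1 x -> pathwise_control F2 z ->
  P.-integrable setT (EFin \o (Sv \* payoff_from lambda x z)).
Proof.
move=> nx nz; have iY := integrable_payoff_from nx nz mlambda.
apply: le_integrable iY => //.
  apply/measurable_EFinP; apply: measurable_funM => //; apply/measurable_EFinP.
  exact: measurable_int (integrable_payoff_from nx nz mlambda).
move=> w _; rewrite lee_fin normrM; have /andP[s0 s1] := Sv01 w.
by rewrite ger0_norm// ler_piMl.
Qed.

(* A deviation from lambda on, restricted to an event A of the common information, turns
   optimality at time 0 into an inequality between integrals over A. *)
Lemma le_value1 x A : pathwise_control F1 x -> (forall w, left_lim T (x^~ w) (lambda w) = 0) -> G A ->
  (\int[P]_(w in A) (Sv w * payoff_from lambda trxi trzeta w)%:E <=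
   \int[P]_(w in A) (Sv w * payoff_from lambda x trzeta w)%:E)%E.
Proof.
move=> nx x0 GA.
have nc := pathwise_conc1 nx GA.
have z0 w := left_lim_trunc_control w nzeta.
have := payoff_conc_ae nx ntrzeta GA x0 z0.
rewrite (conc_trunc_control A nzeta) => H.
have iU := integrable_payoff_from nxi nzeta mcst0.
have iW := integrable_payoff_from nc nzeta mcst0.
exact: (le_integral_perturbation (Gm GA) iU iW (iSvM ntrxi ntrzeta) (iSvM nx ntrzeta) H
  (saddle_point1 nc)).
Qed.

Lemma le_value2 z A : pathwise_control F2 z -> (forall w, left_lim T (z^~ w) (lambda w) = 0) -> G A ->
  (\int[P]_(w in A) (Sv w * payoff_from lambda trxi z w)%:E <=
   \int[P]_(w in A) (Sv w * payoff_from lambda trxi trzeta w)%:E)%E.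
Proof.
move=> nz z0 GA.
have nc := pathwise_conc2 nz GA.
have x0 w := left_lim_trunc_control w nxi.
have := payoff_conc_ae ntrxi nz GA x0 z0.
rewrite (conc_trunc_control A nxi) => H.
have iU := integrable_payoff_from nxi nzeta mcst0.
have iW := integrable_payoff_from nxi nc mcst0.
(* The deviation is now the smaller side, so the optimal payoff is written as a perturbation of the
   deviating one. *)
apply: (le_integral_perturbation (Gm GA) iW iU (iSvM ntrxi nz) (iSvM ntrxi ntrzeta) _
  (saddle_point2 nc)).
by apply: filterS H => w ->; case: (w \in A) => //; exact: perturbation_sym.
Qed.

(** Completeness transfers measurability from [X] to [Y]; equality then holds as functions, by
    [cond_exp_congr]. *)
Lemma cond_exp_ae (X Y : Omega -> R) : measurable_fun setT X ->
  (\forall w \ae P, Y w = X w) -> cond_exp P G (EFin \o Y) = cond_exp P G (EFin \o X).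
Proof.
move=> mX YX; have mX' : measurable_fun setT (EFin \o X) by exact/measurable_EFinP.
apply: (cond_exp_congr Gm) => //; last by apply: filterS YX => w /= ->.
apply: (ae_measurable_fun P_complete _ mX').
by apply: filterS YX => w /= -> _.
Qed.

Let xi0_ae : \forall w \ae P, xi0^~ w = xi^~ w.
Proof. by apply: filterS (regular_control_ae cxi) => w e; apply/funext => t; rewrite /xi e. Qed.

Let zeta0_ae : \forall w \ae P, zeta0^~ w = zeta^~ w.
Proof. by apply: filterS (regular_control_ae czeta) => w e; apply/funext => t; rewrite /zeta e. Qed.

Let E := cond_survival P T F1 F2 xi0 zeta0 lambda.
Let Pi := PiStar P T F1 F2 xi0 zeta0 lambda.

Let survival_ae : \forall w \ae P, survival T xi0 zeta0 lambda w = Sv w.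
Proof. by apply: filterS2 xi0_ae zeta0_ae => w e1 e2; rewrite /Sv /survival e1 e2. Qed.

Let EE : E = cond_exp P G (EFin \o Sv).
Proof. exact: (cond_exp_ae mSv survival_ae). Qed.

Let Pi' w := ratio1 (Sv w) (fine (cond_exp P G (EFin \o Sv) w)).

Let mPi' : measurable_fun setT (Pi' : Omega -> R).
Proof.
apply: measurable_fun_ratio1; first exact: mSv.
apply: (@measurableT_comp _ _ _ _ _ _ (@fine R)); first exact: fine_measurable.
exact: cond_exp_measurable.
Qed.

Let Pi_ae : \forall w \ae P, Pi w = Pi' w.
Proof. by apply: filterS survival_ae => w e; rewrite /Pi /PiStar -/E e EE. Qed.

Let mpf x z : pathwise_control F1 x -> pathwise_control F2 z -> measurable_fun setT (payoff_from lambda x z : Omega -> R).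
Proof.
move=> nx nz; apply/measurable_EFinP.
exact: measurable_int (integrable_payoff_from nx nz mlambda).
Qed.

(** For given [x] and [z] the integrand of [J] is not known to be measurable; it is traded for that
    of pathwise controls with almost surely the same payoff. *)
Lemma J_pathwise x z x' z' : pathwise_control F1 x' -> pathwise_control F2 z' ->
  (\forall w \ae P, path_payoff T (f^~ w) (g^~ w) (h^~ w) (lambda w) (x^~ w) (z^~ w) =
     path_payoff T (f^~ w) (g^~ w) (h^~ w) (lambda w) (x'^~ w) (z'^~ w)) ->
  J P T f g h lambda Pi G x z = cond_exp P G (EFin \o (Pi' \* payoff_from lambda x' z')).
Proof.
move=> nx nz e.
have m : measurable_fun setT (Pi' \* payoff_from lambda x' z' : Omega -> R).
  by apply: measurable_funM; [exact: mPi'|exact: mpf].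
have H : \forall w \ae P, Pi w * path_payoff T (f^~ w) (g^~ w) (h^~ w) (lambda w) (x^~ w) (z^~ w)
    = (Pi' \* payoff_from lambda x' z') w.
  by apply: filterS3 Pi_ae e (payoff_from_ae nx nz mlambda lambda_itv) => w -> -> /= ->.
exact: (cond_exp_ae m H).
Qed.

(** With zero left limits both remaining masses are 1, and the factor in [path_payoff_trunc]
    disappears. *)
Let payoff_trunc_ae x z : pathwise_control F1 x -> pathwise_control F2 z ->
  (\forall w \ae P, left_lim T (x^~ w) (lambda w) = 0) ->
  (\forall w \ae P, left_lim T (z^~ w) (lambda w) = 0) ->
  \forall w \ae P, path_payoff T (f^~ w) (g^~ w) (h^~ w) (lambda w) (x^~ w) (z^~ w) =
     path_payoff T (f^~ w) (g^~ w) (h^~ w) (lambda w)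
       ((trunc_control T lambda x)^~ w) ((trunc_control T lambda z)^~ w).
Proof.
move=> nx nz hx hz.
apply: filterS3 bounded_payoffs_ae hx hz => w [bf bg bh] x0 z0.
have := path_payoff_trunc T_gt0 bf bg bh (nx.2 w) (nz.2 w) (lambda_itv w).
by rewrite x0 z0 subr0 !mul1r.
Qed.

Lemma trunc_controlK F x : pathwise_control F x ->
  trunc_control T lambda (trunc_control T lambda x) = trunc_control T lambda x.
Proof.
move=> nx; apply/funext => t; apply/funext => w.
rewrite {1}/trunc_control /trunc_path (left_lim_trunc_control w nx) !subr0 /ratio1 oner_eq0 divr1.
by rewrite /trunc_control /trunc_path; case: (lambda w <= t).
Qed.

Let V := value P T F1 F2 f g h xi0 zeta0 lambda.

Lemma J_pathwise_id x z : pathwise_control F1 x -> pathwise_control F2 z ->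
  J P T f g h lambda Pi G x z = cond_exp P G (EFin \o (Pi' \* payoff_from lambda x z)).
Proof. by move=> nx nz; apply: (J_pathwise nx nz); exact: aeW. Qed.

Let VE : V = J P T f g h lambda Pi G trxi trzeta.
Proof.
apply: (etrans _ (esym (J_pathwise_id ntrxi ntrzeta))).
apply: (J_pathwise ntrxi ntrzeta).
apply: filterS2 xi0_ae zeta0_ae => w e1 e2.
have t1 : (truncated T xi0 lambda)^~ w = trxi^~ w by rewrite /trxi /trunc_control -e1.
have t2 : (truncated T zeta0 lambda)^~ w = trzeta^~ w by rewrite /trzeta /trunc_control -e2.
exact: (f_equal2 (fun a b => path_payoff T (f^~ w) (g^~ w) (h^~ w) (lambda w) a b) t1 t2).
Qed.

Let Sv_ge0 : \forall w \ae P, 0 <= Sv w.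
Proof. by apply: aeW => w; case/andP: (Sv01 w). Qed.

(** This is what the weight [Pi] is made for: multiplication by [E] turns it back into the survival
    product inside the conditional expectation. *)
Lemma cond_exp_survival x z : pathwise_control F1 x -> pathwise_control F2 z ->
  \forall w \ae P, cond_exp P G (EFin \o (Sv \* payoff_from lambda x z)) w =
    (E w * J P T f g h lambda Pi G x z w)%E.
Proof.
move=> nx nz.
have H := cond_exp_ratio sG Gm iSv Sv_ge0 (integrable_payoff_from nx nz mlambda) (iSvM nx nz).
pose C := cond_exp P G (EFin \o (Sv \* payoff_from lambda x z)).
have {}H := eq_ind _ (fun e => \forall w \ae P, C w = (e w * _)%E) H _ (esym EE).
exact: (eq_ind _ (fun c => \forall w \ae P, C w = (E w * c w)%E) H _ (esym (J_pathwise_id nx nz))).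
Qed.

(** The integrand of [value_bar] is, almost surely, the payoff of the optimal pair from [lambda] on,
    which is the survival product times that of the truncated pair. *)
Lemma value_bar_survival : \forall w \ae P,
  value_bar P T F1 F2 f g h xi0 zeta0 lambda w = (E w * V w)%E.
Proof.
have m : measurable_fun setT (Sv \* payoff_from lambda trxi trzeta : Omega -> R).
  by apply: measurable_funM; [exact: mSv|exact: mpf].
have -> : value_bar P T F1 F2 f g h xi0 zeta0 lambda =
    cond_exp P G (EFin \o (Sv \* payoff_from lambda trxi trzeta)).
  apply: (cond_exp_ae m).
  apply: filterS3 (ae_and xi0_ae zeta0_ae) bounded_payoffs_ae
    (payoff_from_ae ntrxi ntrzeta mlambda lambda_itv) => w [e1 e2] [bf bg bh] ep.
  apply: (etrans _ (congr1 (fun a => Sv w * a) (esym ep))).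
  have dx : distribution_path T (xi0^~ w) by rewrite e1; exact: nxi.2.
  have dz : distribution_path T (zeta0^~ w) by rewrite e2; exact: nzeta.2.
  apply: (etrans (path_payoff_bar T_gt0 (f^~ w) bg bh dx dz (lambda_itv w))).
  rewrite e1 e2.
  by refine (path_payoff_trunc T_gt0 bf bg bh (nxi.2 w) (nzeta.2 w) (lambda_itv w)).
by rewrite VE; exact: (cond_exp_survival ntrxi ntrzeta).
Qed.

(** Inequalities over all events of [G] pass to conditional expectations, and the factor [E], almost
    surely finite, cancels where it is positive. *)
Lemma J_le x z x' z' : pathwise_control F1 x -> pathwise_control F2 z -> pathwise_control F1 x' -> pathwise_control F2 z' ->
  (forall A, G A -> \int[P]_(w in A) (Sv w * payoff_from lambda x z w)%:E <=
    \int[P]_(w in A) (Sv w * payoff_from lambda x' z' w)%:E)%E ->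
  \forall w \ae P, (0 < E w)%E ->
    (J P T f g h lambda Pi G x z w <= J P T f g h lambda Pi G x' z' w)%E.
Proof.
move=> nx nz nx' nz' le.
have H := cond_exp_le sG Gm (iSvM nx nz) (iSvM nx' nz') le.
have Ef := cond_exp_fin_num sG Gm iSv; rewrite -EE in Ef.
apply: filterS3 (ae_and H Ef) (cond_exp_survival nx nz) (cond_exp_survival nx' nz').
by move=> w [le_w Ew] e1 e2 E0; exact: (le_pmul2l_eq E0 Ew e1 e2 le_w).
Qed.

(** A competitor has left limit 0 at [lambda] almost surely only, while [le_value1] asks for it on
    every path. Regularising and then truncating achieves this without changing [J]. *)
Lemma value_minimises x : controls P T F1 lambda x -> \forall w \ae P, (0 < E w)%E ->
  (J P T f g h lambda Pi G trxi trzeta w <= J P T f g h lambda Pi G x trzeta w)%E.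
Proof.
move=> cx; have nx := pathwise_regular_control1 cx; have ntx := pathwise_trunc1 nx.
have rx := regular_control_ae cx.
have x0 : \forall w \ae P, left_lim T ((regular_control T x)^~ w) (lambda w) = 0.
  have [_ _ _ x0 _] := cx; apply: filterS2 rx x0 => w e <-; congr (left_lim T _ _).
  by apply/funext => t; exact: e.
have z0 : \forall w \ae P, left_lim T (trzeta^~ w) (lambda w) = 0.
  by apply: aeW => w; exact: left_lim_trunc_control nzeta.
have -> : J P T f g h lambda Pi G x trzeta =
    J P T f g h lambda Pi G (trunc_control T lambda (regular_control T x)) trzeta.
  apply: (etrans _ (esym (J_pathwise_id ntx ntrzeta))).
  apply: (J_pathwise ntx ntrzeta).
  have := payoff_trunc_ae nx ntrzeta x0 z0; rewrite (trunc_controlK nzeta).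
  apply: filterS2 rx => w e; apply: etrans.
  have ew : x^~ w = (regular_control T x)^~ w by apply/funext => t; rewrite e.
  exact: (f_equal (fun a => path_payoff T (f^~ w) (g^~ w) (h^~ w) (lambda w) a (trzeta^~ w)) ew).
apply: (J_le ntrxi ntrzeta ntx ntrzeta) => A GA.
by apply: (le_value1 ntx _ GA) => w; exact: (left_lim_trunc_control w nx).
Qed.

Lemma value_maximises z : controls P T F2 lambda z -> \forall w \ae P, (0 < E w)%E ->
  (J P T f g h lambda Pi G trxi z w <= J P T f g h lambda Pi G trxi trzeta w)%E.
Proof.
move=> cz; have nz := pathwise_regular_control2 cz; have ntz := pathwise_trunc2 nz.
have rz := regular_control_ae cz.
have z0 : \forall w \ae P, left_lim T ((regular_control T z)^~ w) (lambda w) = 0.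
  have [_ _ _ z0 _] := cz; apply: filterS2 rz z0 => w e <-; congr (left_lim T _ _).
  by apply/funext => t; exact: e.
have x0 : \forall w \ae P, left_lim T (trxi^~ w) (lambda w) = 0.
  by apply: aeW => w; exact: left_lim_trunc_control nxi.
have -> : J P T f g h lambda Pi G trxi z =
    J P T f g h lambda Pi G trxi (trunc_control T lambda (regular_control T z)).
  apply: (etrans _ (esym (J_pathwise_id ntrxi ntz))).
  apply: (J_pathwise ntrxi ntz).
  have := payoff_trunc_ae ntrxi nz x0 z0; rewrite (trunc_controlK nxi).
  apply: filterS2 rz => w e; apply: etrans.
  have ew : z^~ w = (regular_control T z)^~ w by apply/funext => t; rewrite e.
  exact: (f_equal (fun a => path_payoff T (f^~ w) (g^~ w) (h^~ w) (lambda w) (trxi^~ w) a) ew).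
apply: (J_le ntrxi ntz ntrxi ntrzeta) => A GA.
by apply: (le_value2 ntz _ GA) => w; exact: (left_lim_trunc_control w nz).
Qed.

Lemma value_upper_lower : \forall w \ae P, (0 < E w)%E ->
  V w = upper_value P T F1 F2 f g h lambda Pi w /\
  upper_value P T F1 F2 f g h lambda Pi w = lower_value P T F1 F2 f g h lambda Pi w.
Proof.
have c1 : controls P T F1 lambda trxi.
  apply: controls_of; [exact: ntrxi.1|exact: ntrxi.2|].
  by apply: aeW => w; exact: left_lim_trunc_control nxi.
have c2 : controls P T F2 lambda trzeta.
  apply: controls_of; [exact: ntrzeta.1|exact: ntrzeta.2|].
  by apply: aeW => w; exact: left_lim_trunc_control nzeta.
have mD : measurable [set w | (0 < E w)%E].
  have mE : measurable_fun setT E by exact: cond_exp_measurable.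
  by rewrite -[X in measurable X]setTI; exact: emeasurable_fun_o_infty.
have mJ x z : measurable_fun setT (J P T f g h lambda Pi G x z) by exact: cond_exp_measurable.
rewrite VE.
exact: (saddle_essinf_esssup mJ mD c1 c2 value_minimises value_maximises).
Qed.

End saddle_point.

End game_with_partial_information.

Theorem corollary3p13
  (R : realType) (d : measure_display) (Omega : measurableType d)
  (P : probability Omega R) (T : R)
  (FF F1 F2 : R -> set (set Omega)) (f g h : R -> Omega -> R)
  (xi zeta : R -> Omega -> R) (lambda : Omega -> R)
  (T_gt0 : 0 < T)
  (P_complete : measure_is_complete P)
  (FF_filtration : usual_filtration P T FF)
  (FF_proper : FF T `<` d.-measurable)
  (F1_filtration : usual_filtration P T F1)
  (F2_filtration : usual_filtration P T F2)
  (F12_sub : forall t, 0 <= t <= T -> <<s F1 t `|` F2 t >> `<=` FF t)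
  (f_Lb : Lb P T f) (g_Lb : Lb P T g) (h_Lb : Lb P T h)
  (f_adapted : adapted T FF f) (g_adapted : adapted T FF g)
  (h_adapted : adapted T FF h)
  (fhg : \forall w \ae P, forall t, 0 <= t <= T -> g t w <= h t w <= f t w)
  (optimal : optimal_pair P T FF F1 F2 f g h xi zeta)
  (lambda_stopping :
    stopping_times T (fun t => F1 t `&` F2 t) (cst 0) lambda) :
  let Pi := PiStar P T F1 F2 xi zeta lambda in
  let V := value P T F1 F2 f g h xi zeta lambda in
  let E := cond_survival P T F1 F2 xi zeta lambda in
  (\forall w \ae P, (0 < E w)%E ->
     V w = upper_value P T F1 F2 f g h lambda Pi w /\
     upper_value P T F1 F2 f g h lambda Pi w =
     lower_value P T F1 F2 f g h lambda Pi w) /\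
  (\forall w \ae P,
     value_bar P T F1 F2 f g h xi zeta lambda w = (E w * V w)%E).
Proof.
split.
- exact: (value_upper_lower T_gt0 P_complete FF_filtration F1_filtration F2_filtration F12_sub
    f_Lb g_Lb h_Lb f_adapted g_adapted h_adapted lambda_stopping optimal).
- exact: (value_bar_survival T_gt0 P_complete FF_filtration F1_filtration F2_filtration F12_sub
    f_Lb g_Lb h_Lb f_adapted g_adapted h_adapted lambda_stopping optimal).
Qed.
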